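(* Let $d\geq 1$, $1<p\leq 2<q<\infty$, $1\leq\theta\leq\infty$. Then, for $m\in\mathbb{N}$, $$ e_m(B^{r}_{p,\theta})_{B_{q,1}}\asymp \begin{cases} m^{-\frac{q}{2}\left(\frac{r}{d}-\frac{1}{p}+\frac{1}{q}\right)}, & d\left(\frac{1}{p}-\frac{1}{q}\right)<r<\frac{d}{p},\\[2mm] m^{-\frac{r}{d}+\frac{1}{p}-\frac{1}{2}}, & r>\frac{d}{p}. \end{cases} $$
   Context: $\mathbb{T}^d=[0,2\pi)^d$; $L_p(\mathbb{T}^d)$ is the space of functions $2\pi$-periodic in each variable with norm $\|f\|_p=\big((2\pi)^{-d}\int_{\mathbb{T}^d}|f|^p\big)^{1/p}$ ($1\le p<\infty$), $\|f\|_\infty=\operatorname{ess\,sup}|f|$. For $\boldsymbol h\in\mathbb{R}^d$, $\Delta_{\boldsymbol h}f(\boldsymbol x)=f(\boldsymbol x+\boldsymbol h)-f(\boldsymbol x)$, $\Delta^k_{\boldsymbol h}=\Delta_{\boldsymbol h}\Delta^{k-1}_{\boldsymbol h}$, and $\omega_k(f,t)_p=\sup_{|\boldsymbol h|\le t}\|\Delta^k_{\boldsymbol h}f\|_p$ (Euclidean $|\boldsymbol h|$). For $r>0$, $1\le p,\theta\le\infty$ and a fixed integer $k>r$, the Nikol'skii–Besov space $B^r_{p,\theta}$ consists of $f\in L_p(\mathbb{T}^d)$ with finite norm $\|f\|_{B^r_{p,\theta}}=\|f\|_p+\big(\int_0^\infty (t^{-r}\omega_k(f,t)_p)^\theta\,\frac{dt}{t}\big)^{1/\theta}$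 for $\theta<\infty$, and $\|f\|_p+\sup_{t>0}t^{-r}\omega_k(f,t)_p$ for $\theta=\infty$; the class $B^r_{p,\theta}$ denotes its unit ball $\{f:\|f\|_{B^r_{p,\theta}}\le1\}$. Let $V_l(t)=l^{-1}\sum_{k=l}^{2l-1}D_k(t)$ with $D_k(t)=\sum_{|j|\le k}e^{ijt}$ be the de la Vallée-Poussin kernel, $V_l(\boldsymbol x)=\prod_{j=1}^dV_l(x_j)$, $V_l(f)=f*V_l$. Set $\sigma_0(f)=V_1(f)$ and $\sigma_s(f)=V_{2^s}(f)-V_{2^{s-1}}(f)$ for $s\in\mathbb{N}$. For $1\le q\le\infty$, $B_{q,1}$ is the space of $f\in L_q(\mathbb{T}^d)$ with $\|f\|_{B_{q,1}}:=\sum_{s\ge0}\|\sigma_s(f)\|_q<\infty$. For a normed space $\mathcal X$ of functions and $f\in\mathcal X$, the best $m$-term trigonometric approximation is $e_m(f)_{\mathcal X}=\inf_{\Theta_m}\inf_{c_{\boldsymbol k}}\|f-\sum_{\boldsymbol k\in\Theta_m}c_{\boldsymbol k}e^{i(\boldsymbol k,\boldsymbol x)}\|_{\mathcal X}$, where $\Theta_m$ ranges over sets of $m$ vectors in $\mathbb{Z}^d$ and $c_{\boldsymbol k}\in\mathbb{C}$; for a class $F$, $e_m(F)_{\mathcal X}=\sup_{f\in F}e_m(f)_{\mathcal X}$. The notation $a(m)\asymp b(m)$ means there are constants $0<C_1<C_2$ independent of $m$ (depending possibly on the other parameters) with $C_1a(m)\le b(m)\le C_2a(m)$ for all $m\in\mathbb{N}$.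 *)

(* Defs.v *)
(* Functions on T^d are complex-valued maps on
   'rV[R]_d (row vectors = points of R^d), 2pi-periodic in each variable. *)
From mathcomp Require Import all_boot all_order all_algebra.
From mathcomp Require Import all_classical all_reals all_analysis.
Import Order.TTheory GRing.Theory Num.Theory.
From mathcomp Require Export complex.
Set Implicit Arguments. Unset Strict Implicit. Unset Printing Implicit Defensive.
Local Open Scope classical_set_scope.
Local Open Scope ring_scope.
Local Open Scope complex_scope.

Section Defs.
Variable R : realType.
Variable d : nat.
Notation pt := 'rV[R]_d.
Notation C := (R[i]).

Definition boxes : set (set pt) :=
  [set B | exists Bs : 'I_d -> set R,
      (forall i, measurable (Bs i)) /\ B = [set x : pt | forall i, Bs i (x ord0 i)]].

Definition rV_measurable (g : pt -> R) : Prop :=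
  forall B : set R, measurable B -> <<s boxes >> (g @^-1` B).

Definition cmeasurable (f : pt -> C) : Prop :=
  rV_measurable (fun x => complex.Re (f x)) /\ rV_measurable (fun x => complex.Im (f x)).

Definition periodic (f : pt -> C) : Prop :=
  forall (x : pt) (i : 'I_d), f (x + (2 * pi) *: delta_mx 0 i) = f x.

(* ---- integration over T^d = [0,2pi)^d (iterated Lebesgue integrals) ---- *)
Definition setc (x : pt) (n : nat) (t : R) : pt :=
  \row_j (if nat_of_ord j == n then t else x ord0 j).

Fixpoint iint (n : nat) (g : pt -> \bar R) (x : pt) : \bar R :=
  if n is n'.+1 then
    (\int[lebesgue_measure]_(t in `[0%R, (2 * pi)%R[%classic) iint n' g (setc x n' t))%E
  else g x.

Definition torus_int (g : pt -> \bar R) : \bar R :=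
  (((2 * pi) ^- d)%:E * iint d g 0)%E.

Definition Lpnorm (p : R) (f : pt -> C) : \bar R :=
  (torus_int (fun x => (powR (Normc.normc (f x)) p)%:E) `^ p^-1)%E.

Definition cint (g : pt -> C) : C :=
  (fine (torus_int (fun x => (complex.Re (g x))%:E)))
    +i* (fine (torus_int (fun x => (complex.Im (g x))%:E))).

Definition cexpi (t : R) : C := (cos t) +i* (sin t).

Definition dirichlet (k : nat) (t : R) : C :=
  \sum_(0 <= j < (2 * k).+1) cexpi ((j%:R - k%:R) * t).

Definition vp1 (l : nat) (t : R) : C :=
  (l%:R : C)^-1 * \sum_(l <= k < 2 * l) dirichlet k t.

Definition vpd (l : nat) (x : pt) : C := \prod_(j < d) vp1 l (x ord0 j).

Definition vpconv (l : nat) (f : pt -> C) : pt -> C :=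
  fun x => cint (fun y => f (x - y) * vpd l y).

Definition sigma_s (s : nat) (f : pt -> C) : pt -> C :=
  if s is s'.+1 then (fun x => vpconv (2 ^ s) f x - vpconv (2 ^ s') f x)
  else vpconv 1 f.

Definition Bq1norm (q : R) (f : pt -> C) : \bar R :=
  (\sum_(0 <= s <oo) Lpnorm q (sigma_s s f))%E.

Definition diffop (h : pt) (f : pt -> C) : pt -> C := fun x => f (x + h) - f x.
Definition deltak (k : nat) (h : pt) (f : pt -> C) : pt -> C := iter k (diffop h) f.

Definition euclid (h : pt) : R := Num.sqrt (\sum_(i < d) h ord0 i ^+ 2).

Definition omega (k : nat) (f : pt -> C) (t p : R) : \bar R :=
  ereal_sup [set Lpnorm p (deltak k h f) | h in [set h | euclid h <= t]].

Definition besov_seminorm (r p : R) (theta : \bar R) (k : nat) (f : pt -> C) : \bar R :=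
  match theta with
  | EFin th =>
      ((\int[lebesgue_measure]_(t in [set t : R | (0 < t)%R])
          (((powR t (- r))%:E * omega k f t p) `^ th * (t^-1)%R%:E)) `^ th^-1)%E
  | +oo%E => ereal_sup [set ((powR t (- r))%:E * omega k f t p)%E | t in [set t : R | (0 < t)%R]]
  | -oo%E => +oo%E
  end.

Definition besov_norm (r p : R) (theta : \bar R) (k : nat) (f : pt -> C) : \bar R :=
  (Lpnorm p f + besov_seminorm r p theta k f)%E.

(* unit ball of B^r_{p,theta} (with the fixed integer k > r) *)
Definition besov_class (r p : R) (theta : \bar R) (k : nat) : set (pt -> C) :=
  [set f | periodic f /\ cmeasurable f /\ (besov_norm r p theta k f <= 1)%E].

Definition tpoly (m : nat) (kk : 'I_m -> 'rV[int]_d) (c : 'I_m -> C) : pt -> C :=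
  fun x => \sum_(j < m) c j * cexpi (\sum_(i < d) ((kk j ord0 i)%:~R * x ord0 i)).

Definition em_fun (q : R) (m : nat) (f : pt -> C) : \bar R :=
  ereal_inf [set e | exists (kk : 'I_m -> 'rV[int]_d) (c : 'I_m -> C),
     injective kk /\ e = Bq1norm q (fun x => f x - tpoly kk c x)].

Definition em_class (q : R) (m : nat) (F : set (pt -> C)) : \bar R :=
  ereal_sup [set em_fun q m f | f in F].

End Defs.

Definition asymp (R : realType) (a : nat -> R) (b : nat -> \bar R) : Prop :=
  exists C1 C2 : R, (0 < C1)%R /\ (0 < C2)%R /\
    forall m : nat, (0 < m)%N ->
      ((C1 * a m)%:E <= b m)%E /\ (b m <= (C2 * a m)%:E)%E.

(* Main.v *)
(** Upper bound. Let [c_k] be the Fourier coefficients of [f] in the class and let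
    [D_s] be the frequencies with [2^(s-1) < |k|_oo <= 2^s]. For every such frequency
    some difference operator with step [2^-s] along a coordinate axis multiplies the
    coefficient by a factor bounded below, so pairing the differences of [f] with their
    own partial sums and using Nikolskii's inequality for [p' >= 2] gives
    [(sum_(D_s) |c_k|^2)^(1/2) <= C 2^(s(d/p-d/2-r))].
    All low blocks are kept; each middle block is approximated by Maurey's greedy
    averaging, which only needs [sum_(D_s) |c_k|] and tolerates any multipliers of
    modulus at most 1, hence works for the pieces of [sigma_s] and [sigma_(s-1)] at
    once; high blocks are dropped. As [sigma_s] only sees [D_s] and [D_(s+1)], the
    errors form two-sided geometric sums centred at [s = n] when [r > d/p] and at
    [s = nq/2] when [r < d/p], where [m ~ 2^(nd)].

    Lower bound. For the Fejer kernel [F] of order [N], a multiple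
    [c N^(-r-d+d/p) F] lies in the class. If [Theta] is the spectrum of an [m]-term
    polynomial [t] and [P] the restriction of [F] to [Theta], then [F - P] is
    orthogonal to [t], has [L_q']-norm at most [N^(d/q) + 2 m^(1/2)], and pairs with
    [F] to at least [c N^d] as soon as [N^d >= C m]. Taking [N ~ m^(1/d)] or
    [N ~ m^(q/(2d))] gives the two rates. *)

From HB Require Import structures.
Require Import Defs.
From mathcomp Require Import all_boot all_order all_algebra.
From mathcomp Require Import finmap.
From mathcomp Require Import all_classical all_reals all_analysis.
From mathcomp Require Import measurable_realfun ring lra zify.
Import Order.TTheory GRing.Theory Num.Theory.
Import numFieldNormedType.Exports.
Set Implicit Arguments. Unset Strict Implicit. Unset Printing Implicit Defensive.
Local Open Scope classical_set_scope.
Local Open Scope ring_scope.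

(** * Integration on the torus *)

(** The order is the same for all theta because each half works at a single scale: above, only
    omega_k(f, t)_p <= C t^r is extracted, with C free of theta since omega_k is nondecreasing in t;
    below, the Besov integrand of the Fejer kernel decays geometrically away from t = 1/N. Maurey's
    random choice is made deterministic by a potential: the sum over the multipliers of the means of
    (|P|^2 + K)^n, with 2n >= q. The shift K is so large that one averaging step multiplies the
    potential by at most 1 + O(1/M), hence M steps by a bounded factor. In the lower bound the norm
    of B_(q,1) is reached by testing each sigma_s separately and adding up, since the multipliers of
    the sigma_s sum to 1 on the spectrum of F. The L_p norms of the differences of F come from
    writing F as a normalised squared modulus, whose differences split into products accessible to
    Cauchy-Schwarz. As the torus integral is given as an iterated integral, a measure that realises
    it is constructed first. *)

Section integral_monotone.
Local Open Scope ereal_scope.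
Context (dsp : measure_display) (T : measurableType dsp) (R : realType).
Variable mu : {measure set T -> \bar R}.

(* The integral of a nonnegative function is a supremum over simple functions,
   so monotonicity needs no measurability. *)
Lemma ge0_le_integral_nomeas (D : set T) (f1 f2 : T -> \bar R) :
  (forall x, D x -> 0 <= f1 x) -> (forall x, D x -> f1 x <= f2 x) ->
  \int[mu]_(x in D) f1 x <= \int[mu]_(x in D) f2 x.
Proof.
move=> f10 f12; rewrite !ge0_integralE //; last first.
  by move=> x Dx; exact: le_trans (f10 _ Dx) (f12 _ Dx).
apply: le_ereal_sup => _ /= [h hf <-]; exists h => // x.
apply: le_trans (hf x) _; rewrite /patch; case: ifPn => // /[!inE].
exact: f12.
Qed.

End integral_monotone.

(** * Measurability and monotone convergence of iterated integrals *)

Section torus_measure.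
Context {R : realType} {d : nat}.
Local Notation pt := 'rV[R]_d.


Local Notation T := (g_sigma_algebraType (@boxes R d)).

Lemma rV_measurableE (g : pt -> R) :
  rV_measurable g <-> measurable_fun setT (g : T -> R).
Proof.
split=> [mg _ B mB|mg B mB]; first by rewrite setTI; exact: mg.
by have := mg measurableT B mB; rewrite setTI.
Qed.

Lemma measurable_coord i : measurable_fun setT (fun x : T => (x : pt) ord0 i).
Proof.
move=> _ B mB; rewrite setTI; apply: sub_sigma_algebra.
exists (fun j => if j == i then B else setT); split.
  by move=> j; case: ifP.
apply/seteqP; split=> x /=; last by move/(_ i); rewrite eqxx.
by move=> Bx j; case: ifP => // /eqP ->.
Qed.

Lemma measurable_to_torus (dsp : measure_display) (X : measurableType dsp)
    (F : X -> T) :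
  (forall i, measurable_fun setT (fun x => (F x : pt) ord0 i)) ->
  measurable_fun setT F.
Proof.
move=> mF; apply: (@measurability _ _ X T setT F (@boxes R d)) => //.
move=> _ [_ [Bs [mBs ->]] <-].
rewrite [X in measurable X](_ : _ =
    \bigcap_(i in [set: 'I_d]) ((fun x => (F x : pt) ord0 i) @^-1` Bs i)).
  apply: fin_bigcap_measurable => [|i _]; first exact: finite_finset.
  by rewrite -[X in measurable X]setTI; exact: mF.
rewrite setTI; apply/seteqP; split=> x /=; first by move=> H i _; exact: H.
by move=> H i; exact: H.
Qed.


Local Notation I2pi := (`[0, (2 * pi)[%classic : set R).
Local Open Scope ereal_scope.

Lemma measurable_setc n :
  measurable_fun setT (fun xt : T * R => setc xt.1 n xt.2 : T).
Proof.
apply: measurable_to_torus => i.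
rewrite [X in measurable_fun _ X](_ : _ =
  fun xt : T * R => if nat_of_ord i == n then xt.2 else (xt.1 : pt) ord0 i).
  case: (_ == _); first exact: measurable_snd.
  apply: (measurableT_comp (f := fun x : T => (x : pt) ord0 i)).
    exact: measurable_coord.
  exact: measurable_fst.
by apply/funext => xt; rewrite /setc mxE.
Qed.

Lemma measurable_setc1 n (x : T) :
  measurable_fun setT (fun t : R => setc x n t : T).
Proof.
apply: measurable_to_torus => i.
rewrite [X in measurable_fun _ X](_ : _ =
  fun t : R => if nat_of_ord i == n then t else (x : pt) ord0 i).
  by case: (_ == _).
by apply/funext => xt; rewrite /setc mxE.
Qed.

Lemma ge0_iint n (g : pt -> \bar R) : (forall x, 0 <= g x) ->
  forall x, 0 <= iint n g x.
Proof.
by move=> g0; elim: n => [|n IH] x //=; apply: integral_ge0 => t _; exact: IH.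
Qed.

(** Tonelli's measurability theorem for section integrals, applied to the integrand times the
    indicator of [0, 2pi) so that the inner integral runs over the whole line. A signed integrand is
    split into its two parts, its integral being by definition the difference of theirs. *)
Lemma measurable_iint n (g : T -> \bar R) :
  measurable_fun setT g -> measurable_fun setT (iint n g : T -> \bar R).
Proof.
move=> mg; elim: n => [//|n IH] /=.
have mI2 : measurable I2pi by [].
have key (F : T -> \bar R) : (forall x, 0 <= F x) -> measurable_fun setT F ->
    measurable_fun setT
      (fun x : T => \int[lebesgue_measure]_(t in I2pi) F (setc x n t)).
  move=> F0 mF.
  pose H (xt : T * R) := F (setc xt.1 n xt.2) * (\1_I2pi xt.2)%:E.
  rewrite [X in measurable_fun _ X](_ : _ = fubini_F lebesgue_measure H).
    apply: measurable_fun_fubini_tonelli_F => [|xt].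
      apply: emeasurable_funM.
        by apply: (measurableT_comp mF); exact: measurable_setc.
      apply/measurable_EFinP.
      apply: (measurableT_comp (f := \1_I2pi : R -> R)).
        exact: measurable_indic.
      exact: measurable_snd.
    by rewrite mule_ge0// lee_fin.
  apply/funext => x; rewrite /fubini_F [LHS]integral_mkcond.
  apply: eq_integral => t _; rewrite /H /= patchE indicE.
  by case: ifP => _; rewrite ?mule1 ?mule0.
under eq_fun do rewrite integralE.
apply: emeasurable_funB.
  rewrite [X in measurable_fun _ X](_ : _ = fun x : T =>
    \int[lebesgue_measure]_(t in I2pi) (iint n g)^\+ (setc x n t)); last first.
    by apply/funext => x; apply: eq_integral => t _; rewrite !funeposE.
  exact (key _ (funepos_ge0 _) (measurable_funepos IH)).
rewrite [X in measurable_fun _ X](_ : _ = fun x : T =>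
  \int[lebesgue_measure]_(t in I2pi) (iint n g)^\- (setc x n t)); last first.
  by apply/funext => x; apply: eq_integral => t _; rewrite !funenegE.
exact (key _ (funeneg_ge0 _) (measurable_funeneg IH)).
Qed.

Lemma measurable_iint_slice n (g : T -> \bar R) m (x : T) :
  measurable_fun setT g ->
  measurable_fun I2pi (fun t : R => iint n g (setc x m t)).
Proof.
move=> mg; apply: (measurable_funS (E := setT)) => //.
apply: (measurableT_comp (f := iint n g : T -> _)); first exact: measurable_iint.
exact: measurable_setc1.
Qed.

Lemma ge0_le_iint n (f g : pt -> \bar R) :
  (forall x, 0 <= f x) -> (forall x, f x <= g x) ->
  forall x, iint n f x <= iint n g x.
Proof.
move=> f0 fg; elim: n => [//|n IH] x /=.
by apply: ge0_le_integral_nomeas => t _; [exact: ge0_iint|exact: IH].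
Qed.

Lemma ge0_iintD n (f g : T -> \bar R) :
  (forall x, 0 <= f x) -> (forall x, 0 <= g x) ->
  measurable_fun setT f -> measurable_fun setT g ->
  forall x, iint n (fun x => f x + g x) x = iint n f x + iint n g x.
Proof.
move=> f0 g0 mf mg; elim: n => [//|n IH] x /=.
rewrite -ge0_integralD//; first by apply: eq_integral => t _; exact: IH.
- by move=> t _; exact: ge0_iint.
- exact: measurable_iint_slice.
- by move=> t _; exact: ge0_iint.
- exact: measurable_iint_slice.
Qed.

Lemma ge0_iintZ n (k : R) (f : T -> \bar R) : (0 <= k)%R ->
  (forall x, 0 <= f x) -> measurable_fun setT f ->
  forall x, iint n (fun x => k%:E * f x) x = k%:E * iint n f x.
Proof.
move=> k0 f0 mf; elim: n => [//|n IH] x /=.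
rewrite -ge0_integralZl_EFin//; first by apply: eq_integral => t _; exact: IH.
- by move=> t _; exact: ge0_iint.
- exact: measurable_iint_slice.
Qed.

Lemma iint_cst n (k : R) x : iint n (cst k%:E : pt -> \bar R) x = (k * (2 * pi) ^+ n)%:E.
Proof.
elim: n x => [|n IH] x /=; first by rewrite expr0 mulr1.
under eq_integral do rewrite IH.
rewrite (integral_cst lebesgue_measure); last by [].
rewrite [X in _ * X](_ : _ = (2 * pi)%:E).
  by rewrite -EFinM; congr (_%:E); rewrite exprS; ring.
have := @lebesgue_measure_itv R `[0%R, (2 * pi)%R[.
by rewrite /= lte_fin mulr_gt0 ?pi_gt0// sube0; apply.
Qed.

(** Monotone convergence survives each further integration, since the partial integrals are again
    nonnegative and nondecreasing. Countable additivity of [torus_mu] comes from here. *)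
Lemma cvg_iint n (g : (T -> \bar R)^nat) (f : T -> \bar R) :
  (forall i, measurable_fun setT (g i)) -> (forall i x, 0 <= g i x) ->
  (forall x, nondecreasing_seq (g^~ x)) -> (forall x, g^~ x @ \oo --> f x) ->
  forall x, iint n (g i) x @[i --> \oo] --> iint n f x.
Proof.
move=> mg g0 ndg gf; elim: n => [//|n IH] x /=.
rewrite (_ : (fun t : R => iint n f (setc x n t)) =
   fun t : R => limn (fun i => iint n (g i) (setc x n t))); last first.
  by apply/funext => t; apply/esym/cvg_lim => //; exact: IH.
apply: cvg_monotone_convergence => //.
- by move=> i; exact: measurable_iint_slice.
- by move=> i t _; exact: ge0_iint.
- by move=> t _ i j ij; apply: ge0_le_iint => // y; exact: ndg.
Qed.

End torus_measure.

(** * Lebesgue integrals under shifts, under reflection and over a period *)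

Section lebesgue_affine.
Context {R : realType}.
Local Notation mu := (@lebesgue_measure R).
Local Open Scope ereal_scope.

Lemma measurable_shift (a : R) :
  measurable_fun setT ((fun t => a + t)%R : measurableTypeR R -> measurableTypeR R).
Proof. exact: measurable_funD. Qed.

(** Both measures give ]x, y] its length, and Lebesgue measure is determined by these intervals. *)
Lemma lebesgue_measure_shift (a : R) (A : set R) : measurable A ->
  pushforward mu ((fun t => a + t)%R : measurableTypeR R -> measurableTypeR R) A = mu A.
Proof.
move=> mA; apply/esym/lebesgue_measure_unique => //=.
  exact: measurable_shift.
move=> mm _ [[x y]] _ <-.
rewrite /pushforward.
rewrite (_ : _ @^-1` _ = `](x - a)%R, (y - a)%R]%classic).
  rewrite !lebesgue_measure_itv/= !lte_fin ltrD2r.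
  by case: ifPn => // _; rewrite -!EFinB; congr (_%:E); ring.
apply/seteqP; split => t /=; rewrite !in_itv /= => /andP[h1 h2];
 apply/andP; split; lra.
Qed.

Lemma ge0_integral_shift (a : R) (D : set R) (f : R -> \bar R) :
  measurable D -> measurable_fun setT f -> (forall t, 0 <= f t) ->
  \int[mu]_(t in [set t | D (a + t)%R]) f (a + t)%R = \int[mu]_(t in D) f t.
Proof.
move=> mD mf f0.
pose phi : {mfun measurableTypeR R >-> measurableTypeR R} :=
  HB.pack ((fun t => a + t)%R : measurableTypeR R -> measurableTypeR R)
    (isMeasurableFun.Build _ _ _ _ _ (measurable_shift a)).
transitivity (\int[pushforward mu phi]_(t in D) f t).
  apply/esym/(ge0_integral_pushforward (measurable_shift a)) => //.
  exact: measurable_funS mf.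
by apply: eq_measure_integral => A mA _; exact: lebesgue_measure_shift.
Qed.

Lemma ge0_integral_opp (D : set R) (f : R -> \bar R) :
  measurable D -> measurable_fun setT f -> (forall t, 0 <= f t) ->
  \int[mu]_(t in [set t | D (- t)%R]) f (- t)%R = \int[mu]_(t in D) f t.
Proof.
move=> mD mf f0.
transitivity (\int[pushforward mu (-%R : R -> measurableTypeR R)]_(t in D) f t).
  by rewrite ge0_integral_pushforward//; exact: measurable_funS mf.
by apply: eq_measure_integral => A mA _; exact: lebesgue_measureN.
Qed.

Variables (P : R) (P0 : (0 < P)%R) (f : R -> \bar R).
Hypothesis mf : measurable_fun setT f.
Hypothesis f0 : forall t, 0 <= f t.
Hypothesis fP : forall t, f (P + t)%R = f t.

Let ph (a : R) : \bar R := \int[mu]_(t in `[a, (a + P)%R[) f t.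

Let split_int (a b c : R) : (a <= b)%R -> (b <= c)%R ->
  \int[mu]_(t in `[a, c[) f t =
  \int[mu]_(t in `[a, b[) f t + \int[mu]_(t in `[b, c[) f t.
Proof.
move=> ab bc; rewrite -ge0_integral_setU//.
- congr (integral _ _ _); apply/seteqP; split => t /=; rewrite !in_itv/=.
    by move=> /andP[-> ->]; case: (leP b t); [right|left].
  by case=> /andP[h1 h2]; apply/andP; split; lra.
- exact: measurable_funS mf.
- apply/disj_setPS => t /= [] ; rewrite !in_itv/= => /andP[h1 h2] /andP[h3 h4].
  by exfalso; lra.
Qed.

(** Moving the window [a, a + P) by b <= P drops [a, a + b) and gains its translate by P, where f
    takes the same values. *)
Let ph_step (a b : R) : (0 <= b)%R -> (b <= P)%R -> ph (a + b)%R = ph a.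
Proof.
move=> b0 bP; rewrite /ph (@split_int (a + b)%R (a + P)%R (a + b + P)%R); [|lra|lra].
rewrite (@split_int a (a + b)%R (a + P)%R); [|lra|lra].
rewrite [LHS]addeC; congr (_ + _).
rewrite -(@ge0_integral_shift P)//.
under eq_integral do rewrite fP.
congr (integral _ _ _); apply/seteqP; split => t /=; rewrite !in_itv/=;
  move=> /andP[h1 h2]; apply/andP; split; lra.
Qed.

Let ph_nat (a b : R) n : (0 <= b)%R -> (b <= P)%R -> ph (a + n%:R * b)%R = ph a.
Proof.
move=> b0 bP; elim: n => [|n IH]; first by rewrite mul0r addr0.
by rewrite -natr1 mulrDl mul1r addrA ph_step.
Qed.

Let ph_cst (a : R) : ph a = ph 0%R.
Proof.
have key (c a' : R) : (0 <= c)%R -> ph (a' + c)%R = ph a'.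
  (* An arbitrary shift c is cut into n equal shifts of length at most P. *)
  move=> c0; pose n := (Num.truncn (c / P)).+1.
  have n0 : (0 < n%:R :> R)%R by rewrite ltr0n.
  rewrite -[in LHS](@mulfVK _ n%:R _ c) ?gt_eqF//= mulrC ph_nat//.
    by rewrite divr_ge0 // ltW.
  rewrite ler_pdivrMr// mulrC -ler_pdivrMr//.
  by rewrite ltW// truncnS_gt.
have [a0|a0] := leP 0%R a; first by rewrite -(add0r a) key.
by rewrite -[in RHS](addrN a) key// oppr_ge0 ltW.
Qed.

(** The sign e = 1 serves translations, e = -1 the convolution f(x - y). Reflection turns
    [0, P) into ]-P, 0]; endpoints are null sets, so the open side can be swapped. *)
Lemma ge0_integral_period (a e : R) : (e = 1 \/ e = -1)%R ->
  \int[mu]_(t in `[0%R, P[) f (a + e * t)%R = \int[mu]_(t in `[0%R, P[) f t.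
Proof.
move=> he; rewrite -[in RHS](add0r P) -/(ph 0%R).
case: he => ->.
  under eq_integral do rewrite mul1r.
  rewrite -(ph_cst a) /ph -[RHS](@ge0_integral_shift a)//.
  congr (integral _ _ _); apply/seteqP; split => t /=; rewrite !in_itv/=;
  move=> /andP[h1 h2]; apply/andP; split; lra.
under eq_integral do rewrite mulN1r.
have mfa : measurable_fun setT (fun t : R => f (a + t)%R).
  by apply: (measurableT_comp mf); exact: measurable_shift.
transitivity (\int[mu]_(t in `](- P)%R, 0%R]) f (a + t)%R).
  rewrite -[RHS]ge0_integral_opp//; congr (integral _ _ _).
  by apply/seteqP; split => t /=; rewrite !in_itv/=;
  move=> /andP[h1 h2]; apply/andP; split; lra.
rewrite integral_itv_bndoo; last exact: measurable_funS mfa.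
rewrite -(@integral_itv_bndoo _ _ _ _ true true); last exact: measurable_funS mfa.
rewrite -(ph_cst (a - P)%R) /ph -[RHS](@ge0_integral_shift a)//.
congr (integral _ _ _); apply/seteqP; split => t /=; rewrite !in_itv/=;
  move=> /andP[h1 h2]; apply/andP; split; lra.
Qed.

End lebesgue_affine.

(** * The torus integral as integration against a measure *)

Section torus_probability.
Context {R : realType} {d : nat}.
Local Notation pt := 'rV[R]_d.
Local Notation T := (g_sigma_algebraType (@boxes R d)).
Local Notation I2pi := (`[0, (2 * pi)[%classic : set R).
Local Open Scope ereal_scope.

Lemma twopi_gt0 : (0 < 2 * pi :> R)%R.
Proof. by rewrite mulr_gt0 ?pi_gt0. Qed.

Let c0 : (0 <= (2 * pi) ^- d :> R)%R.
Proof. by rewrite invr_ge0 exprn_ge0// ltW// twopi_gt0. Qed.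

Lemma ge0_torus_int (g : pt -> \bar R) : (forall x, 0 <= g x) -> 0 <= torus_int g.
Proof. by move=> g0; rewrite mule_ge0 ?lee_fin//; exact: ge0_iint. Qed.

Lemma ge0_le_torus_int (f g : pt -> \bar R) :
  (forall x, 0 <= f x) -> (forall x, f x <= g x) -> torus_int f <= torus_int g.
Proof. by move=> f0 fg; rewrite lee_wpmul2l ?lee_fin//; exact: ge0_le_iint. Qed.

Lemma ge0_torus_intD (f g : T -> \bar R) :
  (forall x, 0 <= f x) -> (forall x, 0 <= g x) ->
  measurable_fun setT f -> measurable_fun setT g ->
  torus_int (fun x : pt => f x + g x) = torus_int f + torus_int g.
Proof.
move=> f0 g0 mf mg; rewrite /torus_int ge0_iintD// ge0_muleDr//; exact: ge0_iint.
Qed.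

Lemma ge0_torus_intZ (k : R) (f : T -> \bar R) : (0 <= k)%R ->
  (forall x, 0 <= f x) -> measurable_fun setT f ->
  torus_int (fun x : pt => k%:E * f x) = k%:E * torus_int f.
Proof. by move=> k0 f0 mf; rewrite /torus_int ge0_iintZ// muleCA. Qed.

Lemma torus_int_cst (k : R) : torus_int (cst k%:E : pt -> \bar R) = k%:E.
Proof.
rewrite /torus_int iint_cst -EFinM; congr (_%:E).
by rewrite mulrCA mulVf ?mulr1// expf_neq0// gt_eqF// twopi_gt0.
Qed.

Lemma ge0_torus_int_sum (I : Type) (s : seq I) (f : I -> T -> \bar R) :
  (forall i x, 0 <= f i x) -> (forall i, measurable_fun setT (f i)) ->
  torus_int (fun x : pt => \sum_(i <- s) f i x) = \sum_(i <- s) torus_int (f i).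
Proof.
move=> f0 mf; elim: s => [|i s IH].
  rewrite big_nil -[RHS](torus_int_cst 0); congr torus_int.
  by apply/funext => x; rewrite big_nil.
rewrite big_cons -IH -ge0_torus_intD//.
- by congr torus_int; apply/funext => x; rewrite big_cons.
- by move=> x; exact: sume_ge0.
- exact: emeasurable_sum.
Qed.

Lemma cvg_torus_int (g : (T -> \bar R)^nat) (f : T -> \bar R) :
  (forall i, measurable_fun setT (g i)) -> (forall i x, 0 <= g i x) ->
  (forall x, nondecreasing_seq (g^~ x)) -> (forall x, g^~ x @ \oo --> f x) ->
  torus_int (g i) @[i --> \oo] --> torus_int f.
Proof. by move=> mg g0 ndg gf; apply: cvgeZl => //; exact: cvg_iint. Qed.

(** Turning the iterated integral into a measure makes linearity, domination and integrability
    available for [torus_int]. *)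
Definition torus_mu (A : set T) : \bar R := torus_int (fun x : pt => (\1_A x)%:E).

Let torus_mu0 : torus_mu set0 = 0.
Proof.
rewrite /torus_mu -[RHS](torus_int_cst 0); congr torus_int; apply/funext => x.
by rewrite indic0.
Qed.

Let torus_mu_ge0 A : 0 <= torus_mu A.
Proof. by apply: ge0_torus_int => x; rewrite lee_fin. Qed.

Let torus_mu_sigma_additive : semi_sigma_additive torus_mu.
Proof.
move=> F mF tF mUF.
have mi i : measurable_fun setT (fun x : T => (\1_(F i) x : R)%:E).
  by apply/measurable_EFinP; exact: measurable_indic.
rewrite [X in X @ _ --> _](_ : _ = fun n =>
  torus_int (fun x : pt => \sum_(0 <= i < n) (\1_(F i) x : R)%:E)); last first.
  by apply/funext => n; rewrite ge0_torus_int_sum.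
apply: (@cvg_torus_int (fun n (x : T) => \sum_(0 <= i < n) (\1_(F i) x : R)%:E)).
- by move=> i; exact: emeasurable_sum.
- by move=> i x; exact: sume_ge0.
- by move=> x m n mn; apply: lee_sum_nneg_natr.
- move=> x; have [[i _ Fix]|Fx] := pselect ((\bigcup_n F n) x).
    rewrite (_ : (\1_(\bigcup_n F n) x)%:E = 1); last first.
      by rewrite indicE mem_set//; exists i.
    apply: cvg_near_cst; exists i.+1 => // n /= ltin.
    rewrite big_mkord (bigD1 (Ordinal ltin))//= indicE mem_set//=.
    rewrite big1 ?adde0// => j ji; rewrite indicE memNset// => Fjx.
    move/eqP: ji; apply; apply: val_inj => /=.
    by apply: tF => //; exists x; split.
  rewrite (_ : (\1_(\bigcup_n F n) x)%:E = 0); last first.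
    by rewrite indicE memNset.
  apply: cvg_near_cst; apply: nearW => n.
  rewrite big1// => i _; rewrite indicE memNset// => Fix.
  by apply: Fx; exists i.
Qed.

HB.instance Definition _ := isMeasure.Build _ _ _ torus_mu
  torus_mu0 torus_mu_ge0 torus_mu_sigma_additive.

Import HBNNSimple.

(** The two integrals agree on indicators by definition of [torus_mu], hence on simple functions,
    and both pass to increasing limits. *)
Lemma ge0_torus_intE (g : T -> \bar R) : (forall x, 0 <= g x) ->
  measurable_fun setT g -> torus_int g = \int[torus_mu]_x g x.
Proof.
move=> g0 mg; pose h := nnsfun_approx measurableT mg.
have hg x : EFin \o h^~ x @ \oo --> g x by apply: cvg_nnsfun_approx.
have ndh x : nondecreasing_seq (fun i => (h i x)%:E).
  by move=> i j ij; rewrite lee_fin; exact/lefP/nd_nnsfun_approx.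
have mh i : measurable_fun setT (fun x : T => (h i x)%:E).
  exact/measurable_EFinP.
have h0 i x : 0 <= (h i x)%:E by rewrite lee_fin.
have E i : torus_int (fun x : pt => (h i x)%:E) = \int[torus_mu]_x (h i x)%:E.
  rewrite integralT_nnsfun sintegralE fsbig_finite//=.
  rewrite (_ : (fun x : pt => _) = fun x : pt =>
     \sum_(y <- fset_set (range (h i))) (y * \1_(h i @^-1` [set y]) x)%:E); last first.
    by apply/funext => x; rewrite fimfunE fsbig_finite//= sumEFin.
  have mi y : measurable_fun setT (fun x : T => (\1_(h i @^-1` [set y]) x : R)%:E).
    by apply/measurable_EFinP; exact: measurable_indic.
  (* The absolute value of y is inserted because [ge0_torus_int_sum] asks for nonnegative summands
     at every index, also outside the range of [h i]. *)
  transitivity (\sum_(y <- fset_set (range (h i)))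
     torus_int (fun x : pt => (`|y| * \1_(h i @^-1` [set y]) x)%:E)).
    rewrite -ge0_torus_int_sum.
    - congr torus_int; apply/funext => x; rewrite big_seq [RHS]big_seq.
      apply: eq_bigr => y; rewrite in_fset_set// inE => -[z _ <-].
      by rewrite ger0_norm.
    - by move=> y x; rewrite lee_fin mulr_ge0.
    - move=> y; under eq_fun do rewrite EFinM.
      by apply: emeasurable_funM.
  rewrite big_seq [RHS]big_seq.
  apply: eq_bigr => y; rewrite in_fset_set// inE => -[z _ <-].
  rewrite ger0_norm// -[torus_mu _]/(torus_int _) -ge0_torus_intZ//.
have /cvg_lim <-// : torus_int (fun x : pt => (h i x)%:E) @[i --> \oo] --> torus_int g.
  exact: (@cvg_torus_int (fun i (x : T) => (h i x)%:E)).
under eq_fun do rewrite E.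
rewrite (_ : \int[torus_mu]_x g x =
   \int[torus_mu]_x limn (fun i => (h i x)%:E)); last first.
  by apply: eq_integral => x _; apply/esym/cvg_lim => //; exact: hg.
by apply/cvg_lim => //; apply: cvg_monotone_convergence.
Qed.

(** An inner integral may be of the form +oo - oo at some points. Finiteness of the outer integrals
    confines these points to a null set at each level, which the next integration ignores. *)
Lemma iint_posneg n (g : T -> \bar R) : measurable_fun setT g ->
  forall x, iint n g^\+ x < +oo -> iint n g^\- x < +oo ->
  iint n g x = iint n g^\+ x - iint n g^\- x.
Proof.
move=> mg; elim: n => [|n IH] x /=; first by move=> _ _; rewrite [in LHS](funeposneg g).
move=> Aoo Boo.
have mp := measurable_iint_slice n n x (measurable_funepos mg).
have mn := measurable_iint_slice n n x (measurable_funeneg mg).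
have ip : lebesgue_measure.-integrable I2pi
    (fun t : R => iint n g^\+ (setc x n t)).
  apply/integrableP; split => //; apply: le_lt_trans Aoo.
  by under eq_integral do rewrite gee0_abs ?ge0_iint//.
have inn : lebesgue_measure.-integrable I2pi
    (fun t : R => iint n g^\- (setc x n t)).
  apply/integrableP; split => //; apply: le_lt_trans Boo.
  by under eq_integral do rewrite gee0_abs ?ge0_iint//.
rewrite -integralB//; apply: ae_eq_integral => //.
- exact: measurable_iint_slice.
- exact: emeasurable_funB.
have mI3 : measurable (I2pi : set (measurableTypeR R)) by [].
have := integrable_ae mI3 ip; have := integrable_ae mI3 inn.
apply: filterS2 => t hn hp /= It; rewrite IH//.
  by rewrite -ge0_fin_numE ?hp// ge0_iint.
by rewrite -ge0_fin_numE ?hn// ge0_iint.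
Qed.

Lemma torus_intE (g : T -> R) :
  torus_mu.-integrable setT (EFin \o g) ->
  torus_int (fun x : pt => (g x)%:E) = \int[torus_mu]_x (g x)%:E.
Proof.
move=> /[dup] ig /integrableP[mg _].
have mp := measurable_funepos mg; have mn := measurable_funeneg mg.
have Ep := ge0_torus_intE (funepos_ge0 _) mp.
have En := ge0_torus_intE (funeneg_ge0 _) mn.
have ip := integral_funepos_lt_pinfty measurableT ig.
have inn := integral_funeneg_lt_pinfty measurableT ig.
have fin h : torus_int h < +oo -> (forall x, 0 <= h x) -> iint d h (0 : pt) < +oo.
  move=> + h0; rewrite /torus_int; have := ge0_iint d h0 0.
  case: (iint d h 0) => [r _ _|_|//]; first exact: ltry.
  by rewrite gt0_muley// lte_fin invr_gt0 exprn_gt0// twopi_gt0.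
rewrite integralE /torus_int iint_posneg//.
- rewrite muleBr//; first by rewrite -Ep -En.
  by apply: fin_num_adde_defr; rewrite ge0_fin_numE ?ge0_iint// fin// Ep.
- by apply: fin; rewrite // Ep.
- by apply: fin; rewrite // En.
Qed.

End torus_probability.

(** * Invariance of the torus integral under translation and reflection *)

Section torus_invariance.
Context {R : realType} {d : nat}.
Local Notation pt := 'rV[R]_d.
Local Notation T := (g_sigma_algebraType (@boxes R d)).
Local Notation I2pi := (`[0, (2 * pi)[%classic : set R).
Local Open Scope ereal_scope.

Lemma measurable_affine (a : pt) (e : R) :
  measurable_fun setT (fun x : T => (a + e *: (x : pt))%R : T).
Proof.
apply: measurable_to_torus => i.
under eq_fun do rewrite !mxE.
apply: measurable_funD => //; apply: measurable_funM => //.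
exact: measurable_coord.
Qed.

Definition eperiodic (g : pt -> \bar R) :=
  forall x i, g (x + (2 * pi) *: delta_mx 0 i)%R = g x.

(** Only coordinates i >= n are still free in [iint n g]; the earlier ones are overwritten by
    [setc]. *)
Lemma iint_periodic n (g : pt -> \bar R) : eperiodic g ->
  forall (i : 'I_d) x, (n <= i)%N ->
  iint n g (x + (2 * pi) *: delta_mx 0 i)%R = iint n g x.
Proof.
move=> pg; elim: n => [|n IH] i x ni /=; first exact: pg.
apply: eq_integral => t _; rewrite -[RHS](IH i); last exact: ltnW.
congr iint; apply/rowP => j; rewrite !mxE eqxx /=.
case: eqP => // jn; case: eqP => [ji|_]; last by rewrite mulr0 addr0.
by move: ni; rewrite -ji jn ltnn.
Qed.

Lemma eq_iint_coords n (g : pt -> \bar R) (x y : pt) :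
  (forall j : 'I_d, (n <= j)%N -> x ord0 j = y ord0 j) ->
  iint n g x = iint n g y.
Proof.
elim: n x y => [|n IH] x y xy /=.
  by congr g; apply/rowP => j; rewrite xy.
apply: eq_integral => t _; apply: IH => j nj; rewrite !mxE.
case: eqP => // /eqP jn; apply: xy; rewrite ltn_neqAle eq_sym jn.
exact: nj.
Qed.

(** Induction over the coordinates: at stage n the partial integral is periodic in coordinate n, so
    the one-dimensional [ge0_integral_period] applies. *)
Lemma iint_affine n (g : T -> \bar R) (a : pt) (e : R) : (e = 1 \/ e = -1)%R ->
  (n <= d)%N -> eperiodic g -> (forall x, 0 <= g x) -> measurable_fun setT g ->
  forall x, iint n (fun x => g (a + e *: x)%R) x = iint n g (a + e *: x)%R.
Proof.
move=> he + pg g0 mg; elim: n => [//|n IH] nd x /=.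
pose i := Ordinal nd.
under eq_integral do rewrite IH ?(ltnW nd)//.
rewrite -[RHS](@ge0_integral_period _ (2 * pi)%R _ _ _ _ _ (a ord0 i) e)//.
- apply: eq_integral => t _; congr iint; apply/rowP => j; rewrite !mxE.
  by case: eqP => // jn; have -> : j = i by apply: val_inj.
- exact: twopi_gt0.
- apply: (measurableT_comp (f := iint n g : T -> _)); first exact: measurable_iint.
  exact: measurable_setc1.
- by move=> t; exact: ge0_iint.
- move=> t; rewrite -[RHS](@iint_periodic n g pg i)//; congr iint.
  apply/rowP => j; rewrite !mxE eqxx /=.
  case: eqP => [jn|jn]; first by rewrite (_ : j = i) ?eqxx ?mulr1 1?addrC//; exact: val_inj.
  by case: eqP => [/(congr1 val)//|_]; rewrite mulr0 addr0.
Qed.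

Lemma torus_int_affine (g : T -> \bar R) (a : pt) (e : R) : (e = 1 \/ e = -1)%R ->
  eperiodic g -> (forall x, 0 <= g x) -> measurable_fun setT g ->
  torus_int (fun x : pt => g (a + e *: x)%R) = torus_int g.
Proof.
move=> he pg g0 mg; rewrite /torus_int iint_affine//.
by congr (_ * _); apply: eq_iint_coords => j; rewrite leqNgt ltn_ord.
Qed.

End torus_invariance.

(** * Means of real functions *)

Section mean.
Context {R : realType} {d : nat}.
Local Notation pt := 'rV[R]_d.
Local Notation T := (g_sigma_algebraType (@boxes R d)).

Definition mean (g : pt -> R) : R := fine (torus_int (fun x => (g x)%:E)).

Definition mble (g : pt -> R) := measurable_fun setT (g : T -> R).

Definition intble (g : pt -> R) := (@torus_mu R d).-integrable setT (EFin \o g).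

Lemma torus_int_mean g : intble g -> torus_int (fun x => (g x)%:E) = (mean g)%:E.
Proof.
move=> ig; rewrite /mean torus_intE// fineK//.
exact: integrable_fin_num.
Qed.

Lemma meanE g : intble g -> mean g = Rintegral (@torus_mu R d) setT g.
Proof. by move=> ig; rewrite /mean torus_intE. Qed.

Lemma intble_mble g : intble g -> mble g.
Proof. by move/measurable_int/measurable_EFinP. Qed.

Lemma intbleP g : intble g <->
  mble g /\ (torus_int (fun x : pt => `|g x|%:E) < +oo)%E.
Proof.
have E : mble g -> torus_int (fun x : pt => `|g x|%:E) =
    (\int[@torus_mu R d]_x `|(EFin \o g) x|)%E.
  move=> mg; rewrite ge0_torus_intE//.
  by apply/measurable_EFinP; apply: measurableT_comp.
split=> [ig|[mg gfin]].
  have mg := intble_mble ig; split => //; rewrite E//.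
  by have /integrableP[] := ig.
apply/integrableP; split; first exact/measurable_EFinP.
by rewrite -E.
Qed.

Lemma intble_le f g : mble f -> (forall x, `|f x| <= g x) -> intble g -> intble f.
Proof.
move=> mf fg ig; apply: (le_integrable _ _ _ ig) => //.
  exact/measurable_EFinP.
by move=> x _ /=; rewrite lee_fin (le_trans (fg x))// ler_norm.
Qed.

Lemma intble_cst (c : R) : intble (fun=> c).
Proof.
apply/intbleP; split; first exact: measurable_cst.
by rewrite (torus_int_cst `|c|) ltry.
Qed.

Lemma intble_bounded f (B : R) : mble f -> (forall x, `|f x| <= B) -> intble f.
Proof. by move=> mf fB; apply: intble_le (intble_cst B). Qed.

Lemma intbleD f g : intble f -> intble g -> intble (fun x => f x + g x).
Proof. by move=> i1 i2; apply: (integrableD measurableT i1 i2). Qed.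

Lemma intbleZ (c : R) f : intble f -> intble (fun x => c * f x).
Proof. by move=> i1; apply: (integrableZl measurableT c i1). Qed.

Lemma intbleB f g : intble f -> intble g -> intble (fun x => f x - g x).
Proof. by move=> i1 i2; apply: (integrableB measurableT i1 i2). Qed.

Lemma intble_sum (I : Type) (s : seq I) (f : I -> pt -> R) :
  (forall i, intble (f i)) -> intble (fun x => \sum_(i <- s) f i x).
Proof.
move=> fi; elim: s => [|i s IH].
  rewrite (_ : (fun _ => _) = fun=> 0); first exact: intble_cst.
  by apply/funext => x; rewrite big_nil.
rewrite (_ : (fun _ => _) = fun x => f i x + \sum_(i <- s) f i x).
  exact: intbleD.
by apply/funext => x; rewrite big_cons.
Qed.

Lemma meanD f g : intble f -> intble g ->
  mean (fun x => f x + g x) = mean f + mean g.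
Proof. by move=> i1 i2; rewrite !meanE ?RintegralD//; exact: intbleD. Qed.

Lemma meanB f g : intble f -> intble g ->
  mean (fun x => f x - g x) = mean f - mean g.
Proof. by move=> i1 i2; rewrite !meanE ?RintegralB//; exact: intbleB. Qed.

Lemma meanZ c f : intble f -> mean (fun x => c * f x) = c * mean f.
Proof. by move=> i1; rewrite !meanE ?RintegralZl//; exact: intbleZ. Qed.

Lemma mean_cst c : mean (fun=> c) = c.
Proof. by rewrite /mean (torus_int_cst c). Qed.

Lemma mean_sum (I : Type) (s : seq I) (f : I -> pt -> R) :
  (forall i, intble (f i)) ->
  mean (fun x => \sum_(i <- s) f i x) = \sum_(i <- s) mean (f i).
Proof.
move=> fi; elim: s => [|i s IH].
  rewrite big_nil -[RHS](mean_cst 0); congr mean.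
  by apply/funext => x; rewrite big_nil.
rewrite big_cons -IH -meanD//; last exact: intble_sum.
by congr mean; apply/funext => x; rewrite big_cons.
Qed.

Lemma le_mean f g : intble f -> intble g -> (forall x, f x <= g x) ->
  mean f <= mean g.
Proof. by move=> i1 i2 fg; rewrite !meanE//; apply: le_Rintegral. Qed.

Lemma mean_ge0 f : (forall x, 0 <= f x) -> 0 <= mean f.
Proof.
move=> f0; apply: fine_ge0; apply: ge0_torus_int => x; exact: f0.
Qed.

Definition rperiodic (g : pt -> R) :=
  forall x i, g (x + (2 * pi) *: delta_mx 0 i) = g x.

Lemma intble_affine g (a : pt) (e : R) : (e = 1 \/ e = -1) -> rperiodic g -> intble g ->
  intble (fun x => g (a + e *: x)).
Proof.
move=> he pg /intbleP[mg gfin]; apply/intbleP; split.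
  exact: (measurableT_comp mg (measurable_affine a e)).
rewrite (torus_int_affine (g := fun x : T => (`|g x|)%:E))//.
- by move=> x i; rewrite pg.
- by apply/measurable_EFinP; apply: measurableT_comp.
Qed.

Lemma mean_affine g (a : pt) (e : R) : (e = 1 \/ e = -1) -> rperiodic g -> intble g ->
  mean (fun x => g (a + e *: x)) = mean g.
Proof.
move=> he pg ig; have mg := intble_mble ig.
have mEg : measurable_fun setT (EFin \o (g : T -> R)) by exact/measurable_EFinP.
rewrite /mean !torus_intE//; last exact: intble_affine.
congr fine; rewrite integralE [RHS]integralE.
have key (h : T -> \bar R) : (forall x, 0 <= h x)%E -> eperiodic h ->
    measurable_fun setT h ->
    (\int[@torus_mu R d]_x h (a + e *: (x : pt))%R = \int[@torus_mu R d]_x h x)%E.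
  move=> h0 ph mh; rewrite -!ge0_torus_intE//; first exact: torus_int_affine.
  exact: (measurableT_comp mh (measurable_affine a e)).
have pp : eperiodic ((EFin \o g)^\+)%E by move=> x i; rewrite !funeposE /= pg.
have pn : eperiodic ((EFin \o g)^\-)%E by move=> x i; rewrite !funenegE /= pg.
congr (_ - _)%E.
  rewrite -(key _ (funepos_ge0 _) pp (measurable_funepos mEg)).
  by apply: eq_integral => x _; rewrite !funeposE.
rewrite -(key _ (funeneg_ge0 _) pn (measurable_funeneg mEg)).
by apply: eq_integral => x _; rewrite !funenegE.
Qed.

End mean.

(** * Trigonometric polynomials *)

Section complex_norm.
Context {R : realType}.
Implicit Types z w : R[i].
Local Open Scope complex_scope.
Local Notation nc := (@Normc.normc R).

Lemma normc_ge0 z : 0 <= nc z.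
Proof. by case: z => a b; exact: sqrtr_ge0. Qed.

Lemma normc_sqr z : nc z ^+ 2 = complex.Re z ^+ 2 + complex.Im z ^+ 2.
Proof. by case: z => a b /=; rewrite sqr_sqrtr// addr_ge0// sqr_ge0. Qed.

Lemma normcN z : nc (- z) = nc z.
Proof. by case: z => a b /=; rewrite !sqrrN. Qed.

Lemma normcD z w : nc (z + w) <= nc z + nc w.
Proof. by rewrite -lecR rmorphD; exact: (ler_normD z w). Qed.

Lemma normcB z w : nc (z - w) <= nc z + nc w.
Proof. by rewrite -(normcN w); exact: normcD. Qed.

Lemma normc_sum (I : Type) (s : seq I) (P : pred I) (f : I -> R[i]) :
  nc (\sum_(i <- s | P i) f i) <= \sum_(i <- s | P i) nc (f i).
Proof.
elim/big_rec2: _ => [|i y1 y2 _ h]; first by rewrite Normc.normc0.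
exact: le_trans (normcD _ _) (lerD _ _).
Qed.

Lemma normcR (r : R) : nc r%:C = `|r|.
Proof. by rewrite /= expr0n /= addr0 sqrtr_sqr. Qed.

Lemma normc_conj z : nc (conjc z) = nc z.
Proof. by case: z => a b /=; rewrite sqrrN. Qed.

Lemma normcX z n : nc (z ^+ n) = nc z ^+ n.
Proof.
elim: n => [|n IH]; first by rewrite !expr0 Normc.normc1.
by rewrite !exprS Normc.normcM IH.
Qed.

Lemma normc_Re z : `|complex.Re z| <= nc z.
Proof.
rewrite -(@ler_pXn2r _ 2) ?nnegrE ?normc_ge0// normc_sqr real_normK ?num_real//.
by rewrite lerDl sqr_ge0.
Qed.

Lemma normc_Im z : `|complex.Im z| <= nc z.
Proof.
rewrite -(@ler_pXn2r _ 2) ?nnegrE ?normc_ge0// normc_sqr real_normK ?num_real//.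
by rewrite lerDr sqr_ge0.
Qed.

Lemma normc_le_ReIm z : nc z <= `|complex.Re z| + `|complex.Im z|.
Proof.
rewrite -(@ler_pXn2r _ 2) ?nnegrE ?normc_ge0 ?addr_ge0//.
rewrite normc_sqr sqrrD !real_normK ?num_real//.
by rewrite addrAC lerDl mulrn_wge0 ?mulr_ge0.
Qed.

Lemma complex_eq z w : complex.Re z = complex.Re w ->
  complex.Im z = complex.Im w -> z = w.
Proof. by case: z => a b; case: w => a' b' /= -> ->. Qed.

Lemma mulc_conj z : z * conjc z = (nc z ^+ 2)%:C.
Proof.
by rewrite normc_sqr; case: z => a b; apply: complex_eq => /=; ring.
Qed.

Lemma ReM z w : complex.Re (z * w) =
  complex.Re z * complex.Re w - complex.Im z * complex.Im w.
Proof. by case: z => a b; case: w => a' b'. Qed.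

Lemma ImM z w : complex.Im (z * w) =
  complex.Re z * complex.Im w + complex.Im z * complex.Re w.
Proof. by case: z => a b; case: w => a' b'. Qed.

Lemma ReD z w : complex.Re (z + w) = complex.Re z + complex.Re w.
Proof. by case: z => a b; case: w => a' b'. Qed.

Lemma ImD z w : complex.Im (z + w) = complex.Im z + complex.Im w.
Proof. by case: z => a b; case: w => a' b'. Qed.

Lemma ReN z : complex.Re (- z) = - complex.Re z. Proof. by case: z. Qed.
Lemma ImN z : complex.Im (- z) = - complex.Im z. Proof. by case: z. Qed.

Lemma Re_sum (I : Type) (s : seq I) (P : pred I) (f : I -> R[i]) :
  complex.Re (\sum_(i <- s | P i) f i) = \sum_(i <- s | P i) complex.Re (f i).
Proof. by elim/big_rec2: _ => // i y1 y2 _ <-; rewrite ReD. Qed.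

Lemma Im_sum (I : Type) (s : seq I) (P : pred I) (f : I -> R[i]) :
  complex.Im (\sum_(i <- s | P i) f i) = \sum_(i <- s | P i) complex.Im (f i).
Proof. by elim/big_rec2: _ => // i y1 y2 _ <-; rewrite ImD. Qed.

Lemma normc_cexpi (t : R) : nc (cexpi t) = 1.
Proof. by rewrite /= cos2Dsin2 sqrtr1. Qed.

Lemma cexpiD (s t : R) : cexpi (s + t) = cexpi s * cexpi t.
Proof.
rewrite /cexpi cosD sinD; simpc.
by apply: complex_eq => //=; rewrite addrC [cos s * _]mulrC.
Qed.

Lemma cexpi0 : cexpi (0 : R) = 1.
Proof. by rewrite /cexpi cos0 sin0. Qed.

Lemma cexpiN (t : R) : cexpi (- t) = conjc (cexpi t).
Proof. by rewrite /cexpi cosN sinN. Qed.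

Lemma cexpi_2pi (n : int) : cexpi (2 * pi * n%:~R) = 1 :> R[i].
Proof.
have nat_case m : cexpi (2 * pi * m%:R) = 1 :> R[i].
  elim: m => [|m IH]; first by rewrite mulr0 cexpi0.
  rewrite -(natr1 m) mulrDr mulr1 cexpiD IH mul1r /cexpi mulr_natl.
  by rewrite cos2pi sin2pi.
case: n => n; first exact: nat_case.
rewrite NegzE mulrNz mulrN cexpiN -[in LHS]pmulrn nat_case.
by apply: complex_eq => //=; rewrite oppr0.
Qed.

Lemma conjcM z w : conjc (z * w) = conjc z * conjc w.
Proof. by case: z => a b; case: w => a' b'; simpc; congr (_ +i* _); ring. Qed.

Lemma conjc_sum (I : Type) (s : seq I) (f : I -> R[i]) :
  conjc (\sum_(i <- s) f i) = \sum_(i <- s) conjc (f i).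
Proof.
elim/big_rec2: _ => [|i y1 y2 _ <-]; first by apply: complex_eq => //=; rewrite oppr0.
by case: (f i) => a b; case: y2 => a' b'; simpc.
Qed.

End complex_norm.

(** * Integration of complex functions *)

Section complex_integral.
Context {R : realType} {d : nat}.
Local Open Scope complex_scope.
Local Notation pt := 'rV[R]_d.
Local Notation C := R[i].
Local Notation nc := (@Normc.normc R).
Implicit Types f g : pt -> C.

Lemma cmeasurableE f : cmeasurable f <->
  mble (fun x => complex.Re (f x)) /\ mble (fun x => complex.Im (f x)).
Proof. by rewrite /cmeasurable !rV_measurableE. Qed.

Lemma cmeasurable_cst (c : C) : cmeasurable (fun _ : pt => c).
Proof. by apply/cmeasurableE; split; exact: measurable_cst. Qed.

Lemma cmeasurableD f g : cmeasurable f -> cmeasurable g ->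
  cmeasurable (fun x => f x + g x).
Proof.
move=> /cmeasurableE[f1 f2] /cmeasurableE[g1 g2]; apply/cmeasurableE; split.
  by rewrite /mble; under eq_fun do rewrite ReD; exact: measurable_funD.
by rewrite /mble; under eq_fun do rewrite ImD; exact: measurable_funD.
Qed.

Lemma cmeasurableN f : cmeasurable f -> cmeasurable (fun x => - f x).
Proof.
move=> /cmeasurableE[f1 f2]; apply/cmeasurableE; split.
  by rewrite /mble; under eq_fun do rewrite ReN; exact: measurableT_comp.
by rewrite /mble; under eq_fun do rewrite ImN; exact: measurableT_comp.
Qed.

Lemma cmeasurableB f g : cmeasurable f -> cmeasurable g ->
  cmeasurable (fun x => f x - g x).
Proof. by move=> mf /cmeasurableN; exact: cmeasurableD. Qed.

Lemma cmeasurableM f g : cmeasurable f -> cmeasurable g ->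
  cmeasurable (fun x => f x * g x).
Proof.
move=> /cmeasurableE[f1 f2] /cmeasurableE[g1 g2]; apply/cmeasurableE; split.
  rewrite /mble; under eq_fun do rewrite ReM.
  by apply: measurable_funB; exact: measurable_funM.
rewrite /mble; under eq_fun do rewrite ImM.
by apply: measurable_funD; exact: measurable_funM.
Qed.

Lemma cmeasurable_sum (I : Type) (s : seq I) (f : I -> pt -> C) :
  (forall i, cmeasurable (f i)) -> cmeasurable (fun x => \sum_(i <- s) f i x).
Proof.
move=> mf; elim: s => [|i s IH].
  rewrite (_ : (fun _ => _) = fun=> 0); first exact: cmeasurable_cst.
  by apply/funext => x; rewrite big_nil.
rewrite (_ : (fun _ => _) = fun x => f i x + \sum_(i <- s) f i x).
  exact: cmeasurableD.
by apply/funext => x; rewrite big_cons.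
Qed.

Lemma cmeasurable_conj f : cmeasurable f -> cmeasurable (fun x => conjc (f x)).
Proof.
move=> /cmeasurableE[h1 h2]; apply/cmeasurableE; split.
  rewrite [X in mble X](_ : _ = fun x => complex.Re (f x))//.
  by apply/funext => x; case: (f x).
rewrite [X in mble X](_ : _ = fun x => - complex.Im (f x)).
  exact: measurableT_comp.
by apply/funext => x; case: (f x).
Qed.

Lemma cmeasurable_affine f a (e : R) : cmeasurable f ->
  cmeasurable (fun x => f (a + e *: x)).
Proof.
move=> /cmeasurableE[f1 f2]; apply/cmeasurableE; split.
  exact: (measurableT_comp f1 (measurable_affine a e)).
exact: (measurableT_comp f2 (measurable_affine a e)).
Qed.

Lemma mble_normc f : cmeasurable f -> mble (fun x => nc (f x)).
Proof.
move=> /cmeasurableE[f1 f2]; rewrite /mble.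
rewrite (_ : (fun _ => _) = fun x =>
  Num.sqrt (complex.Re (f x) ^+ 2 + complex.Im (f x) ^+ 2)).
  apply: (measurableT_comp (f := @Num.sqrt R)).
    by apply: continuous_measurable_fun; exact: sqrt_continuous.
  by apply: measurable_funD; exact: measurable_funX.
by apply/funext => x; case: (f x).
Qed.

Definition cintble f := cmeasurable f /\ intble (fun x => nc (f x)).

Lemma cintble_Re f : cintble f -> intble (fun x => complex.Re (f x)).
Proof.
move=> [/cmeasurableE[mf _]] ifn; apply: intble_le ifn => // x; exact: normc_Re.
Qed.

Lemma cintble_Im f : cintble f -> intble (fun x => complex.Im (f x)).
Proof.
move=> [/cmeasurableE[_ mf]] ifn; apply: intble_le ifn => // x; exact: normc_Im.
Qed.

Lemma cintble_le f (g : pt -> R) : cmeasurable f -> intble g ->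
  (forall x, nc (f x) <= g x) -> cintble f.
Proof.
move=> mf ig fg; split=> //; apply: intble_le ig; first exact: mble_normc.
by move=> x; rewrite ger0_norm ?normc_ge0.
Qed.

Lemma cintble_bounded f (B : R) : cmeasurable f ->
  (forall x, nc (f x) <= B) -> cintble f.
Proof. by move=> mf fB; apply: cintble_le mf (intble_cst B) _. Qed.

Lemma cintbleD f g : cintble f -> cintble g -> cintble (fun x => f x + g x).
Proof.
move=> [mf ff] [mg gg]; apply: cintble_le (intbleD ff gg) _.
  exact: cmeasurableD.
by move=> x; exact: normcD.
Qed.

Lemma cintbleM_bounded f g (B : R) : cintble f -> cmeasurable g ->
  (forall x, nc (g x) <= B) -> cintble (fun x => f x * g x).
Proof.
move=> [mf ff] mg gB; apply: cintble_le (intbleZ B ff) _.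
  exact: cmeasurableM.
by move=> x; rewrite Normc.normcM mulrC ler_wpM2r ?normc_ge0.
Qed.

Lemma cintbleZ (c : C) f : cintble f -> cintble (fun x => c * f x).
Proof.
move=> fi; under eq_fun do rewrite mulrC.
exact: (cintbleM_bounded (B := nc c)) fi (cmeasurable_cst c) _.
Qed.

Lemma cintble_sum (I : Type) (s : seq I) (f : I -> pt -> C) :
  (forall i, cintble (f i)) -> cintble (fun x => \sum_(i <- s) f i x).
Proof.
move=> fi; elim: s => [|i s IH].
  rewrite (_ : (fun _ => _) = fun=> 0).
    exact: (cintble_bounded (B := nc 0) (cmeasurable_cst 0)).
  by apply/funext => x; rewrite big_nil.
rewrite (_ : (fun _ => _) = fun x => f i x + \sum_(i <- s) f i x).
  exact: cintbleD.
by apply/funext => x; rewrite big_cons.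
Qed.

Lemma cintE f : cint f =
  mean (fun x => complex.Re (f x)) +i* mean (fun x => complex.Im (f x)).
Proof. by []. Qed.

Lemma cintD f g : cintble f -> cintble g ->
  cint (fun x => f x + g x) = cint f + cint g.
Proof.
move=> fi gi; rewrite !cintE; simpc.
under eq_fun do rewrite ReD.
under [X in _ +i* mean X]eq_fun do rewrite ImD.
by rewrite !meanD//; (exact: cintble_Re || exact: cintble_Im).
Qed.

Lemma cintZ (c : C) f : cintble f -> cint (fun x => c * f x) = c * cint f.
Proof.
move=> fi; have iR := cintble_Re fi; have iI := cintble_Im fi.
rewrite !cintE; case: c => a b; apply: complex_eq => /=.
  rewrite -!meanZ// -meanB; [|exact: intbleZ..].
  by congr mean; apply/funext => x; rewrite ReM.
rewrite -!meanZ// -meanD; [|exact: intbleZ..].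
by congr mean; apply/funext => x; rewrite ImM.
Qed.

Lemma cint_sum (I : Type) (s : seq I) (f : I -> pt -> C) :
  (forall i, cintble (f i)) ->
  cint (fun x => \sum_(i <- s) f i x) = \sum_(i <- s) cint (f i).
Proof.
move=> fi; elim: s => [|i s IH].
  rewrite big_nil (_ : (fun _ => _) = fun=> 0).
    by rewrite cintE /= !mean_cst.
  by apply/funext => x; rewrite big_nil.
rewrite big_cons -IH -cintD//; last exact: cintble_sum.
by congr cint; apply/funext => x; rewrite big_cons.
Qed.

Lemma cint_cst (c : C) : cint (fun _ : pt => c) = c.
Proof. by rewrite cintE !mean_cst; case: c. Qed.

Lemma cintble_affine f (a : pt) (e : R) : (e = 1 \/ e = -1) -> Defs.periodic f -> cintble f ->
  cintble (fun x => f (a + e *: x)).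
Proof.
move=> he pf [mf ifn]; split; first exact: cmeasurable_affine.
by apply: (intble_affine (g := fun x => nc (f x))) => // x i; rewrite pf.
Qed.

Lemma cint_affine f (a : pt) (e : R) : (e = 1 \/ e = -1) -> Defs.periodic f -> cintble f ->
  cint (fun x => f (a + e *: x)) = cint f.
Proof.
move=> he pf fi; rewrite !cintE; congr (_ +i* _).
  by apply: (mean_affine (g := fun x => complex.Re (f x))) => //;
    [move=> x i; rewrite pf|exact: cintble_Re].
by apply: (mean_affine (g := fun x => complex.Im (f x))) => //;
  [move=> x i; rewrite pf|exact: cintble_Im].
Qed.

End complex_integral.

(** * Characters, Fourier coefficients and Parseval's identity *)

Section trigonometric_polynomials.
Context {R : realType} {d : nat}.
Local Open Scope complex_scope.
Local Notation pt := 'rV[R]_d.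
Local Notation freq := 'rV[int]_d.
Local Notation C := R[i].
Local Notation nc := (@Normc.normc R).
Implicit Types (f g : pt -> C) (k l : freq) (x y : pt) (a b : freq -> C).

Definition expk k x : C := cexpi (\sum_(i < d) ((k ord0 i)%:~R * x ord0 i)).

Lemma normc_expk k x : nc (expk k x) = 1.
Proof. exact: normc_cexpi. Qed.

Lemma expkD k l x : expk (k + l) x = expk k x * expk l x.
Proof.
rewrite /expk -cexpiD -big_split /=; congr cexpi; apply: eq_bigr => i _.
by rewrite mxE intrD mulrDl.
Qed.

Lemma expk_addpt k x y : expk k (x + y) = expk k x * expk k y.
Proof.
rewrite /expk -cexpiD -big_split /=; congr cexpi; apply: eq_bigr => i _.
by rewrite mxE mulrDr.
Qed.

Lemma expk0 x : expk 0 x = 1.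
Proof. by rewrite /expk big1 ?cexpi0// => i _; rewrite mxE mul0r. Qed.

Lemma expkN k x : expk (- k) x = conjc (expk k x).
Proof.
rewrite /expk -cexpiN -sumrN; congr cexpi; apply: eq_bigr => i _.
by rewrite mxE mulrNz mulNr.
Qed.

Lemma expk_Npt k x : expk k (- x) = expk (- k) x.
Proof.
by rewrite /expk; congr cexpi; apply: eq_bigr => i _; rewrite !mxE mulrNz mulNr mulrN.
Qed.

Lemma expk_conj k x : expk k x * conjc (expk k x) = 1.
Proof. by rewrite mulc_conj normc_expk expr1n. Qed.

Lemma expk_periodic k : Defs.periodic (expk k).
Proof.
move=> x i; rewrite expk_addpt [X in _ * X](_ : _ = 1) ?mulr1//.
rewrite /expk (bigD1 i)//= big1 => [|j ji]; last first.
  by rewrite !mxE eqxx (negbTE ji) mulr0 mulr0.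
by rewrite addr0 !mxE !eqxx mulr1 mulrC cexpi_2pi.
Qed.

Lemma cmeasurable_expk k : cmeasurable (expk k).
Proof.
have ms : mble (fun x : pt => \sum_(i < d) ((k ord0 i)%:~R * x ord0 i)).
  apply: measurable_sum => i; apply: measurable_funM => //.
  exact: measurable_coord.
apply/cmeasurableE; split => /=.
  apply: (measurableT_comp (f := @cos R)) ms.
  by apply: continuous_measurable_fun; exact: continuous_cos.
apply: (measurableT_comp (f := @sin R)) ms.
by apply: continuous_measurable_fun; exact: continuous_sin.
Qed.

Lemma cintble_expk k : cintble (expk k).
Proof.
by apply: (cintble_bounded (B := 1) (cmeasurable_expk k)) => x; rewrite normc_expk.
Qed.

(* Translation invariance forces the mean of a nontrivial character to vanish. *)
Lemma cint_expk k : cint (expk k) = (k == 0)%:R.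
Proof.
have [->|k0] := eqVneq k 0.
  rewrite (_ : expk 0 = fun=> 1) ?cint_cst//.
  by apply/funext => x; rewrite expk0.
have [i ki] : exists i, k ord0 i != 0.
  apply/existsP; apply: contraNT k0 => /existsPn h.
  by apply/eqP/rowP => i; rewrite mxE; apply/eqP; move: (h i); rewrite negbK.
(* Half a period of the character along an axis where k does not vanish, so that it changes sign. *)
pose h : pt := (pi / (k ord0 i)%:~R) *: delta_mx 0 i.
have eh : expk k h = -1.
  rewrite /expk (bigD1 i)//= big1 => [|j ji]; last first.
    by rewrite !mxE eqxx (negbTE ji) mulr0 mulr0.
  rewrite addr0 !mxE !eqxx mulr1 mulrC mulfVK ?intr_eq0//.
  by rewrite /cexpi cospi sinpi; apply: complex_eq => //=; rewrite oppr0.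
have := cint_affine h (or_introl erefl) (@expk_periodic k) (cintble_expk k).
rewrite (_ : (fun x => _) = fun x => -1 * expk k x); last first.
  by apply/funext => x; rewrite scale1r expk_addpt eh.
rewrite cintZ; last exact: cintble_expk.
rewrite mulN1r => /eqP; rewrite eq_sym -addr_eq0 -mulr2n mulrn_eq0/=.
by move/eqP.
Qed.

(** The coefficients live on all of Z^d and the list only selects: multipliers act on [a], and lists
    containing the same part of its support can be exchanged by [trigp_supp]. *)
Definition trigp a (s : seq freq) x : C := \sum_(k <- s) a k * expk k x.

Lemma trigp_periodic a s : Defs.periodic (trigp a s).
Proof. by move=> x i; apply: eq_bigr => k _; rewrite expk_periodic. Qed.

Lemma cmeasurable_trigp a s : cmeasurable (trigp a s).
Proof.
apply: cmeasurable_sum => k; apply: cmeasurableM (cmeasurable_expk k).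
exact: cmeasurable_cst.
Qed.

Lemma normc_trigp a s x : nc (trigp a s x) <= \sum_(k <- s) nc (a k).
Proof.
apply: le_trans (normc_sum _ _ _) _; apply: ler_sum => k _.
by rewrite Normc.normcM normc_expk mulr1.
Qed.

Lemma cintble_trigp a s : cintble (trigp a s).
Proof.
by apply: cintble_bounded (cmeasurable_trigp a s) _ => x; exact: normc_trigp.
Qed.

Lemma eq_trigp a b s x : {in s, a =1 b} -> trigp a s x = trigp b s x.
Proof. by move=> ab; apply: eq_big_seq => k /ab ->. Qed.

Lemma trigpB a b s x :
  trigp (fun k => a k - b k) s x = trigp a s x - trigp b s x.
Proof.
rewrite /trigp -sumrN -big_split; apply: eq_bigr => k _ /=; by rewrite mulrBl.
Qed.

Lemma trigpD a b s x :
  trigp (fun k => a k + b k) s x = trigp a s x + trigp b s x.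
Proof.
rewrite /trigp -big_split; apply: eq_bigr => k _ /=; by rewrite mulrDl.
Qed.

Lemma trigpZ (c : C) a s x : trigp (fun k => c * a k) s x = c * trigp a s x.
Proof. by rewrite /trigp mulr_sumr; apply: eq_bigr => k _; rewrite mulrA. Qed.

Lemma trigp_filter a s (P : pred freq) x :
  trigp a [seq k <- s | P k] x = trigp (fun k => if P k then a k else 0) s x.
Proof.
rewrite /trigp big_filter big_mkcond; apply: eq_bigr => k _.
by case: ifP => // _; rewrite mul0r.
Qed.

Lemma trigp_supp a s s' x : uniq s -> uniq s' ->
  (forall k, a k != 0 -> (k \in s) = (k \in s')) -> trigp a s x = trigp a s' x.
Proof.
move=> us us' h.
have E t : trigp a t x = trigp a [seq k <- t | a k != 0] x.
  by rewrite trigp_filter; apply: eq_trigp => k _; case: eqP.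
rewrite (E s) (E s'); apply: perm_big; apply: uniq_perm; rewrite ?filter_uniq//.
by move=> k; rewrite !mem_filter; case ak: (a k != 0) => //=; exact: h.
Qed.

Definition fcoef f k : C := cint (fun y => f y * expk (- k) y).

Lemma cintble_fcoef f k : cintble f -> cintble (fun y => f y * expk k y).
Proof.
move=> fi; apply: (cintbleM_bounded (B := 1) fi (cmeasurable_expk k)) => x.
by rewrite normc_expk.
Qed.

Lemma fcoef_trigp a s k : uniq s ->
  fcoef (trigp a s) k = if k \in s then a k else 0.
Proof.
move=> us; rewrite /fcoef.
rewrite (_ : (fun y => _) = fun y => \sum_(l <- s) a l * expk (l - k) y).
  rewrite cint_sum; last by move=> l; apply: cintbleZ; exact: cintble_expk.
  rewrite (eq_bigr (fun l => if l == k then a l else 0)) => [|l _].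
    case: ifPn => ks.
      by rewrite (bigD1_seq k)//= eqxx big1 ?addr0// => l /negPf->.
    rewrite big_seq big1// => l ls; case: eqP => // lk.
    by rewrite -lk ls in ks.
  rewrite cintZ ?cint_expk ?subr_eq0; last exact: cintble_expk.
  by case: eqP => _; rewrite ?mulr1 ?mulr0.
apply/funext => y; rewrite /trigp mulr_suml; apply: eq_bigr => l _.
by rewrite -mulrA -expkD.
Qed.

(** Only the polynomial is expanded, so f may be any integrable function; taking f equal to the
    polynomial gives [parseval]. *)
Lemma cint_mul_trigp f b s : cintble f ->
  cint (fun x => f x * conjc (trigp b s x)) = \sum_(k <- s) fcoef f k * conjc (b k).
Proof.
move=> fi; rewrite (_ : (fun x => _) =
   fun x => \sum_(k <- s) conjc (b k) * (f x * expk (- k) x)).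
  rewrite cint_sum; last by move=> k; apply: cintbleZ; exact: cintble_fcoef.
  apply: eq_bigr => k _; rewrite cintZ; last exact: cintble_fcoef.
  by rewrite mulrC.
apply/funext => x; rewrite /trigp conjc_sum mulr_sumr; apply: eq_bigr => k _.
by rewrite conjcM -expkN; ring.
Qed.

Lemma intble_trigp_normc2 a s : intble (fun x => nc (trigp a s x) ^+ 2).
Proof.
apply: (intble_bounded (B := (\sum_(k <- s) nc (a k)) ^+ 2)).
  by apply: measurable_funX; apply: mble_normc; exact: cmeasurable_trigp.
move=> x; rewrite ger0_norm ?sqr_ge0// ler_pXn2r ?nnegrE ?normc_ge0//.
  exact: normc_trigp.
by apply: sumr_ge0 => k _; exact: normc_ge0.
Qed.

Lemma parseval a s : uniq s ->
  mean (fun x => nc (trigp a s x) ^+ 2) = \sum_(k <- s) nc (a k) ^+ 2.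
Proof.
move=> us; have /(congr1 (@complex.Re R)) := cint_mul_trigp a s (cintble_trigp a s).
rewrite cintE /= (_ : (fun x => _) = fun x => nc (trigp a s x) ^+ 2); last first.
  by apply/funext => x; rewrite mulc_conj.
move=> ->; rewrite Re_sum big_seq [RHS]big_seq; apply: eq_bigr => k ks.
by rewrite fcoef_trigp// ks mulc_conj.
Qed.

Lemma fcoefB f g k : cintble f -> cintble g ->
  fcoef (fun x => f x - g x) k = fcoef f k - fcoef g k.
Proof.
move=> fi gi; rewrite /fcoef (_ : (fun y => _) =
  fun y => f y * expk (- k) y + -1 * (g y * expk (- k) y)).
  rewrite cintD ?cintZ ?mulN1r//; try exact: cintble_fcoef.
  by apply: cintbleZ; exact: cintble_fcoef.
by apply/funext => y; ring.
Qed.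

Lemma fcoef_shift f h k : Defs.periodic f -> cintble f ->
  fcoef (fun x => f (x + h)) k = expk k h * fcoef f k.
Proof.
move=> pf fi; rewrite /fcoef -cintZ; last exact: cintble_fcoef.
rewrite -[RHS](cint_affine h (or_introl erefl)).
- congr cint; apply/funext => x; rewrite scale1r (addrC h) expk_addpt.
  rewrite [expk (- k) h]expkN; set u := expk k h; set w := expk (- k) x.
  transitivity ((u * conjc u) * (f (x + h) * w)); first by rewrite expk_conj mul1r.
  by ring.
- by move=> x i; rewrite pf expk_periodic.
- by apply: cintbleZ; exact: cintble_fcoef.
Qed.

Lemma cint_conv_expk f k x : Defs.periodic f -> cintble f ->
  cint (fun y => f (x - y) * expk k y) = expk k x * fcoef f k.
Proof.
move=> pf fi; rewrite /fcoef -cintZ; last exact: cintble_fcoef.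
rewrite -[RHS](cint_affine x (or_intror erefl)).
- congr cint; apply/funext => y; rewrite scaleN1r expk_addpt expk_Npt opprK.
  rewrite expkN; set u := expk k x; set w := expk k y.
  transitivity ((u * conjc u) * (f (x - y) * w)); first by rewrite expk_conj mul1r.
  by ring.
- by move=> y i; rewrite pf expk_periodic.
- by apply: cintbleZ; exact: cintble_fcoef.
Qed.

End trigonometric_polynomials.

(** * Boxes of frequencies *)

Section frequency_boxes.
Context {d : nat}.
Local Notation freq := 'rV[int]_d.

(** Points of [-M, M]^d are coded by finite functions, which lets [bigA_distr_bigA] expand a product
    over coordinates of one-dimensional sums. *)
Definition box_freq (M : nat) (f : {ffun 'I_d -> 'I_(2 * M).+1}) : freq :=
  \row_j ((f j : nat)%:Z - M%:Z).

Definition fbox (M : nat) : seq freq := [seq box_freq f | f <- enum {ffun 'I_d -> 'I_(2 * M).+1}].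

Lemma box_freq_inj M : injective (@box_freq M).
Proof.
move=> f g /rowP fg; apply/ffunP => j; apply: val_inj.
by have := fg j; rewrite !mxE => /addIr [].
Qed.

Lemma uniq_fbox M : uniq (fbox M).
Proof. by rewrite map_inj_uniq ?enum_uniq//; exact: box_freq_inj. Qed.

Lemma size_fbox M : size (fbox M) = ((2 * M).+1 ^ d)%N.
Proof. by rewrite size_map -cardE card_ffun !card_ord. Qed.

Definition supn (k : freq) : nat := \max_(i < d) `|k ord0 i|%N.

Lemma supn_leP (k : freq) M : reflect (forall i, `|k ord0 i|%N <= M)%N (supn k <= M)%N.
Proof.
apply: (iffP idP) => [h i|h]; last by apply/bigmax_leqP => i _.
by apply: leq_trans h; exact: (@leq_bigmax _ (fun i => `|k ord0 i|%N)).
Qed.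

Lemma mem_fbox (k : freq) M : (k \in fbox M) = (supn k <= M)%N.
Proof.
apply/mapP/supn_leP => [[f _ ->] i|h].
  rewrite mxE; move: (ltn_ord (f i)); move: (nat_of_ord _) => n; lia.
exists [ffun j => inord (absz (k ord0 j + M%:Z))]; first by rewrite mem_enum.
apply/rowP => j; rewrite mxE ffunE inordK; move: (h j); move: (k ord0 j) => z; lia.
Qed.

Lemma supnN k : supn (- k) = supn k.
Proof. by apply: eq_bigr => i _; rewrite mxE abszN. Qed.

Lemma sum_fbox (V : nmodType) M (F : freq -> V) :
  \sum_(k <- fbox M) F k = \sum_(f : {ffun 'I_d -> 'I_(2 * M).+1}) F (box_freq f).
Proof. by rewrite big_map big_enum. Qed.

End frequency_boxes.

(** * Multipliers of the de la Vallee-Poussin kernel *)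

Section vallee_poussin.
Context {R : realType}.
Local Open Scope complex_scope.
Local Notation C := R[i].

(** The trapezoid of the de la Vallee-Poussin kernel: 1 for |z| <= l, then linear down to 0 at |z| =
    2l. *)
Definition eta1 (l : nat) (z : int) : R :=
  l%:R^-1 * \sum_(l <= k < 2 * l) ((`|z| <= k)%N)%:R.

Lemma eta1_ge0 l z : 0 <= eta1 l z.
Proof. by rewrite mulr_ge0 ?invr_ge0// sumr_ge0. Qed.

Let eta1_cst l : (0 < l)%N -> l%:R^-1 * \sum_(l <= k < 2 * l) 1 = 1 :> R.
Proof.
move=> l0; rewrite big_const_nat iter_addr_0 mul2n -addnn addnK.
by rewrite mulVf// pnatr_eq0 -lt0n.
Qed.

Lemma eta1_le1 l z : (0 < l)%N -> eta1 l z <= 1.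
Proof.
move=> l0; rewrite -[leRHS](eta1_cst l0) ler_wpM2l ?invr_ge0//.
by apply: ler_sum => k _; rewrite lern1 leq_b1.
Qed.

Lemma eta1_eq1 l z : (0 < l)%N -> (`|z| <= l)%N -> eta1 l z = 1.
Proof.
move=> l0 zl; rewrite -[RHS](eta1_cst l0); congr (_ * _).
by apply: eq_big_nat => k /andP[lk _]; rewrite (leq_trans zl lk).
Qed.

Lemma eta1_eq0 l z : (2 * l <= `|z|)%N -> eta1 l z = 0.
Proof.
move=> zl; rewrite /eta1 big_nat big1 ?mulr0// => k /andP[_ kl].
by rewrite leqNgt (leq_trans kl zl).
Qed.

(** All Dirichlet kernels up to M are written over one index range, so that the average over k in
    [vp1] can be exchanged with the sum over frequencies. *)
Lemma dirichletE k M (t : R) : (k <= M)%N -> dirichlet k t =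
  \sum_(j < (2 * M).+1) ((`|j%:Z - M%:Z| <= k)%N)%:R * cexpi ((j%:Z - M%:Z)%:~R * t).
Proof.
move=> kM; rewrite -(big_mkord xpredT (fun j => ((`|j%:Z - M%:Z| <= k)%N)%:R *
   cexpi ((j%:Z - M%:Z)%:~R * t))).
rewrite (@big_cat_nat _ _ _ (M - k)%N)/=; [|lia|lia].
rewrite (@big_cat_nat _ _ _ (M + k).+1 (M - k)%N)/=; [|lia|lia].
rewrite [X in X + _]big_nat [X in X + _]big1 ?add0r; last first.
  by move=> j hj; rewrite [(_ <= k)%N](_ : _ = false) ?mul0r//; apply/negP; lia.
rewrite [X in _ + X]big_nat [X in _ + X]big1 ?addr0; last first.
  by move=> j hj; rewrite [(_ <= k)%N](_ : _ = false) ?mul0r//; apply/negP; lia.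
rewrite -{1}[(M - k)%N]add0n big_addn.
rewrite (_ : ((M + k).+1 - (M - k) = (2 * k).+1)%N); last by lia.
apply: eq_big_nat => j hj; rewrite [(_ <= k)%N](_ : _ = true) ?mul1r; last by lia.
by congr (cexpi (_ * _)); rewrite !intrD !mulrNz -!pmulrn natrD natrB//; ring.
Qed.

Lemma vp1E l M (t : R) : (2 * l <= M)%N -> vp1 l t =
  \sum_(j < (2 * M).+1) (eta1 l (j%:Z - M%:Z))%:C * cexpi ((j%:Z - M%:Z)%:~R * t).
Proof.
move=> lM; rewrite /vp1.
rewrite (@eq_big_nat _ _ _ l (2 * l) _ (fun k => \sum_(j < (2 * M).+1)
  ((`|j%:Z - M%:Z| <= k)%N)%:R * cexpi ((j%:Z - M%:Z)%:~R * t))); last first.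
  by move=> k /andP[_ kl]; apply: dirichletE; exact: leq_trans (ltnW kl) lM.
rewrite exchange_big /= mulr_sumr; apply: eq_bigr => j _.
rewrite -mulr_suml mulrA; congr (_ * _).
rewrite /eta1 rmorphM /= rmorph_sum /= fmorphV rmorph_nat; congr (_ * _).
by apply: eq_bigr => k _; rewrite rmorph_nat.
Qed.

End vallee_poussin.

(** * Dyadic blocks and the operators sigma_s *)

Section littlewood_paley.
Context {R : realType} {d : nat}.
Local Open Scope complex_scope.
Local Notation pt := 'rV[R]_d.
Local Notation freq := 'rV[int]_d.
Local Notation C := R[i].
Local Notation nc := (@Normc.normc R).

Definition etad (l : nat) (k : freq) : R := \prod_(j < d) eta1 l (k ord0 j).

Lemma etad_ge0 l k : 0 <= etad l k.
Proof. by apply: prodr_ge0 => j _; exact: eta1_ge0. Qed.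

Lemma etad_le1 l k : (0 < l)%N -> etad l k <= 1.
Proof. by move=> l0; apply: prodr_ile1 => j _; rewrite eta1_ge0 eta1_le1. Qed.

Lemma etad_eq1 l k : (0 < l)%N -> (supn k <= l)%N -> etad l k = 1.
Proof. by move=> l0 /supn_leP h; rewrite /etad big1// => j _; exact: eta1_eq1. Qed.

Lemma etad_eq0 l k : (0 < l)%N -> (2 * l <= supn k)%N -> etad l k = 0.
Proof.
move=> l0 h; have /existsP[j hj] : [exists j : 'I_d, (2 * l <= `|k ord0 j|)%N].
  apply: contraLR h => /existsPn h; rewrite -ltnNge.
  rewrite -[X in (_ < X)%N]prednK ?ltnS; last by lia.
  by apply/supn_leP => i; have := h i; lia.
by apply/eqP/prodf_eq0; exists j => //; rewrite eta1_eq0.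
Qed.

Lemma vpdE l M (x : pt) : (2 * l <= M)%N ->
  vpd l x = trigp (fun k => (etad l k)%:C) (fbox M) x.
Proof.
move=> lM; rewrite /vpd.
under eq_bigr do rewrite (vp1E _ lM).
rewrite bigA_distr_bigA /trigp sum_fbox /=; apply: eq_bigr => f _.
rewrite big_split /= /etad rmorph_prod; congr (_ * _).
  by apply: eq_bigr => j _; rewrite mxE.
rewrite /expk.
rewrite (_ : (\sum_(i < d) _) = \sum_(i < d) (((f i : nat)%:Z - M%:Z)%:~R * x ord0 i)).
  elim/big_rec2: _ => [|j a b _ ->]; first by rewrite cexpi0.
  by rewrite cexpiD.
by apply: eq_bigr => j _; rewrite mxE.
Qed.

Lemma vpconvE l M (f : pt -> C) x : Defs.periodic f -> cintble f ->
  (2 * l <= M)%N ->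
  vpconv l f x = trigp (fun k => (etad l k)%:C * fcoef f k) (fbox M) x.
Proof.
move=> pf fi lM; rewrite /vpconv.
rewrite (_ : (fun y => _) = fun y => \sum_(k <- fbox M)
   (etad l k)%:C * (f (x - y) * expk k y)); last first.
  apply/funext => y; rewrite (vpdE _ lM) /trigp mulr_sumr; apply: eq_bigr => k _.
  by ring.
have fi' : cintble (fun y => f (x - y)).
  have := cintble_affine x (or_intror erefl) pf fi.
  by under eq_fun do rewrite scaleN1r.
rewrite cint_sum; last by move=> k; apply: cintbleZ; exact: cintble_fcoef.
apply: eq_bigr => k _; rewrite cintZ; last exact: cintble_fcoef.
by rewrite cint_conv_expk//; ring.
Qed.

Definition lpmult (s : nat) (k : freq) : R :=
  if s is s'.+1 then etad (2 ^ s) k - etad (2 ^ s') k else etad 1 k.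

Lemma sigma_sE s (f : pt -> C) x : Defs.periodic f -> cintble f ->
  sigma_s s f x = trigp (fun k => (lpmult s k)%:C * fcoef f k) (fbox (2 ^ s.+1)) x.
Proof.
move=> pf fi; case: s => [|s] /=; first exact: vpconvE.
rewrite (vpconvE (M := 2 ^ s.+2))//.
rewrite (vpconvE (M := 2 ^ s.+2))//; last by rewrite -expnS leq_exp2l.
by rewrite -trigpB; congr trigp; apply/funext => k; rewrite rmorphB /= mulrBl.
Qed.

Lemma lpmult_norm s k : `|lpmult s k| <= 1.
Proof.
case: s => [|s] /=; first by rewrite ger0_norm ?etad_ge0// etad_le1.
have h1 := etad_ge0 (2 ^ s.+1) k; have h3 := etad_ge0 (2 ^ s) k.
have h2 : etad (2 ^ s.+1) k <= 1 by apply: etad_le1; rewrite expn_gt0.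
have h4 : etad (2 ^ s) k <= 1 by apply: etad_le1; rewrite expn_gt0.
by rewrite ler_norml; apply/andP; split; lra.
Qed.

Lemma lpmult_sum n k : \sum_(0 <= s < n.+1) lpmult s k = etad (2 ^ n) k.
Proof.
elim: n => [|n IH]; first by rewrite big_nat1.
by rewrite big_nat_recr//= IH addrC subrK.
Qed.

(** Level 0 collects the sup-norms 0 and 1; level s > 0 those in (2^(s-1), 2^s]. *)
Definition lev (k : freq) : nat := up_log 2 (supn k).

Lemma lev_leE k n : (lev k <= n)%N = (supn k <= 2 ^ n)%N.
Proof.
rewrite /lev; apply/idP/idP => h.
  by apply: (leq_trans (@up_logP 2 (supn k) isT)); rewrite leq_pexp2l.
exact: up_log_min.
Qed.

(** Below level s the cut-offs at 2^s and 2^(s-1) both equal 1 and cancel; above level s + 1 both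
    vanish. For s = 0 only the first cut-off is present. *)
Lemma lpmult_eq0 s k : lev k != s -> lev k != s.+1 -> lpmult s k = 0.
Proof.
move=> h1 h2; have [h|h] := leqP (lev k) s; last first.
  have h3 : (s.+1 < lev k)%N by rewrite ltn_neqAle eq_sym h2.
  have h4 : (2 ^ s.+1 < supn k)%N by rewrite ltnNge -lev_leE -ltnNge.
  case: s h1 h2 h h3 h4 => [|s] h1 h2 h h3 h4 /=.
    by apply: etad_eq0 => //; rewrite ltnW.
  rewrite !etad_eq0 ?subrr ?expn_gt0//; last by rewrite -expnS ltnW.
  by rewrite -expnS (leq_trans _ (ltnW h4))// leq_pexp2l.
have {}h : (lev k < s)%N by rewrite ltn_neqAle h1.
case: s h1 h2 h => [|s] h1 h2 h //=.
by rewrite !etad_eq1 ?subrr ?expn_gt0// -lev_leE ?(ltnW h)//.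
Qed.

Definition dblock (s : nat) : seq freq := [seq k <- fbox (2 ^ s) | lev k == s].

Lemma uniq_dblock s : uniq (dblock s).
Proof. by rewrite filter_uniq// uniq_fbox. Qed.

Lemma mem_dblock s k : (k \in dblock s) = (lev k == s).
Proof.
rewrite mem_filter mem_fbox -lev_leE; case: eqP => // ->; exact: leqnn.
Qed.

Lemma size_dblock s : (size (dblock s) <= 4 ^ d * (2 ^ s) ^ d)%N.
Proof.
(* The box has (2 * 2^s + 1)^d points, and 2 * 2^s + 1 <= 4 * 2^s. *)
rewrite size_filter (leq_trans (count_size _ _))// size_fbox -expnMn.
have [->|d0] := posnP d; first by rewrite !expn0.
have : (0 < 2 ^ s)%N by rewrite expn_gt0.
by rewrite leq_exp2r//; lia.
Qed.

Lemma sigma_s_dblock s (f : pt -> C) x : Defs.periodic f -> cintble f ->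
  sigma_s s f x = trigp (fun k => (lpmult s k)%:C * fcoef f k) (dblock s) x +
                  trigp (fun k => (lpmult s k)%:C * fcoef f k) (dblock s.+1) x.
Proof.
move=> pf fi; rewrite sigma_sE//.
pose a k := (lpmult s k)%:C * fcoef f k.
transitivity (trigp a (dblock s ++ dblock s.+1) x); last by rewrite /trigp big_cat.
apply: trigp_supp; first exact: uniq_fbox.
  rewrite cat_uniq !uniq_dblock andbT /=; apply/hasPn => k.
  by rewrite !mem_dblock => /eqP ->; rewrite eqn_leq ltnn.
move=> k; rewrite mem_cat !mem_dblock mem_fbox -lev_leE /a => h.
have {h}: lpmult s k != 0 by apply: contraNneq h => ->; rewrite mul0r.
move=> h; have : (lev k == s) || (lev k == s.+1).
  apply: contraNT h; rewrite negb_or => /andP[h1 h2].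
  by apply/eqP; exact: lpmult_eq0.
by move=> h'; rewrite h'; case/orP: h' => /eqP ->; rewrite ?leqnn ?leqnSn.
Qed.

End littlewood_paley.

(** * Inequalities for L_p norms *)

Section Lp_bounds.
Context {R : realType} {d : nat}.
Local Open Scope complex_scope.
Local Notation pt := 'rV[R]_d.
Local Notation freq := 'rV[int]_d.
Local Notation C := R[i].
Local Notation nc := (@Normc.normc R).
Implicit Types f g : pt -> C.

Lemma eq_ler (x y : R) : x = y -> x <= y.
Proof. by move=> ->. Qed.

Lemma ler_powR2r (r a b : R) : 0 <= r -> 0 <= a -> a <= b -> a `^ r <= b `^ r.
Proof.
move=> r0 a0 ab; apply: ge0_ler_powR => //; rewrite nnegrE//.
exact: le_trans ab.
Qed.

Lemma powRK (a r : R) : 0 <= a -> r != 0 -> (a `^ r) `^ r^-1 = a.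
Proof. by move=> a0 r0; rewrite -powRrM mulfV// powRr1. Qed.

Lemma powRVK (a r : R) : 0 <= a -> r != 0 -> (a `^ r^-1) `^ r = a.
Proof. by move=> a0 r0; rewrite -powRrM mulVf// powRr1. Qed.

Lemma poweR_leP (x : \bar R) (p B : R) : 0 < p -> 0 <= B -> (0 <= x)%E ->
  (x `^ p^-1 <= B%:E)%E <-> (x <= (B `^ p)%:E)%E.
Proof.
move=> p0 B0; have p0' : p != 0 by rewrite gt_eqF.
case: x => [x| |//] x0.
  rewrite poweR_EFin !lee_fin; rewrite lee_fin in x0; split => h.
    by rewrite -(powRVK x0 p0') ler_powR2r ?powR_ge0// ltW.
  by rewrite -(powRK B0 p0') ler_powR2r ?invr_ge0// ltW.
by rewrite poweRyr ?invr_eq0.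
Qed.

Lemma Lpnorm_leP (p B : R) f : 0 < p -> 0 <= B ->
  (Lpnorm p f <= B%:E)%E <->
  (torus_int (fun x => (nc (f x) `^ p)%:E) <= (B `^ p)%:E)%E.
Proof.
move=> p0 B0; apply: poweR_leP => //; apply: ge0_torus_int => x.
by rewrite lee_fin powR_ge0.
Qed.

Lemma mble_powR_normc p f : cmeasurable f -> mble (fun x => nc (f x) `^ p).
Proof.
move=> mf; apply: (measurableT_comp (measurable_powR p)); exact: mble_normc.
Qed.

(** [Lpnorm] is an extended real; it is a real bound B that yields integrability, so estimates are
    passed on in the form [Lpnorm p f <= B%:E]. *)
Lemma Lpnorm_intble (p B : R) f : 0 < p -> 0 <= B -> cmeasurable f ->
  (Lpnorm p f <= B%:E)%E -> intble (fun x => nc (f x) `^ p) /\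
  mean (fun x => nc (f x) `^ p) <= B `^ p.
Proof.
move=> p0 B0 mf /Lpnorm_leP -/(_ p0 B0) h.
have i1 : intble (fun x => nc (f x) `^ p).
  apply/intbleP; split; first exact: mble_powR_normc.
  apply: le_lt_trans (ltry (B `^ p)); apply: le_trans h.
  rewrite (_ : (fun x => _) = fun x => (nc (f x) `^ p)%:E)//.
  by apply/funext => x; rewrite ger0_norm// powR_ge0.
by split=> //; move: h; rewrite torus_int_mean// lee_fin.
Qed.

Lemma Lpnorm_le_mean (p B : R) f : 0 < p -> 0 <= B ->
  intble (fun x => nc (f x) `^ p) -> mean (fun x => nc (f x) `^ p) <= B `^ p ->
  (Lpnorm p f <= B%:E)%E.
Proof.
by move=> p0 B0 i1 h; apply/Lpnorm_leP => //; rewrite torus_int_mean// lee_fin.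
Qed.

Lemma Lpnorm_ge0 p f : (0 <= Lpnorm p f)%E.
Proof. exact: poweR_ge0. Qed.

(* The factor 4 is not optimal but avoids Minkowski's inequality. *)
Lemma Lpnorm_quasi_triangle (p A B : R) f g : 1 <= p -> 0 <= A -> 0 <= B ->
  cmeasurable f -> cmeasurable g ->
  (Lpnorm p f <= A%:E)%E -> (Lpnorm p g <= B%:E)%E ->
  (Lpnorm p (fun x => (f x + g x)%R) <= (4 * (A + B))%:E)%E.
Proof.
move=> p1 A0 B0 mf mg hf hg; have p0 : 0 < p by exact: lt_le_trans p1.
have [i1 m1] := Lpnorm_intble p0 A0 mf hf.
have [i2 m2] := Lpnorm_intble p0 B0 mg hg.
(* |u + v| <= 2 max(|u|, |v|) gives one factor 2; the other comes from A^p + B^p <= 2 (A + B)^p <=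
   (2 (A + B))^p. *)
have pt_le x : nc (f x + g x) `^ p <= 2 `^ p * (nc (f x) `^ p + nc (g x) `^ p).
  have h0 := normc_ge0 (f x); have h1 := normc_ge0 (g x).
  apply: (@le_trans _ _ ((2 * Num.max (nc (f x)) (nc (g x))) `^ p)).
    apply: ler_powR2r; [exact: ltW|exact: normc_ge0|].
    apply: le_trans (normcD _ _) _; rewrite mulr_natl mulr2n lerD//.
      by rewrite le_max lexx.
    by rewrite le_max lexx orbT.
  rewrite powRM//; last by rewrite le_max h0.
  rewrite ler_wpM2l ?powR_ge0//; case: (leP (nc (f x)) (nc (g x))) => _.
    by rewrite lerDr powR_ge0.
  by rewrite lerDl powR_ge0.
have i3 : intble (fun x => 2 `^ p * (nc (f x) `^ p + nc (g x) `^ p)).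
  by apply: intbleZ; exact: intbleD.
have i4 : intble (fun x => nc (f x + g x) `^ p).
  apply: intble_le i3; first by apply: mble_powR_normc; exact: cmeasurableD.
  by move=> x; rewrite ger0_norm ?powR_ge0.
apply: Lpnorm_le_mean => //; first by rewrite mulr_ge0// addr_ge0.
apply: le_trans (le_mean i4 i3 pt_le) _.
rewrite meanZ ?meanD//; last exact: intbleD.
rewrite (_ : 4 * (A + B) = 2 * (2 * (A + B))); last by ring.
rewrite powRM ?mulr_ge0 ?addr_ge0// ler_wpM2l ?powR_ge0//.
rewrite powRM ?addr_ge0//.
apply: (@le_trans _ _ (2 * (A + B) `^ p)).
  rewrite mulr_natl mulr2n lerD//.
    by apply: le_trans m1 _; apply: ler_powR2r; rewrite ?(ltW p0) ?lerDl.
  by apply: le_trans m2 _; apply: ler_powR2r; rewrite ?(ltW p0) ?lerDr.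
by rewrite ler_wpM2r ?powR_ge0// le1r_powR// ler1n.
Qed.

(** Holder's inequality: Young's inequality for |f| / A and |g| / B is integrated. Positive A and B
    make this normalisation possible. *)
Lemma mean_mul_le (p q A B : R) f g : 0 < p -> 0 < q -> p^-1 + q^-1 = 1 ->
  0 < A -> 0 < B -> cmeasurable f -> cmeasurable g ->
  (Lpnorm p f <= A%:E)%E -> (Lpnorm q g <= B%:E)%E ->
  intble (fun x => nc (f x) * nc (g x)) /\
  mean (fun x => nc (f x) * nc (g x)) <= A * B.
Proof.
move=> p0 q0 pq A0 B0 mf mg hf hg.
have [i1 m1] := Lpnorm_intble p0 (ltW A0) mf hf.
have [i2 m2] := Lpnorm_intble q0 (ltW B0) mg hg.
pose u x := (A * B) * ((p^-1 / A `^ p) * nc (f x) `^ p + (q^-1 / B `^ q) * nc (g x) `^ q).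
have iu : intble u by apply: intbleZ; apply: intbleD; apply: intbleZ.
have fgu x : nc (f x) * nc (g x) <= u x.
  have h0 := normc_ge0 (f x); have h1 := normc_ge0 (g x).
  have := @conjugate_powR R (nc (f x) / A) (nc (g x) / B) p q.
  rewrite !divr_ge0 ?(ltW A0) ?(ltW B0)// => /(_ isT isT p0 q0 pq).
  rewrite !powRM ?invr_ge0 ?(ltW A0) ?(ltW B0)//.
  rewrite -[A^-1]powR_inv1 ?(ltW A0)// -[B^-1]powR_inv1 ?(ltW B0)//.
  rewrite -!powRrM !mulN1r !powRN !powRr1 ?(ltW A0) ?(ltW B0)//.
  move=> H; rewrite -ler_pdivrMl ?mulr_gt0//; apply: le_trans (le_trans _ H) _.
    by rewrite invfM; apply: eq_ler; ring.
  by apply: eq_ler; ring.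
have ifg : intble (fun x => nc (f x) * nc (g x)).
  apply: intble_le iu; first by apply: measurable_funM; exact: mble_normc.
  by move=> x; rewrite ger0_norm ?mulr_ge0 ?normc_ge0.
split=> //; apply: le_trans (le_mean ifg iu fgu) _.
rewrite /u meanZ; last by apply: intbleD; apply: intbleZ.
rewrite meanD; [|exact: intbleZ..].
rewrite !meanZ// -[leRHS]mulr1 ler_wpM2l ?mulr_ge0 ?(ltW A0) ?(ltW B0)//.
rewrite -[leRHS]pq; apply: lerD.
  rewrite -mulrA ler_piMr ?invr_ge0 ?(ltW p0)//.
  by rewrite mulrC ler_pdivrMr ?powR_gt0// mul1r.
rewrite -mulrA ler_piMr ?invr_ge0 ?(ltW q0)//.
by rewrite mulrC ler_pdivrMr ?powR_gt0// mul1r.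
Qed.

(* AM-GM in place of Cauchy-Schwarz. *)
Lemma sum_le_sqrt_sum_sqr (I : Type) (s : seq I) (x : I -> R) (N L : R) :
  (size s)%:R <= N -> 0 < N -> 0 < L -> \sum_(i <- s) x i ^+ 2 <= L ^+ 2 ->
  \sum_(i <- s) x i <= N `^ 2^-1 * L.
Proof.
move=> sN N0 L0 hL; set w := N `^ 2^-1.
have w0 : 0 < w by exact: powR_gt0.
have w2 : w ^+ 2 = N by rewrite -powR_mulrn ?ltW// powRVK ?ltW.
have key y : y <= (w / (2 * L)) * y ^+ 2 + L / (2 * w).
  have h : 0 <= (w * y - L) ^+ 2 by exact: sqr_ge0.
  have -> : (w / (2 * L)) * y ^+ 2 + L / (2 * w) =
    ((w * y - L) ^+ 2) / (2 * w * L) + y by field; lra.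
  by rewrite lerDr divr_ge0// !mulr_ge0// ltW.
apply: (@le_trans _ _ (\sum_(i <- s) ((w / (2 * L)) * x i ^+ 2 + L / (2 * w)))).
  by apply: ler_sum.
rewrite big_split /= -mulr_sumr big_const_seq count_predT iter_addr_0.
apply: (@le_trans _ _ ((w / (2 * L)) * L ^+ 2 + L / (2 * w) * w ^+ 2)).
  apply: lerD.
    by rewrite ler_wpM2l// divr_ge0 ?mulr_ge0 ?ltW.
  by rewrite -[leLHS]mulr_natr ler_wpM2l ?w2// divr_ge0 ?mulr_ge0 ?ltW.
by apply: eq_ler; field; lra.
Qed.

(** The sup bound S = N^(1/2) L absorbs q - 2 of the q powers, and Parseval evaluates the remaining
    square. Only the number of frequencies enters, not their position. *)
Lemma nikolskii (a : freq -> C) (s : seq freq) (q N L : R) : 2 <= q -> uniq s ->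
  (size s)%:R <= N -> 0 < N -> 0 < L -> \sum_(k <- s) nc (a k) ^+ 2 <= L ^+ 2 ->
  (Lpnorm q (trigp a s) <= (N `^ (2^-1 - q^-1) * L)%:E)%E.
Proof.
move=> q2 us sN N0 L0 hL; have q0 : 0 < q by lra.
pose S := N `^ 2^-1 * L.
have S0 : 0 < S by rewrite mulr_gt0// powR_gt0.
have PS x : nc (trigp a s x) <= S.
  by apply: le_trans (normc_trigp _ _ _) _; exact: sum_le_sqrt_sum_sqr.
have le1 x : nc (trigp a s x) `^ q <= S `^ (q - 2) * nc (trigp a s x) ^+ 2.
  have P0 := normc_ge0 (trigp a s x).
  have -> : nc (trigp a s x) `^ q =
      nc (trigp a s x) `^ (q - 2) * nc (trigp a s x) ^+ 2.
    rewrite -powR_mulrn// -powRD ?subrK//.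
    by apply/implyP => /eqP; lra.
  by rewrite ler_wpM2r ?sqr_ge0// ler_powR2r// subr_ge0.
have i2 := intble_trigp_normc2 a s.
have i3 : intble (fun x => S `^ (q - 2) * nc (trigp a s x) ^+ 2) by exact: intbleZ.
have i1 : intble (fun x => nc (trigp a s x) `^ q).
  apply: intble_le i3; first by apply: mble_powR_normc; exact: cmeasurable_trigp.
  by move=> x; rewrite ger0_norm ?powR_ge0.
apply: Lpnorm_le_mean => //; first by rewrite mulr_ge0 ?powR_ge0// ltW.
apply: le_trans (le_mean i1 i3 le1) _.
rewrite meanZ// parseval//.
apply: le_trans (ler_wpM2l (powR_ge0 _ _) hL) _.
rewrite /S !powRM ?powR_ge0 ?(ltW L0)// -!powRrM -mulrA.
rewrite (_ : L `^ (q - 2) * L ^+ 2 = L `^ q); last first.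
  by rewrite -powR_mulrn ?ltW// -powRD ?subrK//; apply/implyP => _; rewrite gt_eqF.
apply: eq_ler; congr (_ `^ _ * _); field; lra.
Qed.

Lemma cintble_Lp (p B : R) f : 1 <= p -> 0 <= B -> cmeasurable f ->
  (Lpnorm p f <= B%:E)%E -> cintble f.
Proof.
move=> p1 B0 mf /(Lpnorm_intble (lt_le_trans ltr01 p1) B0 mf)[i1 _].
apply: cintble_le mf (intbleD (intble_cst 1) i1) _ => x.
have [h|h] := leP (nc (f x)) 1; first by apply: le_trans h _; rewrite lerDl powR_ge0.
apply: le_trans (le1r_powR (ltW h) p1) _; rewrite lerDr; exact: ler01.
Qed.

(* Duality against the partial sum itself turns Nikolskii's inequality for the
   conjugate exponent into an L_p -> L_2 bound on the Fourier coefficients. *)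
Lemma sum_fcoef_Lp (p N G : R) f (s : seq freq) : 1 < p -> p <= 2 -> uniq s ->
  (size s)%:R <= N -> 0 < N -> 0 < G -> cmeasurable f ->
  (Lpnorm p f <= G%:E)%E ->
  \sum_(k <- s) nc (fcoef f k) ^+ 2 <= (N `^ (p^-1 - 2^-1) * G) ^+ 2.
Proof.
move=> p1 p2 us sN N0 G0 mf hG.
have fi := cintble_Lp (ltW p1) (ltW G0) mf hG.
pose p' := p / (p - 1).
(* For the conjugate exponent, p <= 2 means p' >= 2, the range of [nikolskii]. *)
have p'2 : 2 <= p' by rewrite ler_pdivlMr ?subr_gt0//; lra.
have pp' : p^-1 + p'^-1 = 1 by rewrite /p'; field; lra.
pose X2 := \sum_(k <- s) nc (fcoef f k) ^+ 2; rewrite -/X2.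
have X20 : 0 <= X2 by apply: sumr_ge0 => k _; exact: sqr_ge0.
have [->|X2n] := eqVneq X2 0; first by exact: sqr_ge0.
have X2p : 0 < X2 by rewrite lt_def X2n.
pose X := Num.sqrt X2.
have X0 : 0 < X by rewrite sqrtr_gt0.
have XX : X ^+ 2 = X2 by rewrite sqr_sqrtr.
have hS := @nikolskii (fcoef f) s p' N X p'2 us sN N0 X0.
rewrite XX lexx in hS; have {}hS := hS isT.
have mS := cmeasurable_trigp (fcoef f) s.
have pos : 0 < N `^ (2^-1 - p'^-1) * X by rewrite mulr_gt0// powR_gt0.
have p0 : 0 < p by lra.
have p'0 : 0 < p' by lra.
have [ifS mfS] := mean_mul_le p0 p'0 pp' G0 pos mf mS hG hS.
have E : X2 = complex.Re (cint (fun x => f x * conjc (trigp (fcoef f) s x))).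
  rewrite cint_mul_trigp// Re_sum; apply: eq_bigr => k _.
  by rewrite mulc_conj.
have cm : cmeasurable (fun x => f x * conjc (trigp (fcoef f) s x)).
  by apply: cmeasurableM mf _; exact: cmeasurable_conj.
have ci : cintble (fun x => f x * conjc (trigp (fcoef f) s x)).
  apply: cintble_le cm ifS _ => x.
  by rewrite Normc.normcM normc_conj.
(* Holder's inequality for f and its own partial sum bounds X^2 by a multiple of X; dividing by X
   leaves the claim, as 1/2 - 1/p' = 1/p - 1/2. *)
have : X2 <= G * (N `^ (2^-1 - p'^-1) * X).
  rewrite E cintE /=; apply: le_trans mfS.
  apply: le_mean => //; first exact: cintble_Re.
  move=> x; apply: le_trans (ler_norm _) (le_trans (normc_Re _) _).
  by rewrite Normc.normcM normc_conj.
rewrite -XX expr2 mulrA ler_pM2r// => h.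
rewrite -expr2 ler_pXn2r ?nnegrE ?(ltW X0) ?mulr_ge0 ?powR_ge0 ?(ltW G0)//.
apply: le_trans h _; rewrite mulrC (_ : 2^-1 - p'^-1 = p^-1 - 2^-1)//.
by rewrite /p'; field; lra.
Qed.

End Lp_bounds.

(** * Maurey's averaging argument *)

Section maurey_step.
Context {R : realType}.
Local Open Scope complex_scope.
Local Notation C := R[i].
Local Notation nc := (@Normc.normc R).

(** A Taylor bound of order two. Multiplying by 1 + t <= 4 turns the quadratic coefficient 8^n into
    at most n + 4 * 8^n <= 8^(n+1), which is how 8 closes the induction. *)
Lemma expr1D_le (t : R) n : -1 <= t -> t <= 3 ->
  (1 + t) ^+ n <= 1 + n%:R * t + 8 ^+ n * t ^+ 2.
Proof.
move=> t1 t3; elim: n => [|n IH].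
  by rewrite expr0 mul0r addr0 expr0 mul1r lerDl sqr_ge0.
have e8 : n%:R + 4 * 8 ^+ n <= 8 ^+ n.+1 :> R.
  rewrite exprS (_ : 8 * 8 ^+ n = 4 * 8 ^+ n + 4 * 8 ^+ n :> R); last by ring.
  rewrite lerD2r; apply: (@le_trans _ _ (8 ^+ n)).
    by rewrite -natrX ler_nat ltnW// ltn_expl.
  by rewrite ler_peMl ?exprn_ge0//; lra.
have h80 : 0 <= 8 ^+ n :> R by exact: exprn_ge0.
rewrite exprS; apply: (@le_trans _ _ ((1 + t) * (1 + n%:R * t + 8 ^+ n * t ^+ 2))).
  by rewrite ler_wpM2l//; lra.
rewrite -(natr1 n).
have t2 : 0 <= t ^+ 2 by exact: sqr_ge0.
apply: (@le_trans _ _ (1 + (n%:R + 1) * t + (n%:R + 4 * 8 ^+ n) * t ^+ 2)).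
  rewrite -subr_ge0 (_ : _ - _ = 8 ^+ n * t ^+ 2 * (3 - t)); last by ring.
  by apply: mulr_ge0; [exact: mulr_ge0|lra].
by rewrite lerD2l ler_wpM2r.
Qed.

(** Stands for the random draw of Maurey's argument: some index does no worse than the average. *)
Lemma avg_exists (I : eqType) (s : seq I) (w F : I -> R) (X : R) :
  (forall k, 0 <= w k) -> \sum_(k <- s) w k = 1 ->
  \sum_(k <- s) w k * F k <= X -> exists2 k, k \in s & F k <= X.
Proof.
move=> w0 w1 hX; apply: contrapT => hn.
have h k : k \in s -> X < F k.
  by move=> ks; rewrite ltNge; apply/negP => hk; apply: hn; exists k.
have : \sum_(k <- s) w k * (F k - X) <= 0.
  under eq_bigr do rewrite mulrBr.
  by rewrite sumrB -mulr_suml w1 mul1r subr_le0.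
rewrite big_seq => le0.
have ge0 k : k \in s -> 0 <= w k * (F k - X).
  by move=> /h hk; rewrite mulr_ge0// subr_ge0 ltW.
have : \sum_(k <- s | k \in s) w k * (F k - X) == 0.
  by rewrite eq_le le0 sumr_ge0.
rewrite psumr_eq0// => /allP all0.
suff : \sum_(k <- s) w k = 0 by rewrite w1 => /eqP; rewrite oner_eq0.
rewrite big_seq big1// => k ks; have := all0 k ks; rewrite ks /=.
rewrite mulf_eq0 => /orP[/eqP//|]; rewrite subr_eq0 => /eqP E.
by have := h k ks; rewrite E ltxx.
Qed.

(** Put y = |z|^2 + M B^2, and let y (1 + t_k) be its value after adding xi_k to z. The mean-zero
    condition removes the linear part of t_k, so its average is at most B^2 / y <= 1/M; moreover
    t_k^2 <= 8 B^2 / y <= 8/M and -1 <= t_k <= 3, so [expr1D_le] applies. The shift M B^2 makes both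
    quantities O(1/M) even when z is small. *)
Lemma potential_step (I : eqType) (s : seq I) (w : I -> R) (z : C) (xi : I -> C)
    (B : R) (M n : nat) : (0 < M)%N -> 0 < B -> (forall k, 0 <= w k) ->
  \sum_(k <- s) w k = 1 -> \sum_(k <- s) (w k)%:C * xi k = 0 ->
  (forall k, nc (xi k) <= B) ->
  \sum_(k <- s) w k * (nc (z + xi k) ^+ 2 + M%:R * B ^+ 2) ^+ n <=
  (1 + (n%:R + 8 ^+ n.+1) / M%:R) * (nc z ^+ 2 + M%:R * B ^+ 2) ^+ n.
Proof.
move=> M0 B0 w0 w1 wxi xiB.
have M1 : 1 <= M%:R :> R by rewrite ler1n.
set y := nc z ^+ 2 + M%:R * B ^+ 2.
have z0 := normc_ge0 z.
have B2 : 0 < B ^+ 2 by rewrite exprn_gt0.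
have yMB : M%:R * B ^+ 2 <= y by rewrite lerDr sqr_ge0.
have yzB : nc z ^+ 2 + B ^+ 2 <= y by rewrite lerD2l ler_peMl// ltW.
have y0 : 0 < y by apply: lt_le_trans yMB; rewrite mulr_gt0// ltr0n.
pose v k := nc (z + xi k) ^+ 2 - nc z ^+ 2.
have vE k : v k = 2 * (complex.Re z * complex.Re (xi k) +
    complex.Im z * complex.Im (xi k)) + nc (xi k) ^+ 2.
  by rewrite /v !normc_sqr ReD ImD; ring.
have vB k : `|v k| <= 2 * nc z * B + B ^+ 2.
  have h1 : nc (z + xi k) <= nc z + B by apply: le_trans (normcD _ _) _; rewrite lerD2l.
  have h2 : nc z <= nc (z + xi k) + B.
    rewrite -{1}(addrK (xi k) z); apply: le_trans (normcB _ _) _.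
    by rewrite lerD2l.
  have u0 := normc_ge0 (z + xi k).
  by rewrite /v ler_norml; apply/andP; split; nra.
pose t k := v k / y.
have vy k : v k <= 3 * y.
  have := vB k; rewrite ler_norml => /andP[_ h]; apply: le_trans h _.
  by have := sqr_ge0 (nc z - B); nra.
have v2 k : v k ^+ 2 <= 8 * B ^+ 2 * y.
  rewrite -[v k ^+ 2]real_normK ?num_real//.
  apply: (@le_trans _ _ ((2 * nc z * B + B ^+ 2) ^+ 2)).
    by rewrite ler_pXn2r ?nnegrE// addr_ge0 ?mulr_ge0// ltW.
  apply: (@le_trans _ _ (8 * B ^+ 2 * (nc z ^+ 2 + B ^+ 2))); last first.
    by rewrite ler_wpM2l// mulr_ge0// ltW.
  rewrite (_ : (2 * nc z * B + B ^+ 2) ^+ 2 = B ^+ 2 * (2 * nc z + B) ^+ 2); last by ring.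
  rewrite (_ : 8 * B ^+ 2 * _ = B ^+ 2 * (8 * (nc z ^+ 2 + B ^+ 2))); last by ring.
  by rewrite ler_pM2l//; have := sqr_ge0 (2 * nc z - B); nra.
have t1 k : -1 <= t k.
  rewrite /t ler_pdivlMr// mulN1r lerNl opprB /v.
  apply: le_trans yzB; rewrite lerBlDr -addrA lerDl.
  by rewrite addr_ge0 ?sqr_ge0// ltW.
have t3 k : t k <= 3 by rewrite /t ler_pdivrMr.
have Ey k : (nc (z + xi k) ^+ 2 + M%:R * B ^+ 2) = y * (1 + t k).
  by rewrite /t mulrDr mulr1 [y * (_ / y)]mulrC mulfVK ?gt_eqF// /v /y; ring.
under eq_bigr do rewrite Ey exprMn mulrCA.
rewrite -mulr_sumr [leRHS]mulrC ler_wpM2l ?exprn_ge0 ?(ltW y0)//.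
apply: (@le_trans _ _ (\sum_(k <- s) w k * (1 + n%:R * t k + 8 ^+ n * (8 / M%:R)))).
  apply: ler_sum => k _; rewrite ler_wpM2l//.
  apply: le_trans (expr1D_le n (t1 k) (t3 k)) _; rewrite lerD2l.
  rewrite ler_wpM2l ?exprn_ge0// /t expr_div_n ler_pdivrMr ?exprn_gt0//.
  apply: le_trans (v2 k) _.
  rewrite (_ : 8 / M%:R * y ^+ 2 = 8 * (y / M%:R) * y); last by ring.
  by rewrite ler_pM2r// ler_pM2l// ler_pdivlMr ?ltr0n// mulrC.
under eq_bigr do rewrite !mulrDr mulr1.
rewrite !big_split /= w1 -!mulr_suml w1 mul1r -addrA lerD2l.
rewrite (_ : (n%:R + 8 ^+ n.+1) / M%:R = n%:R / M%:R + 8 ^+ n * (8 / M%:R)); last first.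
  by rewrite exprSr; ring.
rewrite lerD2r.
have -> : \sum_(k <- s) w k * (n%:R * t k) =
    n%:R / y * \sum_(k <- s) w k * nc (xi k) ^+ 2.
  have hR : \sum_(k <- s) w k * complex.Re (xi k) = 0.
    have := congr1 (@complex.Re R) wxi; rewrite Re_sum /= => E.
    rewrite -[RHS]E; apply: eq_bigr => k _; by rewrite ReM /= mul0r subr0.
  have hI : \sum_(k <- s) w k * complex.Im (xi k) = 0.
    have := congr1 (@complex.Im R) wxi; rewrite Im_sum /= => E.
    rewrite -[RHS]E; apply: eq_bigr => k _; by rewrite ImM /= mul0r addr0.
  transitivity (n%:R / y * ((2 * complex.Re z) * (\sum_(k <- s) w k * complex.Re (xi k)) +
    (2 * complex.Im z) * (\sum_(k <- s) w k * complex.Im (xi k)) +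
    \sum_(k <- s) w k * nc (xi k) ^+ 2)).
    rewrite !mulr_sumr -!big_split /= mulr_sumr; apply: eq_bigr => k _.
    by rewrite /t vE; ring.
  by rewrite hR hI !mulr0 !add0r.
rewrite -mulrA ler_wpM2l// mulrC ler_pdivrMr//.
apply: (@le_trans _ _ (B ^+ 2)).
  rewrite -[leRHS]mul1r -w1 mulr_suml; apply: ler_sum => k _.
  by rewrite ler_wpM2l// ler_pXn2r ?nnegrE ?normc_ge0// ltW.
by rewrite mulrC ler_pdivlMr ?ltr0n// mulrC.
Qed.

End maurey_step.

(** * Greedy selection of frequencies under several multipliers *)

Section maurey.
Context {R : realType} {d : nat}.
Local Open Scope complex_scope.
Local Notation pt := 'rV[R]_d.
Local Notation freq := 'rV[int]_d.
Local Notation C := R[i].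
Local Notation nc := (@Normc.normc R).
Variables (I : finType) (lam : I -> freq -> R).
Hypothesis lam1 : forall i k, `|lam i k| <= 1.

Let mult i (c : freq -> C) k := (lam i k)%:C * c k.

Let nc_mult i c k : nc (mult i c k) <= nc (c k).
Proof. by rewrite Normc.normcM normcR ler_piMl ?normc_ge0. Qed.

(** A substitute for the 2n-th powers of L_2n norms, summed over all multipliers [lam i] so that one
    choice of frequencies controls every one of them. *)
Definition potential (s : seq freq) (n : nat) (K : R) (c : freq -> C) : R :=
  \sum_(i : I) mean (fun x : pt => (nc (trigp (mult i c) s x) ^+ 2 + K) ^+ n).

Lemma intble_potential (c : freq -> C) s n K : 0 <= K ->
  intble (fun x : pt => (nc (trigp c s x) ^+ 2 + K) ^+ n).
Proof.
move=> K0.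
have mc : mble (fun x : pt => nc (trigp c s x)).
  by apply: mble_normc; exact: cmeasurable_trigp.
apply: (intble_bounded (B := ((\sum_(k <- s) nc (c k)) ^+ 2 + K) ^+ n)).
  apply: measurable_funX; apply: measurable_funD => //; exact: measurable_funX.
move=> x; have p0 : 0 <= nc (trigp c s x) ^+ 2 + K by rewrite addr_ge0// sqr_ge0.
rewrite ger0_norm ?exprn_ge0// lerXn2r ?nnegrE//.
  by rewrite addr_ge0// sqr_ge0.
rewrite lerD2r lerXn2r ?nnegrE ?normc_ge0 ?normc_trigp//.
by apply: sumr_ge0 => k _; exact: normc_ge0.
Qed.

Section step.
Variables (s : seq freq) (a : freq -> C).
Hypothesis us : uniq s.
Let A := \sum_(k <- s) nc (a k).
Hypothesis A0 : 0 < A.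

(** A times the phase of a_k, at the single frequency k; [a] is the average of these with weights
    |a_k| / A. Where a_k = 0 the phase is 0 by the convention on division. *)
Definition atom (k l : freq) : C :=
  if l == k then A%:C * (a k / (nc (a k))%:C) else 0.

Let nc_atom k l : nc (atom k l) <= if l == k then A else 0.
Proof.
rewrite /atom; case: eqP => _; last by rewrite Normc.normc0.
rewrite !Normc.normcM Normc.normcV !normcR [ `|nc (a k)|]ger0_norm ?normc_ge0//.
rewrite ger0_norm ?(ltW A0)// ler_piMr ?(ltW A0)//.
have [->|h] := eqVneq (nc (a k)) 0; first by rewrite mul0r.
by rewrite mulfV.
Qed.

Let sum_atom k : \sum_(l <- s) nc (atom k l) <= A.
Proof.
apply: (@le_trans _ _ (\sum_(l <- s) if l == k then A else 0)).
  by apply: ler_sum => l _; exact: nc_atom.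
have [ks|ks] := boolP (k \in s).
  by rewrite (bigD1_seq k)//= eqxx big1 ?addr0// => l /negPf->.
rewrite big_seq big1 ?(ltW A0)// => l ls; case: eqP => // lk.
by rewrite -lk ls in ks.
Qed.

Let w k := nc (a k) / A.

Let w0 k : 0 <= w k.
Proof. by rewrite divr_ge0 ?normc_ge0// ltW. Qed.

Let w1 : \sum_(k <- s) w k = 1.
Proof. by rewrite -mulr_suml mulfV// gt_eqF. Qed.

Let mean_atom l : l \in s -> \sum_(k <- s) (w k)%:C * atom k l = a l.
Proof.
move=> ls; rewrite (bigD1_seq l)//= big1 => [|k kl]; last first.
  by rewrite /atom eq_sym (negbTE kl) mulr0.
rewrite addr0 /atom eqxx /w rmorphM fmorphV /=.
have [a0|an0] := eqVneq (a l) 0; first by rewrite a0 mul0r !mulr0.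
have A0' : A%:C != 0 :> C by rewrite fmorph_eq0 gt_eqF.
have n0 : (nc (a l))%:C != 0 :> C.
  by rewrite fmorph_eq0; apply: contraNneq an0 => /Normc.eq0_normc ->.
by field; rewrite A0' n0.
Qed.

(* Averaging over the atoms with weights w cancels the first-order term. *)
Lemma potential_decrease (M n : nat) (c : freq -> C) : (0 < M)%N ->
  let K := M%:R * (2 * A) ^+ 2 in
  exists2 k, k \in s & potential s n K (fun l => c l + (atom k l - a l)) <=
    (1 + (n%:R + 8 ^+ n.+1) / M%:R) * potential s n K c.
Proof.
move=> M0 K; have K0 : 0 <= K by rewrite mulr_ge0// sqr_ge0.
apply: (@avg_exists R _ s w) => //.
pose xi i x k := trigp (mult i (fun l => atom k l - a l)) s x.
have E i x k : trigp (mult i (fun l => c l + (atom k l - a l))) s x =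
    trigp (mult i c) s x + xi i x k.
  rewrite /xi -trigpD; apply: eq_trigp => l _; rewrite /mult mulrDr//.
rewrite /potential.
under eq_bigr do rewrite mulr_sumr.
rewrite exchange_big mulr_sumr; apply: ler_sum => i _.
have it k := intble_potential (mult i (fun l => c l + (atom k l - a l))) s n K0.
have ic := intble_potential (mult i c) s n K0.
rewrite -meanZ// (eq_bigr (fun k => mean (fun x : pt => w k *
  (nc (trigp (mult i (fun l => c l + (atom k l - a l))) s x) ^+ 2 + K) ^+ n))); last first.
  by move=> k _; rewrite meanZ.
rewrite -mean_sum; last by move=> k; exact: intbleZ.
apply: le_mean; [by apply: intble_sum => k; exact: intbleZ|exact: intbleZ|].
move=> x; under eq_bigr do rewrite E.
(* The bound B is 2 A: an atom and [a] have l_1 norm at most A each, and the multipliers do not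
   increase it. *)
apply: potential_step => //; first by rewrite mulr_gt0.
- rewrite /xi.
  under eq_bigr do rewrite -trigpZ.
  rewrite /trigp exchange_big /= big_seq big1// => l ls.
  rewrite -mulr_suml (_ : \sum_(k <- s) _ = 0) ?mul0r//.
  under eq_bigr do rewrite /mult mulrCA mulrBr.
  rewrite -mulr_sumr sumrB mean_atom// -mulr_suml -rmorph_sum /= w1 mul1r.
  by rewrite subrr mulr0.
- move=> k; apply: le_trans (normc_trigp _ _ _) _.
  rewrite mulr_natl mulr2n.
  apply: (@le_trans _ _ (\sum_(l <- s) (nc (atom k l) + nc (a l)))).
    by apply: ler_sum => l _; apply: le_trans (nc_mult _ _ _) _; exact: normcB.
  by rewrite big_split /= lerD2r.
Qed.

(** Greedy choice, with repetitions allowed. The start c = 0 has potential |I| K^n, and each step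
    costs a factor 1 + O(1/M). *)
Lemma potential_iter (M n j : nat) : (0 < M)%N ->
  let K := M%:R * (2 * A) ^+ 2 in
  exists ks : seq freq, [/\ size ks = j, {subset ks <= s} &
    potential s n K (fun l => \sum_(k <- ks) (atom k l - a l)) <=
    (1 + (n%:R + 8 ^+ n.+1) / M%:R) ^+ j * (#|I|%:R * K ^+ n)].
Proof.
move=> M0 K; elim: j => [|j [ks [sz ss h]]].
  exists [::]; split => //; rewrite expr0 mul1r /potential.
  rewrite (eq_bigr (fun=> K ^+ n)) => [|i _].
    by rewrite sumr_const mulr_natl.
  rewrite (_ : (fun x => _) = fun=> K ^+ n) ?mean_cst//.
  apply/funext => x; rewrite (_ : trigp _ _ _ = 0).
    by rewrite Normc.normc0 expr0n /= add0r.
  by rewrite /trigp big1// => l _; rewrite /mult big_nil mulr0 mul0r.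
have [k ks' hk] := potential_decrease n (fun l => \sum_(k <- ks) (atom k l - a l)) M0.
exists (k :: ks); split; first by rewrite /= sz.
  by move=> l; rewrite inE => /orP[/eqP ->//|/ss].
rewrite (_ : (fun l => \sum_(k0 <- k :: ks) (atom k0 l - a l)) =
   fun l => \sum_(k <- ks) (atom k l - a l) + (atom k l - a l)); last first.
  by apply/funext => l; rewrite big_cons addrC.
by apply: le_trans hk _; rewrite [_ ^+ j.+1]exprS -mulrA ler_wpM2l//.
Qed.

End step.

Lemma LpnormZ (q B : R) (z : C) (f : pt -> C) : 0 < q -> 0 <= B -> cmeasurable f ->
  (Lpnorm q f <= B%:E)%E -> (Lpnorm q (fun x => z * f x)%R <= (nc z * B)%:E)%E.
Proof.
move=> q0 B0 mf hf; have [i1 m1] := Lpnorm_intble q0 B0 mf hf.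
have E : (fun x => nc (z * f x) `^ q) = fun x => nc z `^ q * nc (f x) `^ q.
  by apply/funext => x; rewrite Normc.normcM powRM ?normc_ge0.
apply: Lpnorm_le_mean => //; rewrite ?E; first by rewrite mulr_ge0 ?normc_ge0.
  exact: intbleZ.
by rewrite meanZ// powRM ?normc_ge0// ler_wpM2l ?powR_ge0.
Qed.

(** The exponential bounds the M-fold product (1 + kap / M)^M, the outer 2 is that of K = M (2 A)^2,
    and the added 1 is paid in passing from the potential to L_q. *)
Definition maurey_cst (n : nat) : R :=
  2 * (1 + #|I|%:R * expR (n%:R + 8 ^+ n.+1)).

Lemma maurey_cst_gt0 n : 0 < maurey_cst n.
Proof. by rewrite mulr_gt0// ltr_pwDl// mulr_ge0// expR_ge0. Qed.

(** After M greedy steps the sum of the M centred atoms has L_q norm O(K^(1/2)) = O(A M^(1/2));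
    dividing by M leaves A M^(-1/2). *)
Lemma maurey (s : seq freq) (a : freq -> C) (M n : nat) (q A : R) :
  (0 < M)%N -> uniq s -> 1 <= q -> q <= (2 * n)%:R -> 0 < A ->
  \sum_(k <- s) nc (a k) <= A ->
  exists (b : freq -> C) (t : seq freq), [/\ (size t <= M)%N, {subset t <= s},
    forall k, k \notin t -> b k = 0 &
    forall i, (Lpnorm q (trigp (fun k => ((lam i k)%:C * (a k - b k))%R) s) <=
      (maurey_cst n * A * M%:R `^ (- 2^-1))%:E)%E].
Proof.
move=> M0 us q1 qn A0 hA; have q0 : 0 < q by lra.
have MR0 : 0 < M%:R :> R by rewrite ltr0n.
have Mp : 0 < M%:R `^ (- 2^-1) :> R by rewrite powR_gt0.
pose A' := \sum_(k <- s) nc (a k).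
have A'0 : 0 <= A' by apply: sumr_ge0 => k _; exact: normc_ge0.
(* When all a_k vanish there are no weights to average with, and the zero approximation is exact. *)
have [/eqP E|An0] := boolP (A' == 0).
  have a0 k : k \in s -> a k = 0.
    move=> ks; apply: Normc.eq0_normc; apply/eqP.
    move: E => /eqP; rewrite psumr_eq0 => [/allP/(_ k ks)//|l _]; exact: normc_ge0.
  exists (fun=> 0), [::]; split => // i.
  rewrite (_ : trigp _ s = fun=> 0); last first.
    apply/funext => x; rewrite /trigp big_seq big1// => k ks.
    by rewrite a0// subr0 mulr0 mul0r.
  apply/Lpnorm_leP => //; first by rewrite !mulr_ge0 ?ltW// maurey_cst_gt0.
  rewrite Normc.normc0 powR0 ?gt_eqF// (torus_int_cst 0) lee_fin.
  exact: powR_ge0.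
have {An0}A'p : 0 < A' by rewrite lt_def An0.
have [ks [szks sks hpot]] := @potential_iter s a us A'p M n M M0.
set K := M%:R * _ in hpot; pose c l := \sum_(k <- ks) (atom s a k l - a l).
have K0 : 0 < K by rewrite mulr_gt0// exprn_gt0// mulr_gt0.
pose E := #|I|%:R * expR (n%:R + 8 ^+ n.+1) : R.
have E0 : 0 <= E by rewrite mulr_ge0// expR_ge0.
have hpot2 : potential s n K c <= E * K ^+ n.
  apply: le_trans hpot _; rewrite mulrA ler_wpM2r ?exprn_ge0 ?(ltW K0)//.
  rewrite /E mulrC ler_wpM2l//.
  set kap := (_ / M%:R).
  have kap0 : 0 <= kap by rewrite divr_ge0// addr_ge0// exprn_ge0.
  rewrite (_ : expR _ = expR kap ^+ M).
    by rewrite lerXn2r ?nnegrE ?expR_ge0 ?addr_ge0// expR_ge1Dx.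
  by rewrite -expRM_natl /kap mulrC mulfVK// gt_eqF.
pose T := Num.sqrt K.
have T0 : 0 < T by rewrite sqrtr_gt0.
have TT : T ^+ 2 = K by rewrite sqr_sqrtr// ltW.
(* Repeated atoms share a frequency, so at most M frequencies remain. *)
exists (fun l => (M%:R)^-1 * \sum_(k <- ks) atom s a k l), (undup ks); split.
- by rewrite -szks size_undup.
- by move=> k; rewrite mem_undup; exact: sks.
- move=> k; rewrite mem_undup => kks; rewrite big_seq big1 ?mulr0// => l lks.
  by rewrite /atom; case: eqP => // kl; rewrite kl lks in kks.
move=> i.
have Efun : trigp (fun k => (lam i k)%:C * (a k - (M%:R)^-1 *
     \sum_(k0 <- ks) atom s a k0 k)) s =
   fun x => (- (M%:R^-1)%:C) * trigp (mult i c) s x.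
  apply/funext => x; rewrite -trigpZ; apply: eq_trigp => l _; rewrite /mult /c.
  rewrite sumrB big_const_seq count_predT iter_addr_0 szks -[_ *+ M]mulr_natl.
  have M0' : (M%:R : C) != 0 by rewrite pnatr_eq0 -lt0n.
  rewrite fmorphV rmorph_nat; by field.
have mP := cmeasurable_trigp (mult i c) s.
have LP : (Lpnorm q (trigp (mult i c) s) <= (T * (1 + E))%:E)%E.
  have i1 := intble_potential (mult i c) s n (ltW K0).
  have i2 : intble (fun x => T `^ q * (1 + (K ^+ n)^-1 *
      (nc (trigp (mult i c) s x) ^+ 2 + K) ^+ n)).
    by apply: intbleZ; apply: intbleD; [exact: intble_cst|exact: intbleZ].
  (* For |P| <= T the term 1 suffices; for |P| > T the exponent q of |P| / T may be raised to 2n,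
     and T^2 = K. *)
  have le1 x : nc (trigp (mult i c) s x) `^ q <= T `^ q * (1 + (K ^+ n)^-1 *
      (nc (trigp (mult i c) s x) ^+ 2 + K) ^+ n).
    set P := nc _; have P0 : 0 <= P by exact: normc_ge0.
    have -> : P `^ q = T `^ q * (P / T) `^ q.
      rewrite -powRM ?divr_ge0 ?(ltW T0)//; congr (_ `^ _).
      by rewrite mulrC mulfVK ?gt_eqF.
    rewrite ler_wpM2l ?powR_ge0//.
    have P2 : 0 <= P ^+ 2 by exact: sqr_ge0.
    have pos2 : 0 <= (K ^+ n)^-1 * (P ^+ 2 + K) ^+ n.
      by rewrite mulr_ge0 ?invr_ge0 ?exprn_ge0 ?addr_ge0 ?(ltW K0).
    have [h|h] := leP (P / T) 1.
      apply: (@le_trans _ _ 1); last by rewrite lerDl.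
      rewrite [leRHS](_ : 1 = 1 `^ q); last by rewrite powR1.
      apply: ler_powR2r => //; first exact: ltW.
      by rewrite divr_ge0// ltW.
    apply: le_trans (ler_powR (ltW h) qn) _.
    rewrite powR_mulrn ?divr_ge0 ?(ltW T0)// exprM expr_div_n TT.
    rewrite expr_div_n mulrC; apply: (@le_trans _ _ ((K ^+ n)^-1 *
      (P ^+ 2 + K) ^+ n)); last by rewrite lerDr.
    rewrite ler_wpM2l ?invr_ge0 ?exprn_ge0 ?(ltW K0)//.
    by rewrite lerXn2r ?nnegrE// ?lerDl ?addr_ge0 ?(ltW K0).
  have i3 : intble (fun x => nc (trigp (mult i c) s x) `^ q).
    apply: intble_le i2; first exact: mble_powR_normc.
    by move=> x; rewrite ger0_norm ?powR_ge0.
  apply: Lpnorm_le_mean => //; first by rewrite mulr_ge0 ?(ltW T0)// addr_ge0.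
  apply: le_trans (le_mean i3 i2 le1) _.
  rewrite meanZ; last by apply: intbleD; [exact: intble_cst|exact: intbleZ].
  rewrite meanD; [|exact: intble_cst|exact: intbleZ].
  rewrite mean_cst meanZ// powRM ?(ltW T0) ?addr_ge0// ler_wpM2l ?powR_ge0//.
  apply: (@le_trans _ _ (1 + E)); last by rewrite le1r_powR// lerDl.
  rewrite lerD2l mulrC ler_pdivrMr ?exprn_gt0//; apply: le_trans hpot2.
  rewrite /potential (bigD1 i)//= lerDl; apply: sumr_ge0 => j _.
  by apply: mean_ge0 => x; rewrite exprn_ge0// addr_ge0 ?sqr_ge0// ltW.
have := LpnormZ (- (M%:R^-1)%:C) q0 _ mP LP.
rewrite Efun => /(_ _)/le_trans; apply; first by rewrite mulr_ge0 ?(ltW T0)// addr_ge0.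
rewrite lee_fin normcN normcR ger0_norm ?invr_ge0//.
have -> : T = M%:R `^ 2^-1 * (2 * A').
  rewrite /T /K sqrtrM// sqrtr_sqr ger0_norm ?mulr_ge0 ?(ltW A'p)//.
  by rewrite powR12_sqrt.
have -> : M%:R^-1 * (M%:R `^ 2^-1 * (2 * A') * (1 + E)) =
    maurey_cst n * A' * M%:R `^ (- 2^-1).
  rewrite (_ : M%:R `^ (- 2^-1) = M%:R^-1 * M%:R `^ 2^-1); last first.
    rewrite -[M%:R^-1]powR_inv1// -powRD; first by congr (_ `^ _); field.
    by rewrite (gt_eqF MR0) implybT.
  by rewrite /maurey_cst -/E; ring.
rewrite ler_wpM2r ?(ltW Mp)// ler_wpM2l// ltW//; exact: maurey_cst_gt0.
Qed.

End maurey.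

(** * Upper bound *)

Section besov_coefficients.
Context {R : realType} {d : nat}.
Local Open Scope complex_scope.
Local Notation pt := 'rV[R]_d.
Local Notation freq := 'rV[int]_d.
Local Notation C := R[i].
Local Notation nc := (@Normc.normc R).

Lemma periodic_diffop h (f : pt -> C) : Defs.periodic f -> Defs.periodic (diffop h f).
Proof. by move=> pf x i; rewrite /diffop addrAC !pf. Qed.

Lemma cmeasurable_diffop h (f : pt -> C) : cmeasurable f -> cmeasurable (diffop h f).
Proof.
move=> mf; apply: (cmeasurableB _ mf).
have := cmeasurable_affine h 1 mf.
by under eq_fun do rewrite scale1r addrC.
Qed.

Lemma cintbleN (f : pt -> C) : cintble f -> cintble (fun x => - f x).
Proof. by move/(cintbleZ (-1)); under eq_fun do rewrite mulN1r. Qed.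

Lemma cintble_shift h (f : pt -> C) : Defs.periodic f -> cintble f ->
  cintble (fun x => f (x + h)).
Proof.
move=> pf /(cintble_affine h (or_introl erefl) pf).
by under eq_fun do rewrite scale1r addrC.
Qed.

Lemma cintble_diffop h (f : pt -> C) : Defs.periodic f -> cintble f ->
  cintble (diffop h f).
Proof.
by move=> pf fi; apply: cintbleD (cintbleN fi); exact: cintble_shift.
Qed.

Lemma deltak_props k h (f : pt -> C) : Defs.periodic f -> cintble f ->
  Defs.periodic (deltak k h f) /\ cintble (deltak k h f).
Proof.
move=> pf fi; elim: k => [//|k [IH1 IH2]] /=.
by split; [exact: periodic_diffop|exact: cintble_diffop].
Qed.

Lemma cmeasurable_deltak k h (f : pt -> C) : cmeasurable f -> cmeasurable (deltak k h f).
Proof. by move=> mf; elim: k => [//|k IH]; exact: cmeasurable_diffop. Qed.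

Lemma fcoef_deltak k h (f : pt -> C) l : Defs.periodic f -> cintble f ->
  fcoef (deltak k h f) l = (expk l h - 1) ^+ k * fcoef f l.
Proof.
move=> pf fi; elim: k => [|k IH]; first by rewrite expr0 mul1r.
have [pk ik] := deltak_props k h pf fi.
rewrite [deltak _ _ _]/(diffop h (deltak k h f)) /diffop.
rewrite fcoefB//; last exact: cintble_shift.
by rewrite fcoef_shift// IH exprS; ring.
Qed.

(** Serves integrands containing [omega], whose measurability in t is not established. *)
Lemma ge0_subset_integral_nomeas (D D' : set R) (f g : R -> \bar R) : D' `<=` D ->
  (forall t, D t -> 0 <= f t)%E -> (forall t, D' t -> 0 <= g t)%E ->
  (forall t, D' t -> g t <= f t)%E ->
  (\int[lebesgue_measure]_(t in D') g t <= \int[lebesgue_measure]_(t in D) f t)%E.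
Proof.
move=> DD f0 g0 gf; rewrite integral_mkcond [leRHS]integral_mkcond.
apply: ge0_le_integral_nomeas => t _; rewrite !patchE.
  by case: ifP => // /[!inE]; exact: g0.
case: ifPn => [/[!inE] D't|_]; first by rewrite mem_set ?gf//; exact: DD.
by case: ifP => // /[!inE]; exact: f0.
Qed.

Lemma omega_ge0 k (f : pt -> C) t p : 0 <= t -> (0 <= omega k f t p)%E.
Proof.
move=> t0; apply: le_trans (Lpnorm_ge0 p (deltak k 0 f)) _.
apply: ereal_sup_ubound; exists 0 => //=.
by rewrite /euclid big1 ?sqrtr0// => i _; rewrite mxE expr0n.
Qed.

Lemma omega_le k (f : pt -> C) t t' p : t <= t' -> (omega k f t p <= omega k f t' p)%E.
Proof.
move=> tt'; apply: le_ereal_sup => _ /= [h ht <-]; exists h => //=.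
exact: le_trans tt'.
Qed.

Lemma besov_Lpnorm_le1 (r p : R) (theta : \bar R) k (f : pt -> C) :
  (1 <= theta)%E -> (besov_norm r p theta k f <= 1)%E -> (Lpnorm p f <= 1)%E.
Proof.
move=> th1 hB.
apply: le_trans hB; rewrite /besov_norm leeDl//.
case: theta th1 => [th|_|//] /=; first by move=> _; exact: poweR_ge0.
apply: (@le_trans _ _ ((1 `^ (- r))%:E * omega k f 1 p)%E).
  by rewrite mule_ge0 ?omega_ge0// lee_fin powR_ge0.
by apply: ereal_sup_ubound; exists 1 => //=; exact: ltr01.
Qed.

(** For finite theta, [omega] being nondecreasing, the integral over [t, 2t] alone is at least
    (omega / (2t)^r)^theta / 2, and 2^(1/theta) <= 2. The constant is therefore free of theta. *)
Lemma besov_omega_le (r p : R) (theta : \bar R) k (f : pt -> C) t :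
  0 < r -> (1 <= theta)%E -> (besov_norm r p theta k f <= 1)%E -> 0 < t ->
  (omega k f t p <= (2 * (2 * t) `^ r)%:E)%E.
Proof.
move=> r0 th1 hB t0.
have tr0 : 0 < t `^ r by rewrite powR_gt0.
have t20 : 0 < 2 * t by rewrite mulr_gt0.
have hs : (besov_seminorm r p theta k f <= 1)%E.
  by apply: le_trans hB; rewrite /besov_norm leeDr// Lpnorm_ge0.
case: theta th1 {hB} hs => [th| |//] /= th1 hs; last first.
  have h : ((t `^ (- r))%:E * omega k f t p <= 1)%E.
    by apply: le_trans hs; apply: ereal_sup_ubound; exists t.
  have {}h : (omega k f t p <= (t `^ r)%:E)%E.
    move: h; rewrite powRN muleC lee_pdivrMr//.
    by rewrite mul1e.
  apply: le_trans h _; rewrite lee_fin.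
  apply: (@le_trans _ _ ((2 * t) `^ r)).
    by apply: ler_powR2r; [exact: ltW|exact: ltW|rewrite ler_peMl ?ler1n// ltW].
  by rewrite ler_peMl ?powR_ge0// ler1n.
rewrite lee_fin in th1; have th0 : 0 < th by lra.
have h1 : (\int[lebesgue_measure]_(t in [set t : R | (0 < t)%R])
  (((t `^ (- r))%:E * omega k f t p) `^ th * (t^-1)%:E) <= 1)%E.
  move/poweR_leP : hs; rewrite powR1; apply => //.
  apply: integral_ge0 => u /= u0.
  by rewrite mule_ge0 ?poweR_ge0// lee_fin invr_ge0 ltW.
(* A priori [omega] may be +oo, so the bound is shown for every real w below it; taking w one above
   the bound then excludes +oo. *)
have key w : 0 <= w -> (w%:E <= omega k f t p)%E -> w <= 2 * (2 * t) `^ r.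
  move=> w0 hw; pose c := (2 * t) `^ (- r) * w.
  have c0 : 0 <= c by rewrite mulr_ge0 ?powR_ge0.
  have h2 : (\int[lebesgue_measure]_(u in `[t, (2 * t)%R]) (cst ((c `^ th / (2 * t))%:E) u) <= 1)%E.
    apply: le_trans h1; apply: ge0_subset_integral_nomeas.
    - by move=> u /=; rewrite in_itv /= => /andP[tu _]; exact: lt_le_trans tu.
    - move=> u /= u0; rewrite mule_ge0 ?poweR_ge0// lee_fin invr_ge0; exact: ltW.
    - by move=> u _ /=; rewrite lee_fin divr_ge0 ?powR_ge0// ltW.
    move=> u /=; rewrite in_itv /= => /andP[tu u2]; have u0 := lt_le_trans t0 tu.
    rewrite EFinM lee_pmul ?lee_fin ?powR_ge0 ?invr_ge0 ?(ltW t20)//.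
      rewrite -poweR_EFin; apply: gt0_ler_poweR; first exact: ltW.
      - by rewrite in_itv /= lee_fin c0 leey.
      - by rewrite in_itv /= leey mule_ge0 ?lee_fin ?powR_ge0// omega_ge0// ltW.
      rewrite /c EFinM lee_pmul ?lee_fin ?powR_ge0//.
        by rewrite !powRN lef_pV2 ?posrE ?powR_gt0//; apply: ler_powR2r => //; exact: ltW.
      exact: le_trans hw (omega_le _ _ _ tu).
    by rewrite lef_pV2.
  move: h2; rewrite (integral_cst lebesgue_measure)//.
  rewrite [X in (_ * X)%E](_ : _ = t%:E); last first.
    have := @lebesgue_measure_itv R `[t, (2 * t)%R].
    rewrite /= lte_fin ltr_pMl// ltr1n /= -EFinD => ->.
    by congr (_%:E); ring.
  rewrite -EFinM lee_fin => h2.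
  have h3 : c `^ th <= 2.
    have E2 : c `^ th / (2 * t) * t = c `^ th / 2 by field; exact: lt0r_neq0.
    by move: h2; rewrite E2 ler_pdivrMr// mul1r.
  have h4 : c <= 2.
    rewrite -(powRK c0 (lt0r_neq0 th0)); apply: (@le_trans _ _ (2 `^ th^-1)).
      by apply: ler_powR2r; rewrite ?powR_ge0// invr_ge0 ltW.
    by rewrite ler1_powR ?ler1n// invf_le1.
  move: h4; rewrite /c powRN mulrC ler_pdivrMr ?powR_gt0//.
have h0 := omega_ge0 k f p (ltW t0).
case E : (omega k f t p) h0 key => [w| |//] h0 key.
  by rewrite lee_fin; apply: key => //; rewrite -lee_fin.
have B0 : 0 <= 2 * (2 * t) `^ r by rewrite mulr_ge0 ?powR_ge0.
have := key (2 * (2 * t) `^ r + 1) _ (leey _).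
by rewrite addr_ge0// gerDl ler10 => /(_ isT).
Qed.

Definition sin_half : R := sin 2^-1.

Let half_lt_pi2 : (1 : R) <= pi / 2.
Proof. by rewrite ler_pdivlMr// mul1r pi_ge2. Qed.

Lemma sin_half_gt0 : 0 < sin_half.
Proof.
by apply: sin_gt0_pi; apply/andP; split; have := half_lt_pi2; lra.
Qed.

(** The imaginary part of the difference is sin t, and the sine increases on [1/2, 1], inside
    [0, pi/2]. *)
Lemma cexpi_sub1_ge (t : R) : 2^-1 <= `|t| <= 1 -> sin_half <= nc (cexpi t - 1).
Proof.
move=> /andP[h1 h2]; have := half_lt_pi2 => hpi.
apply: le_trans (normc_Im _); rewrite ImD ImN /= oppr0 addr0.
have key u : 2^-1 <= u -> u <= 1 -> sin_half <= sin u.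
  by move=> u1 u2; rewrite /sin_half le_eqVlt;
     have [->|ne] := eqVneq u 2^-1; rewrite ?eqxx//; apply/orP; right;
     rewrite ltr_sin ?in_itv /=; do ?[apply/andP; split]; lra.
have [t0|t0] := leP 0 t.
  rewrite ger0_norm// in h1 h2; apply: le_trans (key _ h1 h2) _; exact: ler_norm.
rewrite ltr0_norm// in h1 h2; apply: le_trans (key _ h1 h2) _.
by rewrite sinN; apply: le_trans (ler_norm _) _; rewrite normrN.
Qed.

(** No single axis serves all frequencies of a block, so the bounds for the d axis differences are
    added up; B absorbs the factor d. *)
Lemma besov_block (r p : R) (theta : \bar R) k : 1 < p -> p <= 2 -> 0 < r ->
  (1 <= theta)%E -> exists2 B : R, 0 < B & forall f : pt -> C,
    besov_class r p theta k f -> forall s,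
    \sum_(l <- dblock s) nc (fcoef f l) ^+ 2 <=
    (B * 2 `^ (s%:R * (d%:R / p - d%:R / 2 - r))) ^+ 2.
Proof.
move=> p1 p2 r0 th1.
have sg := sin_half_gt0; set c0 := sin_half in sg.
pose G := 2 * 2 `^ r : R.
have G0 : 0 < G by rewrite mulr_gt0// powR_gt0.
pose e := p^-1 - 2^-1.
pose N0 := (4 ^ d)%:R `^ e : R.
have N00 : 0 < N0 by rewrite powR_gt0// ltr0n expn_gt0.
pose K := (c0 ^- k * G) : R.
have K0 : 0 < K by rewrite mulr_gt0// invr_gt0 exprn_gt0.
exists (N0 * (1 + d%:R * K)); first by rewrite mulr_gt0// ltr_wpDr ?ltr01// mulr_ge0// ltW.
have D0 : 0 <= 1 + d%:R * K by rewrite addr_ge0// mulr_ge0// ltW.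
move=> f [pf [mf hB]] s.
have hp1 := besov_Lpnorm_le1 th1 hB.
have fi := cintble_Lp (ltW p1) ler01 mf hp1.
have sz : (size (@dblock d s))%:R <= (4 ^ d * (2 ^ s) ^ d)%:R :> R.
  by rewrite ler_nat size_dblock.
have szp : 0 < (4 ^ d * (2 ^ s) ^ d)%:R :> R.
  by rewrite ltr0n muln_gt0 !expn_gt0.
have NE : (4 ^ d * (2 ^ s) ^ d)%:R `^ e = N0 * 2 `^ (s%:R * (d%:R / p - d%:R / 2)) :> R.
  rewrite natrM powRM// -/N0; congr (_ * _).
  rewrite -expnM natrX -powR_mulrn// -powRrM natrM; congr (_ `^ _).
  by rewrite /e; ring.
(* Block 0 contains the zero frequency, which no difference of positive order detects; there the
   bound on the L_p norm of f is used. *)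
case: s sz szp NE => [|s] sz szp NE.
  have := sum_fcoef_Lp p1 p2 (uniq_dblock 0) sz szp ltr01 mf hp1.
  move/le_trans; apply; rewrite NE !mul0r powRr0 !mulr1.
  rewrite lerXn2r ?nnegrE ?(ltW N00)//; first by rewrite mulr_ge0 ?(ltW N00).
  by rewrite ler_peMr ?(ltW N00)// lerDl mulr_ge0// ltW.
(* A frequency of block s + 1 has a coordinate of modulus in (2^s, 2^(s+1)], so this step gives a
   phase of modulus in (1/2, 1]. *)
pose hh i : pt := (2 ^- s.+1) *: delta_mx 0 i.
have hs0 : 0 < 2 ^- s.+1 :> R by rewrite invr_gt0 exprn_gt0.
have eh i : euclid (hh i) = 2 ^- s.+1.
  rewrite /euclid (bigD1 i)//= big1 => [|j ji]; last first.
    by rewrite !mxE eqxx (negbTE ji) mulr0 expr0n.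
  by rewrite !mxE !eqxx mulr1 addr0 sqrtr_sqr ger0_norm// ltW.
have Gs0 : 0 < G * 2 `^ (- (s.+1%:R * r)) by rewrite mulr_gt0// powR_gt0.
have gi i : (Lpnorm p (deltak k (hh i) f) <= (G * 2 `^ (- (s.+1%:R * r)))%:E)%E.
  apply: (@le_trans _ _ (omega k f (2 ^- s.+1) p)).
    by apply: ereal_sup_ubound; exists (hh i) => //=; rewrite eh.
  apply: le_trans (besov_omega_le r0 th1 hB hs0) _.
  rewrite lee_fin powRM ?(ltW hs0)// mulrA -/G; apply: eq_ler; congr (_ * _).
  rewrite -powR_mulrn// -powRN -powRrM; congr (_ `^ _); ring.
have Si i : \sum_(l <- dblock s.+1) nc (fcoef (deltak k (hh i) f) l) ^+ 2 <=
   (N0 * 2 `^ (s.+1%:R * (d%:R / p - d%:R / 2)) * (G * 2 `^ (- (s.+1%:R * r)))) ^+ 2.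
  rewrite -NE; apply: sum_fcoef_Lp => //; first exact: uniq_dblock.
  exact: cmeasurable_deltak.
pose X := N0 * 2 `^ (s.+1%:R * (d%:R / p - d%:R / 2)) * (G * 2 `^ (- (s.+1%:R * r))).
have pt_le l : l \in dblock s.+1 -> nc (fcoef f l) ^+ 2 <=
    \sum_(i < d) (c0 ^- k) ^+ 2 * nc (fcoef (deltak k (hh i) f) l) ^+ 2.
  rewrite mem_dblock => /eqP lv.
  have l1 : (supn l <= 2 ^ s.+1)%N by rewrite -lev_leE lv.
  have l2 : (2 ^ s < supn l)%N by rewrite ltnNge -lev_leE lv ltnn.
  have /existsP[i hi] : [exists i : 'I_d, (2 ^ s < `|l ord0 i|)%N].
    apply: contraLR l2 => /existsPn h; rewrite -leqNgt; apply/supn_leP => i.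
    by rewrite leqNgt.
  have hi2 : (`|l ord0 i| <= 2 ^ s.+1)%N by move/supn_leP : l1.
  rewrite (bigD1 i)//=; apply: (@le_trans _ _ ((c0 ^- k) ^+ 2 *
      nc (fcoef (deltak k (hh i) f) l) ^+ 2)); last first.
    by rewrite lerDl sumr_ge0// => j _; rewrite mulr_ge0 ?sqr_ge0.
  rewrite -exprMn lerXn2r ?nnegrE ?normc_ge0//.
    by rewrite mulr_ge0 ?normc_ge0// invr_ge0 exprn_ge0// ltW.
  rewrite fcoef_deltak// Normc.normcM normcX mulrA.
  rewrite ler_peMl ?normc_ge0// mulrC ler_pdivlMr ?exprn_gt0// mul1r.
  rewrite lerXn2r ?nnegrE ?normc_ge0 ?(ltW sg)//.
  rewrite /expk (bigD1 i)//= big1 => [|j ji]; last first.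
    by rewrite !mxE eqxx (negbTE ji) !mulr0.
  rewrite !mxE !eqxx mulr1 addr0; apply: cexpi_sub1_ge.
  rewrite normrM [ `|2 ^- s.+1|]ger0_norm ?(ltW hs0)//.
  rewrite -intr_norm -abszE -pmulrn.
  rewrite ler_pdivlMr ?exprn_gt0// ler_pdivrMr ?exprn_gt0// mul1r.
  rewrite -natrX ler_nat hi2 andbT expnS natrM mulrA mulVf ?pnatr_eq0// mul1r ler_nat.
  exact: ltnW.
apply: (@le_trans _ _ (d%:R * ((c0 ^- k) ^+ 2 * X ^+ 2))).
  rewrite big_seq; apply: le_trans (ler_sum _ pt_le) _.
  rewrite -big_seq exchange_big /=.
  apply: (@le_trans _ _ (\sum_(i < d) (c0 ^- k) ^+ 2 * X ^+ 2)).
    apply: ler_sum => i _; rewrite -mulr_sumr ler_wpM2l ?sqr_ge0//.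
    exact: Si.
  by rewrite sumr_const card_ord mulr_natl.
have -> : N0 * (1 + d%:R * K) * 2 `^ (s.+1%:R * (d%:R / p - d%:R / 2 - r)) =
   (1 + d%:R * K) / G * X.
  rewrite /X mulrBr powRD; last by apply/implyP => _; rewrite pnatr_eq0.
  field; exact: lt0r_neq0.
rewrite [(_ / G * X) ^+ 2]exprMn mulrA ler_wpM2r ?sqr_ge0//.
rewrite expr_div_n ler_pdivlMr ?exprn_gt0// -mulrA -exprMn -/K.
have [->|dn0] := eqVneq d 0%N; first by rewrite mul0r sqr_ge0.
have d1 : 1 <= d%:R :> R by rewrite ler1n lt0n.
apply: (@le_trans _ _ ((d%:R * K) ^+ 2)).
  by rewrite [(d%:R * K) ^+ 2]exprMn ler_wpM2r ?sqr_ge0// expr2 ler_peMr.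
have dK : 0 <= d%:R * K by rewrite mulr_ge0// ltW.
by rewrite lerXn2r ?nnegrE// -subr_ge0 addrK ler01.
Qed.

End besov_coefficients.

(** * Assembling the approximant *)

Section upper_bound.
Context {R : realType} {d : nat}.
Local Open Scope complex_scope.
Local Notation pt := 'rV[R]_d.
Local Notation freq := 'rV[int]_d.
Local Notation C := R[i].
Local Notation nc := (@Normc.normc R).

Lemma tpoly_of_trigp (m : nat) (b : freq -> C) (t : seq freq) : (1 <= d)%N ->
  uniq t -> (size t <= m)%N -> (forall k, k \notin t -> b k = 0) ->
  exists (kk : 'I_m -> freq) (c : 'I_m -> C), injective kk /\
    forall x : pt, tpoly kk c x = trigp b t x.
Proof.
move=> d1 ut tm bt; pose L := t ++ [seq k <- fbox m | k \notin t].
have uL : uniq L.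
  rewrite cat_uniq ut filter_uniq ?uniq_fbox// andbT /=.
  by apply/hasPn => k; rewrite mem_filter => /andP[].
have mL : (m <= size L)%N.
  apply: (@leq_trans (size (@fbox d m))).
    rewrite size_fbox; case: d d1 => // e _; rewrite expnS.
    by rewrite (leq_trans _ (leq_pmulr _ _))// ?expn_gt0//; lia.
  apply: uniq_leq_size (uniq_fbox m) _ => k km.
  by rewrite mem_cat mem_filter km andbT orbN.
have nthI : injective (fun j : 'I_m => nth 0 L j).
  move=> i j /eqP; rewrite nth_uniq ?(leq_trans (ltn_ord _) mL)//.
  by move=> /eqP h; exact: val_inj.
exists (fun j : 'I_m => nth 0 L j), (fun j : 'I_m => b (nth 0 L j)); split => // x.
transitivity (trigp b (take m L) x).
  rewrite /tpoly /trigp (big_nth 0) size_takel// big_mkord.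
  by apply: eq_bigr => j _; rewrite nth_take.
apply: trigp_supp => //; first exact: take_uniq.
move=> k bk; have kt : k \in t by apply: contraR bk => /bt ->.
rewrite kt /L take_cat; case: ltnP => h; last by rewrite mem_cat kt.
by rewrite (_ : m = size t) ?take_size//; apply/eqP; rewrite eqn_leq tm ltnW.
Qed.

Lemma nneseries_le (u : nat -> \bar R) (B : R) : (forall s, 0 <= u s)%E ->
  (forall N, \sum_(0 <= s < N) u s <= B%:E)%E -> (\sum_(0 <= s <oo) u s <= B%:E)%E.
Proof.
move=> u0 h; apply: lime_le; first exact: is_cvg_nneseries.
exact: nearW.
Qed.

Lemma Lpnorm0 (q : R) : 0 < q -> Lpnorm q (fun _ : pt => 0 : C) = 0%E.
Proof.
move=> q0; rewrite /Lpnorm Normc.normc0 powR0 ?gt_eqF// (torus_int_cst 0).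
by rewrite poweR0r// invr_eq0 gt_eqF.
Qed.

Definition low_freqs n : seq freq := [seq k <- fbox (2 ^ n) | (lev k < n)%N].

Lemma size_low_freqs n : (size (low_freqs n) <= 4 ^ d * (2 ^ n) ^ d)%N.
Proof.
rewrite size_filter (leq_trans (count_size _ _))// size_fbox -expnMn.
have [->|d0] := posnP d; first by rewrite !expn0.
have : (0 < 2 ^ n)%N by rewrite expn_gt0.
by rewrite leq_exp2r//; lia.
Qed.

Lemma size_low_freqs0 : size (low_freqs 0) = 0%N.
Proof. by rewrite /low_freqs (eq_filter (a2 := pred0)) ?filter_pred0. Qed.

(** The allocation is left open, as the two ranges of r differ only in it: [Ms s] terms are spent on
    block s, [E s] bounds its error. In the final 8, a factor 4 is that of [Lpnorm_quasi_triangle],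
    and a factor 2 arises because block s enters both sigma_s and sigma_(s-1). *)
Lemma em_fun_le (r p q : R) (theta : \bar R) k : (1 <= d)%N -> 1 < p -> p <= 2 ->
  2 < q -> 0 < r -> (1 <= theta)%E ->
  exists2 Q : R, 0 < Q & forall f : pt -> C, besov_class r p theta k f ->
  forall (n S m : nat) (Ms : nat -> nat) (E : nat -> R) (B : R),
    (size (low_freqs n) + \sum_(n <= s < S) Ms s <= m)%N ->
    (forall s, (n <= s < S)%N -> (0 < Ms s)%N) ->
    (forall s, 0 <= E s) ->
    (forall s, (n <= s < S)%N ->
       Q * (2 `^ (s%:R * (d%:R / p - r)) * (Ms s)%:R `^ (- 2^-1)) <= E s) ->
    (forall s, (n <= s)%N -> (S <= s)%N ->
       Q * 2 `^ (- (s%:R * (r - d%:R / p + d%:R / q))) <= E s) ->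
    (forall N, \sum_(0 <= s < N) E s <= B) ->
  (em_fun q m f <= (8 * B)%:E)%E.
Proof.
move=> d1 p1 p2 q2 r0 th1.
have q1 : 1 <= q by lra.
have q0 : 0 < q by lra.
have [B0 B0p hblock] := @besov_block R d r p theta k p1 p2 r0 th1.
pose n0 := (Num.truncn q).+1.
have qn0 : q <= (2 * n0)%:R.
  apply: ltW; apply: lt_le_trans (truncnS_gt q) _; rewrite ler_nat.
  by rewrite -/n0 leq_pmull.
pose F : R := (4 ^ d)%:R.
have F0 : 0 < F by rewrite ltr0n expn_gt0.
pose Cm := @maurey_cst R bool n0 * (F `^ 2^-1 * B0).
pose Cn := F `^ (2^-1 - q^-1) * B0.
have Cm0 : 0 < Cm by rewrite mulr_gt0 ?maurey_cst_gt0// mulr_gt0// powR_gt0.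
have Cn0 : 0 < Cn by rewrite mulr_gt0// powR_gt0.
exists (Cm + Cn); first exact: addr_gt0.
move=> f /[dup] fB [pf [mf hB]] n S m Ms E B hm Mpos E0 hmid htail hsum.
have hp1 := besov_Lpnorm_le1 th1 hB.
have fi := cintble_Lp (ltW p1) ler01 mf hp1.
pose c := fcoef f.
pose Nn s : R := (4 ^ d * (2 ^ s) ^ d)%:R.
have Nn0 s : 0 < Nn s by rewrite ltr0n muln_gt0 !expn_gt0.
have szN s : (size (@dblock d s))%:R <= Nn s by rewrite ler_nat size_dblock.
pose L s := B0 * 2 `^ (s%:R * (d%:R / p - d%:R / 2 - r)).
have L0 s : 0 < L s by rewrite mulr_gt0// powR_gt0.
have hL s : \sum_(l <- dblock s) nc (c l) ^+ 2 <= L s ^+ 2 by exact: hblock.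
have NnE s e : Nn s `^ e * L s =
    F `^ e * B0 * 2 `^ (s%:R * (d%:R * e + d%:R / p - d%:R / 2 - r)).
  rewrite /Nn /L natrM powRM// -/F -expnM natrX -powR_mulrn// -powRrM natrM.
  rewrite mulrACA; congr (_ * _).
  rewrite -powRD; last by apply/implyP => _; rewrite pnatr_eq0.
  congr (_ `^ _); ring.
(* The multipliers are indexed by [bool]: true for that of sigma_s, false for that of sigma_(s-1).
   At s = 0 the two coincide. *)
have hmaurey s : exists bt : (freq -> C) * seq freq, (n <= s < S)%N ->
    [/\ (size bt.2 <= Ms s)%N, {subset bt.2 <= dblock s},
      forall l, l \notin bt.2 -> bt.1 l = 0 &
      forall i : bool, (Lpnorm q (trigp (fun l =>
         ((lpmult (if i then s else s.-1) l)%:C * (c l - bt.1 l))%R) (dblock s)) <= (E s)%:E)%E].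
  have [hs|hs] := boolP (n <= s < S)%N; last by exists (fun=> 0, [::]).
  have sA := sum_le_sqrt_sum_sqr (szN s) (Nn0 s) (L0 s) (hL s).
  have A0 : 0 < Nn s `^ 2^-1 * L s by rewrite mulr_gt0// powR_gt0.
  have [b [t [h1 h2 h3 h4]]] := @maurey R d bool
     (fun (i : bool) l => lpmult (if i then s else s.-1) l)
     (fun i l => lpmult_norm _ l) (dblock s) c (Ms s) n0 q _
     (Mpos s hs) (uniq_dblock s) q1 qn0 A0 sA.
  exists (b, t) => _; split => // i; apply: le_trans (h4 i) _; rewrite lee_fin.
  apply: le_trans (hmid s hs).
  rewrite NnE (_ : s%:R * (d%:R * 2^-1 + d%:R / p - d%:R / 2 - r) = s%:R * (d%:R / p - r));
    last by ring.
  apply: (@le_trans _ _ (Cm * (2 `^ (s%:R * (d%:R / p - r)) * (Ms s)%:R `^ (- 2^-1)))).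
    by apply: eq_ler; rewrite /Cm; ring.
  by rewrite ler_wpM2r ?mulr_ge0 ?powR_ge0// lerDl ltW.
have [bt hbt] := choice hmaurey.
pose b l := if (lev l < n)%N then c l else if (lev l < S)%N then (bt (lev l)).1 l else 0.
pose Th := low_freqs n ++ flatten [seq (bt s).2 | s <- index_iota n S].
pose t0 := undup Th.
have st0 : (size t0 <= m)%N.
  apply: leq_trans (size_undup _) _; apply: leq_trans hm.
  rewrite size_cat leq_add2l size_flatten /shape sumnE !big_map.
  rewrite [leqLHS]big_seq [leqRHS]big_seq; apply: leq_sum => s.
  by rewrite mem_index_iota => hs; have [] := hbt s hs.
have bt0 l : l \notin t0 -> b l = 0.
  rewrite mem_undup mem_cat negb_or => /andP[h1 h2]; rewrite /b.
  case: ifPn => [ln|ln].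
    by move: h1; rewrite mem_filter ln mem_fbox -lev_leE ltnW.
  case: ifPn => // lS; have hs : (n <= lev l < S)%N by rewrite leqNgt ln.
  have [_ _ h3 _] := hbt _ hs; apply: h3; apply: contra h2 => h2.
  apply/flatten_mapP; exists (lev l) => //; by rewrite mem_index_iota.
have [kk [cc [kinj tE]]] := tpoly_of_trigp d1 (undup_uniq Th) st0 bt0.
apply: (@le_trans _ _ (Bq1norm q (fun x => f x - tpoly kk cc x))).
  by apply: ereal_inf_lbound; exists kk, cc.
set g := fun x => f x - tpoly kk cc x.
have gE : g = fun x => f x - trigp b t0 x by apply/funext => x; rewrite /g tE.
have ti := cintble_trigp b t0.
have pg : Defs.periodic g by move=> x i; rewrite gE pf trigp_periodic.
have gi : cintble g by rewrite gE; apply: cintbleD fi (cintbleN ti).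
have gc l : fcoef g l = c l - b l.
  rewrite gE fcoefB// fcoef_trigp ?undup_uniq//; case: ifPn => // h.
  by rewrite (bt0 _ h).
have blk s s' : (s' == s) || (s' == s.+1) ->
  (Lpnorm q (trigp (fun l => ((lpmult s l)%:C * fcoef g l)%R) (dblock s')) <= (E s')%:E)%E.
  move=> ss'.
  have [sn|sn] := ltnP s' n.
    rewrite (_ : trigp _ _ = fun=> 0) ?Lpnorm0 ?lee_fin//.
    apply/funext => x; rewrite /trigp big_seq big1// => l.
    by rewrite mem_dblock gc /b => /eqP ->; rewrite sn subrr mulr0 mul0r.
  have [sS|sS] := ltnP s' S.
    have hs : (n <= s' < S)%N by rewrite sn.
    have [_ _ _ /(_ (s' == s))] := hbt _ hs.
    rewrite (_ : trigp _ _ = trigp (fun l => (lpmult s l)%:C * fcoef g l) (dblock s'))//.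
    apply/funext => x; apply: eq_trigp => l; rewrite mem_dblock => /eqP lv.
    rewrite gc /b lv ltnNge sn /= sS; congr ((lpmult _ _)%:C * _).
    by move: ss'; case: eqP => //= _ /eqP ->.
  (* A dropped block: passing from L_2 to L_q adds d/2 - d/q to the exponent d/p - d/2 - r. *)
  apply: le_trans (_ : (_ <= (Nn s' `^ (2^-1 - q^-1) * L s')%:E)%E) _.
    apply: nikolskii => //; [by lra|exact: uniq_dblock|].
    apply: le_trans (hL s'); rewrite big_seq [leRHS]big_seq; apply: ler_sum => l.
    rewrite mem_dblock => /eqP lv.
    rewrite gc /b lv (ltnNge s' n) sn (ltnNge s' S) sS (subr0 (c l)).
    rewrite lerXn2r ?nnegrE ?normc_ge0//.
    by rewrite Normc.normcM normcR ler_piMl ?normc_ge0// lpmult_norm.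
  rewrite lee_fin NnE; apply: le_trans (htail s' sn sS).
  rewrite (_ : s'%:R * _ = - (s'%:R * (r - d%:R / p + d%:R / q))); last by field; lra.
  by rewrite -/Cn ler_wpM2r ?powR_ge0// lerDr ltW.
have sig s : (Lpnorm q (sigma_s s g) <= (4 * (E s + E s.+1))%:E)%E.
  rewrite (_ : sigma_s s g = fun x =>
    trigp (fun l => (lpmult s l)%:C * fcoef g l) (dblock s) x +
    trigp (fun l => (lpmult s l)%:C * fcoef g l) (dblock s.+1) x).
    apply: Lpnorm_quasi_triangle => //; try exact: cmeasurable_trigp.
      by apply: blk; rewrite eqxx.
    by apply: blk; rewrite eqxx orbT.
  by apply/funext => x; exact: sigma_s_dblock.
apply: nneseries_le => [s|N]; first exact: Lpnorm_ge0.
apply: (@le_trans _ _ (\sum_(0 <= s < N) (4 * (E s + E s.+1))%:E)%E).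
  by apply: lee_sum => s _.
rewrite sumEFin lee_fin -mulr_sumr big_split /=.
have h1 := hsum N; have h2 := hsum N.+1.
rewrite big_nat_recl// in h2.
have h3 := E0 0%N; lra.
Qed.

End upper_bound.

(** * Choice of the allocation and passage to all m *)

Section upper_bound_order.
Context {R : realType} {d : nat}.
Local Notation pt := 'rV[R]_d.

(** The distance |s - t|: with truncated subtraction one of the two terms is 0. *)
Definition natdist (s t : nat) : nat := ((s - t) + (t - s))%N.

Lemma geo_sum (x : R) n : 0 < x -> x < 1 -> \sum_(0 <= i < n) x ^+ i <= (1 - x)^-1.
Proof.
move=> x0 x1; have h : 0 < 1 - x by lra.
rewrite -[leRHS]mul1r ler_pdivlMr// mulrC.
suff -> : (1 - x) * \sum_(0 <= i < n) x ^+ i = 1 - x ^+ n.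
  by rewrite lerBlDr lerDl exprn_ge0// ltW.
elim: n => [|n IH]; first by rewrite big_geq// expr0 subrr mulr0.
by rewrite big_nat_recr//= mulrDr IH exprS; ring.
Qed.

Lemma powR1E (g : R) : 1 `^ g = 1.
Proof. by rewrite powR1. Qed.

Lemma pow2N_lt1 (g : R) : 0 < g -> 2 `^ (- g) < 1.
Proof.
move=> g0; rewrite powRN invf_lt1 ?powR_gt0// -[ltLHS](powR1E g).
by apply: gt0_ltr_powR => //; rewrite ?nnegrE// ltr1n.
Qed.

Lemma geo_dist_sum (g : R) s0 N : 0 < g ->
  \sum_(0 <= s < N) 2 `^ (- (g * (natdist s s0)%:R)) <= 2 / (1 - 2 `^ (- g)).
Proof.
move=> g0; set x := 2 `^ (- g).
have x0 : 0 < x by rewrite powR_gt0.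
have x1 : x < 1 by exact: pow2N_lt1.
have E n : 2 `^ (- (g * n%:R)) = x ^+ n by rewrite -mulNr powRrM powR_mulrn// ltW.
under eq_bigr do rewrite E.
apply: (@le_trans _ _ (\sum_(0 <= s < s0 + N) x ^+ natdist s s0)).
  rewrite (@big_cat_nat _ _ _ N 0 (s0 + N))//= ?leq_addl// lerDl.
  by apply: sumr_ge0 => s _; rewrite exprn_ge0// ltW.
rewrite (@big_cat_nat _ _ _ s0)//= ?leq_addr//.
rewrite mulr_natl mulr2n; apply: lerD.
  rewrite big_nat_rev /=; apply: le_trans (geo_sum s0 x0 x1).
  rewrite big_nat [leRHS]big_nat; apply: ler_sum => s /andP[_ hs].
  by rewrite ler_wiXn2l ?(ltW x0) ?(ltW x1)// /natdist; lia.
rewrite -{1}[s0]add0n big_addn addKn; apply: le_trans (geo_sum N x0 x1).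
by apply: eq_ler; apply: eq_bigr => s _; congr (_ ^+ _); rewrite /natdist; lia.
Qed.

Lemma nat_le_pow2 n : (1 <= d)%N -> n%:R <= 2 `^ (n%:R * d%:R) :> R.
Proof.
move=> d1; rewrite -natrM powR_mulrn// -natrX ler_nat.
apply: leq_trans (ltnW (ltn_expl n (isT : (1 < 2)%N))) _.
by rewrite leq_exp2l// leq_pmulr.
Qed.

(** Block s receives about 2^(nd - kap |s - s0|) terms and is allowed an error of order 2^(V - g |s
    - s0|), so both sums are geometric and the hypotheses only compare exponents. The summand S pays
    for rounding each number of terms up. The alternative n = S = 0 is the zero approximation,
    available for every m. *)
Lemma upper_param (r p q : R) (theta : \bar R) k : (1 <= d)%N -> 1 < p -> p <= 2 ->
  2 < q -> 0 < r -> (1 <= theta)%E ->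
  exists2 Q : R, 0 < Q & forall f : pt -> R[i], besov_class r p theta k f ->
  forall (n S s0 m : nat) (kap g V : R), 0 < kap -> 0 < g ->
    (forall s, (n <= s < S)%N ->
       s%:R * (d%:R / p - r) - (n%:R * d%:R - kap * (natdist s s0)%:R) / 2 <=
       V - g * (natdist s s0)%:R) ->
    (forall s, (n <= s)%N -> (S <= s)%N ->
       - (s%:R * (r - d%:R / p + d%:R / q)) <= V - g * (natdist s s0)%:R) ->
    ((S == 0%N) && (n == 0%N)) || (2 `^ (n%:R * d%:R) *
       ((4 ^ d)%:R + 2 / (1 - 2 `^ (- kap))) + S%:R <= m%:R) ->
  (em_fun q m f <= (Q * 2 `^ V * (1 - 2 `^ (- g))^-1)%:E)%E.
Proof.
move=> d1 p1 p2 q2 r0 th1.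
have [Q Q0 main] := @em_fun_le R d r p q theta k d1 p1 p2 q2 r0 th1.
exists (16 * Q); first by rewrite mulr_gt0.
move=> f fB n S s0 m kap g V kap0 g0 hi hii hm.
pose M s := (Num.truncn (2 `^ (n%:R * d%:R - kap * (natdist s s0)%:R) : R)).+1.
have two1 : 1 <= 2 :> R by rewrite ler1n.
have two0 : 2 != 0 :> R by rewrite pnatr_eq0.
have Mge s : 2 `^ (n%:R * d%:R - kap * (natdist s s0)%:R) <= (M s)%:R :> R.
  by apply: ltW; exact: truncnS_gt.
have Mle s : (M s)%:R <= 2 `^ (n%:R * d%:R - kap * (natdist s s0)%:R) + 1 :> R.
  by rewrite /M -(natr1 (Num.truncn _)) lerD2r truncn_le ?powR_ge0.
have := main f fB n S m M (fun s => Q * 2 `^ (V - g * (natdist s s0)%:R))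
  (Q * 2 `^ V * (2 / (1 - 2 `^ (- g)))).
rewrite (_ : 8 * (Q * 2 `^ V * (2 / (1 - 2 `^ (- g)))) =
   16 * Q * 2 `^ V * (1 - 2 `^ (- g))^-1); last by ring.
apply => //.
- case/orP: hm => [/andP[/eqP -> /eqP ->]|hm].
    by rewrite size_low_freqs0 big_geq.
  rewrite -(ler_nat R) natrD natr_sum; apply: le_trans hm.
  rewrite mulrDr -addrA; apply: lerD.
    rewrite -natrM powR_mulrn// -natrX -natrM ler_nat mulnC.
    by apply: leq_trans (size_low_freqs n) _; rewrite expnM.
  apply: (@le_trans _ _ (\sum_(n <= s < S) (2 `^ (n%:R * d%:R) *
     2 `^ (- (kap * (natdist s s0)%:R)) + 1))).
    apply: ler_sum => s _; apply: le_trans (Mle s) _.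
    by rewrite powRD// implybE two0 orbT.
  rewrite big_split /= -mulr_sumr; apply: lerD.
    rewrite ler_wpM2l ?powR_ge0//; apply: le_trans (geo_dist_sum s0 S kap0).
    have [nS|nS] := leqP n S; last first.
      by rewrite big_geq ?(ltnW nS)// sumr_ge0// => s _; exact: powR_ge0.
    rewrite (@big_cat_nat _ _ _ n 0)//= lerDr sumr_ge0// => s _; exact: powR_ge0.
  by rewrite big_const_nat iter_addr_0 ler_nat leq_subr.
- by move=> s; rewrite mulr_ge0 ?powR_ge0// ltW.
- move=> s hs; rewrite ler_pM2l//.
  apply: (@le_trans _ _ (2 `^ (s%:R * (d%:R / p - r)) *
     (2 `^ (n%:R * d%:R - kap * (natdist s s0)%:R)) `^ (- 2^-1))).
    rewrite ler_wpM2l ?powR_ge0// !powRN lef_pV2 ?posrE ?powR_gt0 ?ltr0n//.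
    by apply: ler_powR2r; rewrite ?invr_ge0 ?powR_ge0.
  rewrite -powRrM -powRD ?implybE ?two0 ?orbT//; apply: ler_powR => //.
  by apply: le_trans (hi s hs); apply: eq_ler; ring.
- by move=> s ns Ss; rewrite ler_pM2l//; apply: ler_powR => //; exact: hii.
- move=> N; under eq_bigr do rewrite powRD ?implybE ?two0 ?orbT// mulrA.
  by rewrite -mulr_sumr ler_wpM2l ?mulr_ge0 ?powR_ge0 ?(ltW Q0)// geo_dist_sum.
Qed.

(** For m >= K the largest n with K 2^(nd) <= m has m < K 2^d 2^(nd). For m < K no n qualifies, and
    the bound Q, valid for all m, is comparable to the claim. *)
Lemma upper_choice (F : nat -> \bar R) (Q K tau : R) : (1 <= d)%N -> 0 < Q ->
  1 <= K -> 0 < tau -> (forall m, F m <= Q%:E)%E ->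
  (forall m n, K * 2 `^ (n%:R * d%:R) <= m%:R ->
     (F m <= (Q * 2 `^ (- (n%:R * tau)))%:E)%E) ->
  exists2 C2 : R, 0 < C2 & forall m, (0 < m)%N ->
    (F m <= (C2 * m%:R `^ (- (tau / d%:R)))%:E)%E.
Proof.
move=> d1 Q0 K1 t0 F1 F2; have K0 : 0 < K by lra.
have d0 : 0 < d%:R :> R by rewrite ltr0n.
pose e := tau / d%:R; have e0 : 0 < e by rewrite divr_gt0.
pose C2 := Q * (K * 2 `^ d%:R) `^ e.
have p2 : 1 <= 2 `^ d%:R :> R by rewrite powR_mulrn// exprn_ege1// ler1n.
have KK : 0 < K * 2 `^ d%:R by rewrite mulr_gt0// powR_gt0.
exists C2; first by rewrite mulr_gt0// powR_gt0.
move=> m m0; have mR : 0 < m%:R :> R by rewrite ltr0n.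
have goal (y : R) : 0 < y -> m%:R <= K * 2 `^ d%:R * y ->
    Q * y `^ (- e) <= C2 * m%:R `^ (- e).
  move=> y0 my; rewrite /C2 -mulrA ler_pM2l// !powRN.
  rewrite ler_pdivlMr ?powR_gt0// mulrC ler_pdivrMr ?powR_gt0//.
  by rewrite -powRM ?(ltW KK) ?(ltW y0)//; apply: ler_powR2r; rewrite ?(ltW e0) ?(ltW mR).
have [mK|Km] := ltP m%:R K.
  apply: le_trans (F1 m) _; rewrite lee_fin -[leLHS]mulr1 -[X in Q * X](powR1E (- e)).
  by apply: goal => //; rewrite mulr1; apply: le_trans (ltW mK) _; rewrite ler_peMr// ltW.
pose P n := K * 2 `^ (n%:R * d%:R) <= m%:R.
have P0 : exists n, P n by exists 0%N; rewrite /P mul0r powRr0 mulr1.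
have Pb n : P n -> (n <= m)%N.
  rewrite /P => h; rewrite -(ler_nat R); apply: le_trans h.
  apply: le_trans (nat_le_pow2 n d1) _; by rewrite ler_peMl ?powR_ge0.
case: (ex_maxnP P0 Pb) => n Pn maxn.
apply: le_trans (F2 m n Pn) _; rewrite lee_fin.
rewrite (_ : - (n%:R * tau) = (n%:R * d%:R) * (- e)); last first.
  by rewrite /e; field; exact: lt0r_neq0.
rewrite powRrM; apply: goal; first exact: powR_gt0.
rewrite leNgt; apply/negP => h.
have /maxn : P n.+1; last by rewrite ltnn.
rewrite /P; apply: le_trans (ltW h).
rewrite -mulrA -powRD; last by apply/implyP => _; rewrite pnatr_eq0.
rewrite ler_wpM2l ?(ltW K0)//; apply: eq_ler; congr (_ `^ _); by rewrite -natr1; ring.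
Qed.

(** At a constant budget of 2^(nd) terms the error of block s decays like 2^(-al s). Half of this
    decay is given away to let the budget shrink like 2^(-al (s - n)), which keeps the total number
    of terms of order 2^(nd). *)
Lemma upper_large (r p q : R) (theta : \bar R) k : (1 <= d)%N -> 1 < p -> p <= 2 ->
  2 < q -> 0 < r -> (1 <= theta)%E -> d%:R / p < r ->
  exists2 C2 : R, 0 < C2 & forall m, (0 < m)%N ->
   (em_class q m (@besov_class R d r p theta k) <=
    (C2 * m%:R `^ (- (r / d%:R) + p^-1 - 2^-1))%:E)%E.
Proof.
move=> d1 p1 p2 q2 r0 th1 hr.
have [Q Q0 main] := @upper_param r p q theta k d1 p1 p2 q2 r0 th1.
have d0 : 0 < d%:R :> R by rewrite ltr0n.
have dq : 0 < d%:R / q by rewrite divr_gt0//; lra.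
pose al := r - d%:R / p; have al0 : 0 < al by rewrite subr_gt0.
have be0 : 0 < r - d%:R / p + d%:R / q by rewrite addr_gt0.
pose x1 := 2 `^ (- (al / 2)) : R; pose x2 := 2 `^ (- (r - d%:R / p + d%:R / q)) : R.
have x11 : 0 < 1 - x1 by rewrite subr_gt0 pow2N_lt1// divr_gt0.
have x21 : 0 < 1 - x2 by rewrite subr_gt0 pow2N_lt1.
have x31 : 0 < 1 - 2 `^ (- al) by rewrite subr_gt0 pow2N_lt1.
pose Q' := Q * (1 - x1)^-1 + Q * (1 - x2)^-1.
have Q1 : 0 < Q * (1 - x1)^-1 by rewrite mulr_gt0// invr_gt0.
have Q2 : 0 < Q * (1 - x2)^-1 by rewrite mulr_gt0// invr_gt0.
(* The last summand bounds S = n + j0 <= n + n d / al + 1 in units of 2^(nd). *)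
pose K := (4 ^ d)%:R + 2 / (1 - 2 `^ (- al)) + (d%:R / al + 2).
have dal : 0 < d%:R / al by rewrite divr_gt0.
have K1 : 1 <= K.
  have h1 : 0 <= (4 ^ d)%:R :> R by [].
  have h2 : 0 < 2 / (1 - 2 `^ (- al)) by rewrite divr_gt0.
  rewrite /K; lra.
have tau0 : 0 < d%:R / 2 + al by rewrite addr_gt0// divr_gt0.
have [|||C2 C20 h] := @upper_choice
  (fun m => em_class q m (@besov_class R d r p theta k)) Q' K (d%:R / 2 + al)
  d1 _ K1 tau0.
- exact: addr_gt0.
- move=> m; apply: ub_ereal_sup => _ [f fB <-].
  apply: le_trans (main f fB 0%N 0%N 0%N m 1 _ 0 ltr01 be0 _ _ _) _ => //.
    move=> s _ _; rewrite /natdist subn0 sub0n addn0 sub0r mulrC; exact: lexx.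
  by rewrite lee_fin powRr0 mulr1 /Q' lerDr ltW.
- move=> m n hm; apply: ub_ereal_sup => _ [f fB <-].
  (* Then al (s - n) >= n d for every dropped block, which makes up for the factor 2^(-nd/2) that
     only Maurey's bound provides. *)
  pose j0 := (Num.truncn (n%:R * d%:R / al)).+1.
  have j0g : n%:R * d%:R / al < j0%:R by exact: truncnS_gt.
  have j0l : j0%:R <= n%:R * d%:R / al + 1.
    by rewrite /j0 -(natr1 (Num.truncn _)) lerD2r truncn_le// divr_ge0 ?mulr_ge0// ltW.
  apply: le_trans (main f fB n (n + j0)%N n m al (al / 2)
     (- (n%:R * (d%:R / 2 + al))) al0 _ _ _ _) _.
  + by rewrite divr_gt0.
  + move=> s /andP[ns _]; rewrite /natdist (eqP ns) addn0 natrB//.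
    by apply: eq_ler; rewrite /al; field; lra.
  + move=> s ns Ss; rewrite /natdist (eqP ns) addn0 natrB//.
    have s1 : n%:R + j0%:R <= s%:R :> R by rewrite -natrD ler_nat.
    have h1 : n%:R * d%:R <= (s%:R - n%:R) * al.
      rewrite -ler_pdivrMr//; lra.
    have h2 : 0 <= s%:R * (d%:R / q) by rewrite mulr_ge0// ltW.
    have -> : r - d%:R / p + d%:R / q = al + d%:R / q by [].
    by nra.
  + apply/orP; right; apply: le_trans hm.
    have p1n : 1 <= 2 `^ (n%:R * d%:R) :> R.
      by rewrite -natrM powR_mulrn// exprn_ege1// ler1n.
    have n1 := nat_le_pow2 n d1; rewrite /K natrD.
    rewrite [leRHS]mulrC [leRHS]mulrDr lerD2l.
    have h3 : n%:R * d%:R / al <= 2 `^ (n%:R * d%:R) * (d%:R / al).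
      by rewrite -mulrA ler_pM2r.
    by lra.
  + rewrite lee_fin -/x1 -[leLHS]mulrA [_ `^ _ * _]mulrC mulrA.
    by rewrite ler_wpM2r ?powR_ge0// /Q' lerDl ltW.
exists C2 => // m m0; apply: le_trans (h m m0) _; rewrite lee_fin.
apply: eq_ler; congr (_ * _ `^ _); rewrite /al; field; lra.
Qed.

(** Here al = d/p - r > 0: at a budget of 2^(nd) terms Maurey's error 2^(s al - nd/2) grows with s,
    while the truncation error 2^(-s be) falls. As al + be = d/q, they balance at s = nq/2, where
    both are 2^(-n q be / 2). *)
Lemma upper_small (r p q : R) (theta : \bar R) k : (1 <= d)%N -> 1 < p -> p <= 2 ->
  2 < q -> 0 < r -> (1 <= theta)%E -> d%:R * (p^-1 - q^-1) < r -> r < d%:R / p ->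
  exists2 C2 : R, 0 < C2 & forall m, (0 < m)%N ->
   (em_class q m (@besov_class R d r p theta k) <=
    (C2 * m%:R `^ (- (q / 2) * (r / d%:R - p^-1 + q^-1)))%:E)%E.
Proof.
move=> d1 p1 p2 q2 r0 th1 hr1 hr2.
have [Q Q0 main] := @upper_param r p q theta k d1 p1 p2 q2 r0 th1.
have d0 : 0 < d%:R :> R by rewrite ltr0n.
pose al := d%:R / p - r; have al0 : 0 < al by rewrite subr_gt0.
pose be := r - d%:R / p + d%:R / q.
have be0 : 0 < be by move: hr1; rewrite mulrBr /be; lra.
have abE : al + be = d%:R / q by rewrite /al /be; ring.
pose g := Num.min (al / 2) be.
have g0 : 0 < g by rewrite lt_min divr_gt0// be0.
have g1 : g <= al / 2 by rewrite ge_min lexx.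
have g2 : g <= be by rewrite ge_min lexx orbT.
have x11 : 0 < 1 - 2 `^ (- g) by rewrite subr_gt0 pow2N_lt1.
have x21 : 0 < 1 - 2 `^ (- be) by rewrite subr_gt0 pow2N_lt1.
have x31 : 0 < 1 - 2 `^ (- al) by rewrite subr_gt0 pow2N_lt1.
pose Q' := Q * 2 `^ al * (1 - 2 `^ (- g))^-1 + Q * (1 - 2 `^ (- be))^-1.
have Q1 : 0 < Q * 2 `^ al * (1 - 2 `^ (- g))^-1.
  by rewrite !mulr_gt0 ?powR_gt0// invr_gt0.
have Q2 : 0 < Q * (1 - 2 `^ (- be))^-1 by rewrite mulr_gt0// invr_gt0.
pose K := (4 ^ d)%:R + 2 / (1 - 2 `^ (- al)) + (q / 2 + 1).
have K1 : 1 <= K.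
  have h1 : 0 <= (4 ^ d)%:R :> R by [].
  have h2 : 0 < 2 / (1 - 2 `^ (- al)) by rewrite divr_gt0.
  rewrite /K; lra.
have tau0 : 0 < q / 2 * be by rewrite mulr_gt0//; lra.
have [|||C2 C20 h] := @upper_choice
  (fun m => em_class q m (@besov_class R d r p theta k)) Q' K (q / 2 * be)
  d1 _ K1 tau0.
- exact: addr_gt0.
- move=> m; apply: ub_ereal_sup => _ [f fB <-].
  apply: le_trans (main f fB 0%N 0%N 0%N m 1 _ 0 ltr01 be0 _ _ _) _ => //.
    move=> s _ _; rewrite /natdist subn0 sub0n addn0 sub0r mulrC; exact: lexx.
  by rewrite lee_fin powRr0 mulr1 /Q' lerDr ltW.
- move=> m n hm; apply: ub_ereal_sup => _ [f fB <-].
  pose S := (Num.truncn (n%:R * q / 2)).+1.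
  have Sg : n%:R * q / 2 < S%:R by exact: truncnS_gt.
  have Sl : S%:R <= n%:R * q / 2 + 1.
    by rewrite /S -(natr1 (Num.truncn _)) lerD2r truncn_le// divr_ge0 ?mulr_ge0//; lra.
  have qE : q * (al + be) = d%:R by rewrite abE mulrC mulfVK// gt_eqF//; lra.
  (* The summand al in V absorbs the rounding of S, which exceeds nq/2 by at most 1. *)
  apply: le_trans (main f fB n S S m al g (al - n%:R * (q / 2 * be)) al0 g0 _ _ _) _.
  + move=> s /andP[_ sS]; rewrite -/al /natdist (eqP (ltnW sS)) add0n natrB ?(ltnW sS)//.
    have h1 : 0 <= S%:R - s%:R :> R by rewrite subr_ge0 ler_nat ltnW.
    have h2 := ler_wpM2r h1 g1.
    have h3 := ler_wpM2r (ltW al0) Sl.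
    have h4 : n%:R * d%:R = n%:R * q * al + n%:R * q * be by rewrite -qE; ring.
    by lra.
  + move=> s _ sS; rewrite -/be /natdist (eqP sS) addn0 natrB//.
    have h1 : 0 <= s%:R - S%:R :> R by rewrite subr_ge0 ler_nat.
    have h2 := ler_wpM2r h1 g2.
    have h3 := ler_wpM2r (ltW be0) (ltW Sg).
    by lra.
  + apply/orP; right; apply: le_trans hm.
    have p1n : 1 <= 2 `^ (n%:R * d%:R) :> R.
      by rewrite -natrM powR_mulrn// exprn_ege1// ler1n.
    have n1 := nat_le_pow2 n d1; rewrite /K.
    rewrite [leRHS]mulrC [leRHS]mulrDr lerD2l.
    have h3 := ler_wpM2r (_ : 0 <= q / 2) n1.
    by lra.
  + rewrite lee_fin powRD ?implybE ?pnatr_eq0 ?orbT//.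
    rewrite [leLHS](_ : _ = Q * 2 `^ al * (1 - 2 `^ (- g))^-1 *
      2 `^ (- (n%:R * (q / 2 * be)))); last by ring.
    by rewrite ler_wpM2r ?powR_ge0// /Q' lerDl ltW.
exists C2 => // m m0; apply: le_trans (h m m0) _; rewrite lee_fin.
apply: eq_ler; congr (_ * _ `^ _); rewrite /be; field; lra.
Qed.

End upper_bound_order.

(** * Lower bound *)

Section fejer_kernel.
Context {R : realType} {d : nat}.
Local Open Scope complex_scope.
Local Notation pt := 'rV[R]_d.
Local Notation freq := 'rV[int]_d.
Local Notation C := R[i].
Local Notation nc := (@Normc.normc R).

Lemma sin_lip (t : R) : 0 <= t -> `|sin t| <= t.
Proof.
move=> t0; have [|c _] := @MVT_segment R sin cos 0 t t0.
- by apply: continuous_subspaceT => x; exact: continuous_sin.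
rewrite sin0 !subr0 => ->; rewrite normrM (ger0_norm t0) ler_piMl//.
exact: cos_max.
Qed.

Lemma cos_lip (t : R) : 0 <= t -> `|cos t - 1| <= t.
Proof.
move=> t0; have [|c _] := @MVT_segment R cos (fun x => - sin x) 0 t t0.
- by apply: continuous_subspaceT => x; exact: continuous_cos.
rewrite cos0 subr0 => ->; rewrite normrM normrN (ger0_norm t0) ler_piMl//.
exact: sin_max.
Qed.

Lemma cexpi_sub1_le (t : R) : nc (cexpi t - 1) <= 2 * `|t|.
Proof.
have key u : 0 <= u -> nc (cexpi u - 1) <= 2 * u.
  move=> u0; apply: le_trans (normc_le_ReIm _) _.
  rewrite ReD ImD ReN ImN /= oppr0 addr0 mulr_natl mulr2n.
  by apply: lerD; [exact: cos_lip|exact: sin_lip].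
have [t0|t0] := leP 0 t; first by rewrite ger0_norm//; exact: key.
rewrite ltr0_norm// -[t in leLHS]opprK cexpiN.
have -> : conjc (cexpi (- t)) - 1 = conjc (cexpi (- t) - 1).
  by apply: complex_eq; rewrite /= ?oppr0 ?subr0 ?addr0 ?oppr0 ?addr0.
by rewrite normc_conj; apply: key; rewrite oppr_ge0 ltW.
Qed.

Lemma expk_sub1_le2 (k : freq) (h : pt) : nc (expk k h - 1) <= 2.
Proof.
by apply: le_trans (normcB _ _) _; rewrite normc_expk Normc.normc1; apply: eq_ler; ring.
Qed.

Lemma euclid_coord (h : pt) i : `|h ord0 i| <= euclid h.
Proof.
rewrite /euclid -[ `|h _ _|]sqrtr_sqr ler_wsqrtr//.
by rewrite (bigD1 i)//= lerDl sumr_ge0// => j _; exact: sqr_ge0.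
Qed.

Lemma expk_sub1_le (N : nat) (k : freq) (h : pt) : (supn k <= N)%N ->
  nc (expk k h - 1) <= 2 * d%:R * (N%:R * euclid h).
Proof.
move=> /supn_leP kN; apply: le_trans (cexpi_sub1_le _) _.
rewrite -mulrA ler_pM2l//; apply: le_trans (ler_norm_sum _ _ _) _.
apply: (@le_trans _ _ (\sum_(i < d) N%:R * euclid h)).
  apply: ler_sum => i _; rewrite normrM ler_pM// ?euclid_coord//.
  by rewrite -intr_norm -abszE -pmulrn ler_nat.
by rewrite sumr_const card_ord -[_ *+ d]mulr_natl.
Qed.

Lemma deltak_trigp k h (c : freq -> C) s :
  deltak k h (trigp c s) = trigp (fun l => (expk l h - 1) ^+ k * c l) s :> (pt -> C).
Proof.
elim: k => [|k IH].
  by apply/funext => x; apply: eq_trigp => l _; rewrite expr0 mul1r.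
rewrite [deltak _ _ _]/(diffop h (deltak k h (trigp c s))) IH.
apply/funext => x; rewrite /diffop /trigp -sumrN -big_split; apply: eq_bigr => l _ /=.
by rewrite expk_addpt exprS; ring.
Qed.

Variable N : nat.
Hypothesis N0 : (0 < N)%N.

Definition cube_freq (f : {ffun 'I_d -> 'I_N}) : freq := \row_j (f j : nat)%:Z.
Definition cube : seq freq := [seq cube_freq f | f <- enum {ffun 'I_d -> 'I_N}].

Lemma uniq_cube : uniq cube.
Proof.
rewrite map_inj_uniq ?enum_uniq// => f g /rowP fg; apply/ffunP => j; apply: val_inj.
by have := fg j; rewrite !mxE => -[].
Qed.

Lemma size_cube : size cube = (N ^ d)%N.
Proof. by rewrite size_map -cardE card_ffun !card_ord. Qed.

Lemma cube_coord a i : a \in cube -> (0 <= a ord0 i) /\ (a ord0 i < N%:Z).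
Proof. by move=> /mapP[f _ ->]; rewrite mxE; split=> //; rewrite ltz_nat. Qed.

Lemma cube_supn a : a \in cube -> (supn a <= N)%N.
Proof.
move=> h; apply/supn_leP => i; have [] := cube_coord i h.
by move: (a ord0 i) => z; lia.
Qed.

Lemma cubeB_mem a b : a \in cube -> b \in cube -> a - b \in fbox N.
Proof.
move=> ha hb; rewrite mem_fbox; apply/supn_leP => i; rewrite !mxE.
have [] := cube_coord i ha; have [] := cube_coord i hb.
by move: (a ord0 i) (b ord0 i) => z w; lia.
Qed.

(** The normalised autocorrelation of the cube, that is the product of the (1 - |k_j| / N)_+. As a
    double sum it exhibits the kernel as N^(-d) |sum_(a in cube) e_a|^2, the form in which its
    differences factor. *)
Definition fejer_coef (k : freq) : R :=
  N%:R ^- d * \sum_(a <- cube) \sum_(b <- cube) (a - b == k)%:R.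

Let Nd0 : 0 < N%:R ^+ d :> R.
Proof. by rewrite exprn_gt0// ltr0n. Qed.

Lemma fejer_coef_ge0 k : 0 <= fejer_coef k.
Proof.
rewrite mulr_ge0 ?invr_ge0 ?(ltW Nd0)// sumr_ge0// => a _.
exact: sumr_ge0.
Qed.

Lemma fejer_coef_le1 k : fejer_coef k <= 1.
Proof.
rewrite /fejer_coef mulrC ler_pdivrMr// mul1r.
rewrite -natrX -size_cube -sum1_size natr_sum; apply: ler_sum => a _.
rewrite -natr_sum lern1.
rewrite (eq_bigr (fun b : freq => if b == a - k then 1%N else 0%N)); last first.
  by move=> b _; rewrite (can2_eq (subKr a) (subKr a)); case: eqP.
by rewrite -big_mkcond sum1_count count_uniq_mem ?uniq_cube// leq_b1.
Qed.

Lemma sum_fejer_coef : \sum_(k <- fbox N) fejer_coef k = N%:R ^+ d.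
Proof.
rewrite -mulr_sumr exchange_big /=.
rewrite (_ : \sum_(a <- cube) _ = \sum_(a <- cube) N%:R ^+ d); last first.
  rewrite big_seq [RHS]big_seq; apply: eq_bigr => a ha.
  rewrite exchange_big /= -natrX -size_cube -sum1_size natr_sum.
  rewrite big_seq [RHS]big_seq; apply: eq_bigr => b hb.
  rewrite (bigD1_seq (a - b)) ?uniq_fbox ?cubeB_mem//= eqxx big1 ?addr0// => k.
  by rewrite eq_sym => /negPf ->.
rewrite big_const_seq count_predT iter_addr_0 size_cube -[(_ ^+ d) *+ _]mulr_natl natrX.
by rewrite mulrA mulVf ?mul1r// gt_eqF.
Qed.

(** The weight om is there for difference operators, which multiply the coefficient at l by a power
    of [expk l h - 1]. *)
Lemma fejer_double (om : freq -> C) (x : pt) :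
  trigp (fun k => om k * (fejer_coef k)%:C) (fbox N) x =
  (N%:R ^- d)%:C * \sum_(a <- cube) \sum_(b <- cube)
     om (a - b) * (expk a x * conjc (expk b x)).
Proof.
rewrite /trigp /fejer_coef.
transitivity ((N%:R ^- d)%:C * \sum_(a <- cube) \sum_(b <- cube) \sum_(k <- fbox N)
   (a - b == k)%:R * (om k * expk k x)).
  rewrite mulr_sumr; under [RHS]eq_bigr do rewrite exchange_big mulr_sumr.
  rewrite [RHS]exchange_big; apply: eq_bigr => k _ /=.
  rewrite rmorphM /= -mulr_sumr.
  have -> : (\sum_(a <- cube) \sum_(b <- cube) (a - b == k)%:R)%:C =
      \sum_(a <- cube) \sum_(b <- cube) (a - b == k)%:R :> C.
    rewrite rmorph_sum; apply: eq_bigr => a _; rewrite rmorph_sum.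
    by apply: eq_bigr => b _; rewrite /= rmorph_nat.
  under [in RHS]eq_bigr do rewrite -mulr_suml.
  by rewrite -mulr_suml; ring.
congr (_ * _); rewrite big_seq [RHS]big_seq; apply: eq_bigr => a ha.
rewrite big_seq [RHS]big_seq; apply: eq_bigr => b hb.
rewrite (bigD1_seq (a - b)) ?uniq_fbox ?cubeB_mem//= eqxx big1 => [|k]; last first.
  by rewrite eq_sym => /negPf ->; rewrite mul0r.
by rewrite mul1r addr0 expkD expkN.
Qed.

Definition fejer (x : pt) : C := trigp (fun k => (fejer_coef k)%:C) (fbox N) x.

Section fejer_differences.
Variables (k : nat) (h : pt) (rho : R).
Hypothesis rho0 : 0 < rho.
Hypothesis hrho : forall l : freq, (supn l <= N)%N -> nc (expk l h - 1) <= rho.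

Let G := deltak k h fejer.

Lemma fejer_delta_sup x : nc (G x) <= rho ^+ k * N%:R ^+ d.
Proof.
rewrite /G deltak_trigp; apply: le_trans (normc_trigp _ _ _) _.
rewrite -sum_fejer_coef mulr_sumr big_seq [leRHS]big_seq; apply: ler_sum => l.
rewrite mem_fbox => hl; rewrite Normc.normcM normcX normcR.
rewrite (ger0_norm (fejer_coef_ge0 _)) ler_wpM2r ?fejer_coef_ge0//.
by rewrite lerXn2r ?nnegrE ?normc_ge0 ?(ltW rho0)// hrho.
Qed.

Let U j := trigp (fun a : freq => (expk a h - 1) ^+ j) cube : pt -> C.
Let W j := trigp (fun b : freq => conjc ((conjc (expk b h)) ^+ (k - j) *
   (conjc (expk b h) - 1) ^+ j)) cube : pt -> C.

(* With z = e_a(h) and w = conj(e_b(h)), expanding (z w - 1)^k around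
   z w - 1 = (z - 1) w + (w - 1) decouples the variables a and b. *)
Let GE x : G x = (N%:R ^- d)%:C *
  \sum_(j < k.+1) ('C(k, j))%:R * (U (k - j) x * conjc (W j x)).
Proof.
rewrite /G deltak_trigp fejer_double; congr (_ * _).
have E a b : (expk (a - b) h - 1) ^+ k = \sum_(j < k.+1) ('C(k, j))%:R *
    ((expk a h - 1) ^+ (k - j) * ((conjc (expk b h)) ^+ (k - j) * (conjc (expk b h) - 1) ^+ j)).
  rewrite expkD expkN (_ : _ - 1 = (expk a h - 1) * conjc (expk b h) +
     (conjc (expk b h) - 1)); last by ring.
  rewrite exprDn; apply: eq_bigr => j _; rewrite exprMn -[_ *+ _]mulr_natl; ring.
have cK (z : C) : conjc (conjc z) = z by case: z => u v; rewrite /= opprK.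
under eq_bigr do under eq_bigr do rewrite E mulr_suml.
under eq_bigr do rewrite exchange_big.
rewrite exchange_big; apply: eq_bigr => j _.
rewrite /U /W /trigp conjc_sum mulr_suml mulr_sumr; apply: eq_bigr => a _.
rewrite !mulr_sumr; apply: eq_bigr => b _.
by rewrite [conjc (conjc _ * _)]conjcM cK; ring.
Qed.

Let cubeL (c : freq -> C) L : 0 < L -> (forall a, a \in cube -> nc (c a) <= L) ->
  (Lpnorm 2 (trigp c cube) <= (L * N%:R `^ (d%:R / 2))%:E)%E.
Proof.
move=> L0 hc.
have NR : 0 < N%:R :> R by rewrite ltr0n.
have Q0 : 0 < L * N%:R `^ (d%:R / 2) by rewrite mulr_gt0// powR_gt0.
have := @nikolskii R d c cube 2 (N%:R ^+ d) (L * N%:R `^ (d%:R / 2)) (lexx _) uniq_cube.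
rewrite subrr powRr0 mul1r; apply => //.
  by rewrite size_cube natrX.
rewrite exprMn -[(_ `^ _) ^+ 2]powR_mulrn ?powR_ge0// -powRrM mulfVK ?pnatr_eq0// powR_mulrn ?(ltW NR)//.
apply: (@le_trans _ _ (\sum_(a <- cube) L ^+ 2)).
  rewrite big_seq [leRHS]big_seq; apply: ler_sum => a ha.
  by rewrite lerXn2r ?nnegrE ?normc_ge0 ?(ltW L0)// hc.
by rewrite big_const_seq count_predT iter_addr_0 size_cube -[(L ^+ 2) *+ _]mulr_natr natrX.
Qed.

(** Cauchy-Schwarz separates the two factors of each product in [GE], and Parseval bounds them by
    rho^(k-j) N^(d/2) and rho^j N^(d/2). The powers of N cancel against N^(-d), and the binomial
    coefficients sum to 2^k. *)
Lemma fejer_delta_L1 : intble (fun x => nc (G x)) /\ mean (fun x => nc (G x)) <= (2 * rho) ^+ k.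
Proof.
have NR : 0 < N%:R :> R by rewrite ltr0n.
have iG : intble (fun x => nc (G x)).
  by rewrite /G deltak_trigp; have [] := cintble_trigp
     (fun l => (expk l h - 1) ^+ k * (fejer_coef l)%:C) (fbox N).
split => //.
have hU j : (Lpnorm 2 (U j) <= (rho ^+ j * N%:R `^ (d%:R / 2))%:E)%E.
  apply: cubeL => [|a /cube_supn ha]; first exact: exprn_gt0.
  by rewrite normcX lerXn2r ?nnegrE ?normc_ge0 ?(ltW rho0)// hrho.
have hW j : (Lpnorm 2 (W j) <= (rho ^+ j * N%:R `^ (d%:R / 2))%:E)%E.
  apply: cubeL => [|b /cube_supn hb]; first exact: exprn_gt0.
  rewrite normc_conj Normc.normcM !normcX normc_conj normc_expk expr1n mul1r.
  rewrite -expkN lerXn2r ?nnegrE ?normc_ge0 ?(ltW rho0)// hrho// supnN//.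
have P0 j : 0 < rho ^+ j * N%:R `^ (d%:R / 2) by rewrite mulr_gt0 ?exprn_gt0 ?powR_gt0.
have half : 2^-1 + 2^-1 = 1 :> R by field.
have two0 : 0 < 2 :> R by [].
have hUW j := mean_mul_le two0 two0 half (P0 (k - j)%N) (P0 j)
  (cmeasurable_trigp _ _) (cmeasurable_trigp _ _) (hU (k - j)%N) (hW j).
have iUW j : intble (fun x => ('C(k, j))%:R * (nc (U (k - j) x) * nc (W j x))).
  by apply: intbleZ; have [] := hUW j.
apply: (@le_trans _ _ (mean (fun x => N%:R ^- d * \sum_(j < k.+1)
    ('C(k, j))%:R * (nc (U (k - j) x) * nc (W j x))))).
  apply: le_mean => //; first by apply: intbleZ; apply: intble_sum => j; exact: iUW.
  move=> x; rewrite GE Normc.normcM normcR ger0_norm ?invr_ge0 ?(ltW Nd0)//.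
  rewrite ler_wpM2l ?invr_ge0 ?(ltW Nd0)//; apply: le_trans (normc_sum _ _ _) _.
  apply: ler_sum => j _; rewrite !Normc.normcM normc_conj.
  rewrite (_ : nc ('C(k, j))%:R = ('C(k, j))%:R)//.
  by rewrite -(rmorph_nat (real_complex R)) normcR ger0_norm.
rewrite meanZ; last by apply: intble_sum => j; exact: iUW.
rewrite mulrC ler_pdivrMr// mean_sum; last by move=> j; exact: iUW.
apply: (@le_trans _ _ (\sum_(j < k.+1) ('C(k, j))%:R * (rho ^+ k * N%:R ^+ d))).
  apply: ler_sum => j _; rewrite meanZ; last by have [] := hUW j.
  rewrite ler_wpM2l//; have [_ /le_trans] := hUW j; apply; apply: eq_ler.
  rewrite mulrACA; congr (_ * _).
    by rewrite -exprD subnK// -ltnS.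
  rewrite -powRD; last by rewrite (gt_eqF NR) implybT.
  by rewrite -mulrDr half mulr1 powR_mulrn// ltW.
rewrite -mulr_suml -natr_sum exprMn -mulrA ler_wpM2r ?mulr_ge0 ?exprn_ge0 ?(ltW rho0)//.
have := Pascal 1 1 k; rewrite /= => E.
by rewrite -natrX (_ : (2 ^ k)%N = \sum_(i < k.+1) 'C(k, i)) // (_ : 2%N = (1 + 1)%N)// E;
  apply: eq_bigr => j _; rewrite !exp1n !muln1.
Qed.

(** Interpolation between L_1 and the sup norm: p - 1 of the p powers are bounded by
    [fejer_delta_sup]. *)
Lemma fejer_delta_Lp (p : R) : 1 < p ->
  (Lpnorm p G <= ((2 * rho) ^+ k * N%:R `^ (d%:R * (1 - p^-1)))%:E)%E.
Proof.
move=> p1; have p0 : 0 < p by lra.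
have NR : 0 < N%:R :> R by rewrite ltr0n.
have [iG mG] := fejer_delta_L1.
pose S := rho ^+ k * N%:R ^+ d.
have S0 : 0 < S by rewrite mulr_gt0// exprn_gt0.
have le1 x : nc (G x) `^ p <= S `^ (p - 1) * nc (G x).
  rewrite -mulr_powRB1 ?normc_ge0// mulrC ler_wpM2r ?normc_ge0//.
  apply: ler_powR2r; [by lra|exact: normc_ge0|exact: fejer_delta_sup].
have i2 : intble (fun x => S `^ (p - 1) * nc (G x)) by exact: intbleZ.
have i1 : intble (fun x => nc (G x) `^ p).
  apply: intble_le i2; last by move=> x; rewrite ger0_norm ?powR_ge0.
  apply: mble_powR_normc; rewrite /G deltak_trigp; exact: cmeasurable_trigp.
have r2 : 0 <= 2 * rho by rewrite mulr_ge0// ltW.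
apply: Lpnorm_le_mean => //; first by rewrite mulr_ge0 ?exprn_ge0 ?powR_ge0.
apply: le_trans (le_mean i1 i2 le1) _; rewrite meanZ//.
apply: le_trans (ler_wpM2l (powR_ge0 _ _) mG) _.
rewrite [leRHS]powRM ?exprn_ge0 ?powR_ge0//.
rewrite -powRrM (_ : d%:R * (1 - p^-1) * p = d%:R * (p - 1)); last by field; lra.
rewrite /S powRM ?exprn_ge0 ?(ltW rho0) ?(ltW NR)// -[N%:R ^+ d]powR_mulrn ?(ltW NR)// -powRrM.
rewrite mulrAC ler_wpM2r ?powR_ge0//.
rewrite -[leRHS]mulr_powRB1 ?exprn_ge0// [leRHS]mulrC ler_wpM2r ?exprn_ge0//.
apply: ler_powR2r; [by lra|by rewrite exprn_ge0// ltW|].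
by rewrite lerXn2r ?nnegrE ?(ltW rho0)// ler_peMl ?(ltW rho0)// ler1n.
Qed.

End fejer_differences.

End fejer_kernel.

(** * The integral over t in the Besov norm *)

Section dyadic_integral.
Context {R : realType}.

Lemma dyadic_exists (u : R) : 1 <= u -> exists j : nat, 2 ^+ j <= u /\ u < 2 ^+ j.+1.
Proof.
move=> u1; pose P j := 2 ^+ j <= u.
have P0 : exists j, P j by exists 0%N; rewrite /P expr0.
have Pb j : P j -> (j <= Num.truncn u)%N.
  rewrite /P => h; rewrite truncn_ge_nat; last by lra.
  by apply: le_trans h; rewrite -natrX ler_nat ltnW// ltn_expl.
case: (ex_maxnP P0 Pb) => j Pj maxj; exists j; split => //.
by rewrite ltNge; apply/negP => /maxj; rewrite ltnn.
Qed.

(** The integrand is dominated by constants on the intervals where L t lies in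
    [2^j, 2^(j+1)) or in (2^(-j-1), 2^(-j)]; each contributes at most 2^(-e j), whatever L is. *)
Lemma dyadic_integral (e L : R) : 0 < e -> 0 < L ->
  (\int[lebesgue_measure]_(t in [set t : R | (0 < t)%R])
    ((Num.min (L * t) (L * t)^-1) `^ e * t^-1)%:E <= (2 / (1 - 2 `^ (- e)))%:E)%E.
Proof.
move=> e0 L0; pose D := [set t : R | 0 < t].
have DE : D = `]0, +oo[%classic.
  by apply/seteqP; split => t; rewrite /D /= in_itv /= andbT.
have mD : measurable D by rewrite DE.
pose x := 2 `^ (- e); have x0 : 0 < x by rewrite powR_gt0.
have x1 : x < 1 by exact: pow2N_lt1.
pose Ap j := `[2 ^+ j / L, 2 ^+ j.+1 / L[%classic : set R.
pose Am j := `]2 ^- j.+1 / L, 2 ^- j / L]%classic : set R.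
pose gp j t := (x ^+ j * (L / 2 ^+ j) * \1_(Ap j) t) : R.
pose gm j t := (x ^+ j * (L * 2 ^+ j.+1) * \1_(Am j) t) : R.
have cp0 j : 0 <= x ^+ j * (L / 2 ^+ j).
  by rewrite mulr_ge0 ?exprn_ge0 ?divr_ge0 ?exprn_ge0 ?(ltW L0) ?(ltW x0).
have cm0 j : 0 <= x ^+ j * (L * 2 ^+ j.+1).
  by rewrite !mulr_ge0 ?exprn_ge0 ?(ltW L0) ?(ltW x0).
have gp0 j t : 0 <= gp j t by rewrite mulr_ge0.
have gm0 j t : 0 <= gm j t by rewrite mulr_ge0.
have mgp j : measurable_fun D (fun t => (gp j t)%:E).
  apply/measurable_EFinP; apply: measurable_funM; [exact: measurable_cst|by apply: measurable_indic; exact: measurable_itv].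
have mgm j : measurable_fun D (fun t => (gm j t)%:E).
  apply/measurable_EFinP; apply: measurable_funM; [exact: measurable_cst|by apply: measurable_indic; exact: measurable_itv].
have ind c a b b0 b1 : 0 <= c -> a <= b ->
   (\int[lebesgue_measure]_(t in D) (c * \1_([set` Interval (BSide b0 a) (BSide b1 b)]) t)%:E
     <= (c * (b - a))%:E)%E.
  move=> c0 ab; under eq_integral do rewrite EFinM.
  rewrite ge0_integralZl_EFin//; last first.
    by apply/measurable_EFinP; exact: measurable_indic.
  rewrite EFinM lee_wpmul2l ?lee_fin// integral_indic//.
  apply: (@le_trans _ _ (lebesgue_measure [set` Interval (BSide b0 a) (BSide b1 b)])).
    apply: le_measure; rewrite ?inE; [exact: measurableI|by []|].
    by move=> t [].
  rewrite lebesgue_measure_itv /= lte_fin; case: ifPn => _; first by rewrite -EFinB.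
  by rewrite lee_fin subr_ge0.
have pt_le t : D t -> (((Num.min (L * t) (L * t)^-1) `^ e * t^-1)%:E <=
    \sum_(0 <= j <oo) ((gp j t)%:E + (gm j t)%:E))%E.
  move=> t0; pose u := L * t; have u0 : 0 < u by rewrite mulr_gt0.
  have tE : t^-1 = L / u by rewrite /u; field; rewrite !lt0r_neq0.
  have key j : (((Num.min u u^-1) `^ e * t^-1)%:E <= (gp j t)%:E + (gm j t)%:E)%E ->
      (((Num.min u u^-1) `^ e * t^-1)%:E <= \sum_(0 <= j <oo) ((gp j t)%:E + (gm j t)%:E))%E.
    move=> h; apply: le_trans h (le_trans _ (nneseries_lim_ge j.+1 _)).
      rewrite big_nat_recr//= leeDr// sume_ge0// => i _.
      by rewrite adde_ge0 ?lee_fin.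
    by move=> i _; rewrite adde_ge0 ?lee_fin.
  have xj j : x ^+ j = (2 ^- j) `^ e.
    by rewrite /x powRN -powR_mulrn ?invr_ge0 ?powR_ge0// -!powRN -!powRrM
      -[2 ^+ j]powR_mulrn// -powRN -powRrM; congr (_ `^ _); ring.
  have [u1|u1] := leP 1 u.
    have [j [j1 j2]] := dyadic_exists u1; apply: (key j).
    apply: (@le_trans _ _ (gp j t)%:E); last by rewrite leeDl// lee_fin.
    have p2 : 0 < 2 ^+ j :> R by exact: exprn_gt0.
    rewrite lee_fin /gp indicE mem_set ?mulr1; last first.
      by rewrite /Ap /= in_itv /= ler_pdivrMr// ltr_pdivlMr// [t * L]mulrC j1 j2.
    rewrite xj ler_pM ?powR_ge0 ?invr_ge0 ?(ltW t0)//.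
      apply: ler_powR2r; first exact: ltW.
        by rewrite le_min (ltW u0) invr_ge0 ltW.
      by rewrite ge_min lef_pV2 ?posrE// j1 orbT.
    by rewrite tE ler_pM2l// lef_pV2 ?posrE.
  have v1 : 1 <= u^-1 by rewrite invf_ge1// ltW.
  have [j [j1 j2]] := dyadic_exists v1; apply: (key j).
  apply: (@le_trans _ _ (gm j t)%:E); last by rewrite leeDr// lee_fin.
  have p2 i : 0 < 2 ^+ i :> R by exact: exprn_gt0.
  have j1' : u <= 2 ^- j by rewrite -[u]invrK lef_pV2 ?posrE ?invr_gt0.
  have j2' : 2 ^- j.+1 < u by rewrite -[u]invrK ltf_pV2 ?posrE ?invr_gt0.
  rewrite lee_fin /gm indicE mem_set ?mulr1; last first.
    by rewrite /Am /= in_itv /= ltr_pdivrMr// ler_pdivlMr// [t * L]mulrC j1' j2'.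
  rewrite xj ler_pM ?powR_ge0 ?invr_ge0 ?(ltW t0)//.
    apply: ler_powR2r; first exact: ltW.
      by rewrite le_min (ltW u0) invr_ge0 ltW.
    by rewrite ge_min j1'.
  by rewrite tE ler_pM2l//; exact: ltW.
apply: (@le_trans _ _ (\int[lebesgue_measure]_(t in D)
   (\sum_(0 <= j <oo) ((gp j t)%:E + (gm j t)%:E)))%E).
  apply: ge0_le_integral_nomeas => // t t0.
  by rewrite lee_fin mulr_ge0 ?powR_ge0// invr_ge0 ltW.
rewrite integral_nneseries//; last 2 first.
- by move=> j; apply: emeasurable_funD; [exact: mgp|exact: mgm].
- by move=> j t _; rewrite adde_ge0 ?lee_fin.
apply: nneseries_le => [j|N].
  by apply: integral_ge0 => t _; rewrite adde_ge0 ?lee_fin.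
apply: (@le_trans _ _ (\sum_(0 <= j < N) (2 * x ^+ j)%:E)%E).
  apply: lee_sum => j _; rewrite ge0_integralD;
    [|by []|by move=> t _; rewrite lee_fin|exact: mgp|by move=> t _; rewrite lee_fin|exact: mgm].
  have p2 i : 0 < 2 ^+ i :> R by exact: exprn_gt0.
  rewrite mulr_natl mulr2n EFinD; apply: leeD.
    apply: le_trans (ind _ _ _ _ _ (cp0 j) _) _.
      by rewrite ler_pM2r ?invr_gt0// exprS ler_peMl ?(ltW (p2 j))// ler1n.
    by rewrite lee_fin; apply: eq_ler; rewrite exprS; field; rewrite !lt0r_neq0.
  apply: le_trans (ind _ _ _ _ _ (cm0 j) _) _.
    by rewrite ler_pM2r ?invr_gt0// lef_pV2 ?posrE// exprS ler_peMl ?(ltW (p2 j))// ler1n.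
  by rewrite lee_fin; apply: eq_ler; rewrite exprS; field; rewrite !lt0r_neq0.
rewrite sumEFin lee_fin -mulr_sumr ler_wpM2l//; exact: geo_sum.
Qed.

End dyadic_integral.

(** * A multiple of the Fejer kernel in the class *)

Section besov_fejer.
Context {R : realType} {d : nat}.
Local Open Scope complex_scope.
Local Notation pt := 'rV[R]_d.
Local Notation freq := 'rV[int]_d.
Local Notation C := R[i].
Local Notation nc := (@Normc.normc R).

Lemma deltakZ k h (c : C) (f : pt -> C) :
  deltak k h (fun x => c * f x) = fun x => c * deltak k h f x.
Proof.
elim: k => [//|k IH].
rewrite [LHS]/(diffop h (deltak k h (fun x => c * f x))) IH; apply/funext => x.
by rewrite [deltak k.+1 h f]/(diffop h (deltak k h f)) /diffop mulrBr.
Qed.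

(** With u = N t: the left side is u^(k-r) for u <= 1 and u^(-r) for u > 1, so r < k gives decay of
    the Besov integrand on both sides of t = 1/N. *)
Lemma min_pow_le (u r : R) (k : nat) : 0 < u -> 0 < r -> r < k%:R ->
  u `^ (- r) * (Num.min 1 u) ^+ k <=
  (Num.min u u^-1) `^ Num.min r (k%:R - r).
Proof.
move=> u0 r0 rk; set e := Num.min r _.
have [u1|u1] := leP u 1.
  have ui : u <= u^-1 by apply: (le_trans u1); rewrite invf_ge1.
  rewrite (min_l ui) -powR_mulrn ?(ltW u0)// -powRD; last first.
    by rewrite (gt_eqF u0) implybT.
  by apply: ger_powR; rewrite ?u0 ?u1// addrC /e ge_min lexx orbT.
have ui : u^-1 <= u by apply: le_trans (ltW u1); rewrite invf_le1// ltW.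
rewrite (min_r ui) expr1n mulr1 powRN -powR_inv1 ?powR_ge0// -powRrM.
rewrite -[in leRHS](powR_inv1 (ltW u0)) -powRrM.
apply: ler_powR; first exact: ltW.
by rewrite mulN1r mulrN1 lerN2 ge_min lexx.
Qed.

Lemma besov_fejer (r p : R) (theta : \bar R) k : (1 <= d)%N -> 1 < p ->
  0 < r -> r < k%:R -> (1 <= theta)%E ->
  exists2 c : R, 0 < c & forall N : nat, (0 < N)%N ->
   besov_class r p theta k
     (fun x : pt => (c * N%:R `^ (- r - d%:R + d%:R / p))%:C * @fejer R d N x).
Proof.
move=> d1 p1 r0 rk th1; have p0 : 0 < p by lra.
pose e := Num.min r (k%:R - r).
have e0 : 0 < e by rewrite lt_min r0 subr_gt0.
have x1 := pow2N_lt1 e0; have x0 : 0 < 2 `^ (- e) :> R by rewrite powR_gt0.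
pose I := 2 / (1 - 2 `^ (- e)) : R.
have I1 : 1 <= I by rewrite ler_pdivlMr ?mul1r; lra.
pose C1 := (4 * d%:R) ^+ k : R.
have dR : 1 <= d%:R :> R by rewrite ler1n.
have C11 : 1 <= C1 by rewrite exprn_ege1//; lra.
(* C1 comes from the difference estimate, I from the integral in t; the 2 leaves half of the unit
   norm to each of the two terms of [besov_norm]. *)
pose c := (2 * C1 * I)^-1.
have cI : c * C1 * I = 2^-1 by rewrite /c; field; rewrite !lt0r_neq0//; lra.
have C10 : 0 < C1 by exact: lt_le_trans C11.
have I0 : 0 < I by exact: lt_le_trans I1.
have c0 : 0 < c.
  by rewrite invr_gt0; apply: mulr_gt0 I0; exact: mulr_gt0.
have a0 : 0 <= c * C1 by rewrite mulr_ge0 ?(ltW c0) ?(ltW C10).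
have cC1 : c * C1 <= 2^-1 by rewrite -cI ler_peMr.
have c2 : c <= 2^-1 by apply: le_trans cC1; rewrite ler_peMr// ltW.
exists c => // N N0; have NR : 0 < N%:R :> R by rewrite ltr0n.
pose ga := c * N%:R `^ (- r - d%:R + d%:R / p).
have ga0 : 0 < ga by rewrite mulr_gt0// powR_gt0.
rewrite -/ga; set f := fun x : pt => _.
have mF : cmeasurable (@fejer R d N) by exact: cmeasurable_trigp.
have NE : ga * N%:R `^ (d%:R * (1 - p^-1)) = c * N%:R `^ (- r).
  rewrite /ga -mulrA -powRD; last by rewrite (gt_eqF NR) implybT.
  by congr (_ * _ `^ _); field; lra.
have N1 : N%:R `^ (- r) <= 1 :> R.
  by rewrite powRN invf_le1 ?powR_gt0// -[leLHS](powR1E r); apply: ler_powR2r;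
    rewrite ?(ltW r0)// ler1n.
have hLp : (Lpnorm p f <= 2^-1%:E)%E.
  (* Order 0 yields the L_p norm of the kernel itself; rho = 2 is a bound valid for all frequencies,
     and rho^0 = 1. *)
  have := @fejer_delta_Lp R d N N0 0 0 2 _ _ p p1.
  rewrite expr0 mul1r => /(_ _ _) h.
  have := @LpnormZ R d p _ ga%:C (@fejer R d N) p0 (powR_ge0 _ _) mF (h _ _).
  rewrite normcR ger0_norm ?(ltW ga0)// NE => /(_ _ _)/le_trans; apply => //.
    by move=> l _; exact: expk_sub1_le2.
  rewrite lee_fin; apply: le_trans c2; rewrite ler_piMr// ltW//.
have hom (t : R) : 0 < t -> (omega k f t p <=
    (c * C1 * N%:R `^ (- r) * (Num.min 1 (N%:R * t)) ^+ k)%:E)%E.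
  move=> t0; apply: ub_ereal_sup => _ [h /= ht <-].
  rewrite /f deltakZ.
  (* One rho covers both bounds on [expk l h - 1], by 2 and by 2 d N t; the first uses d >= 1. *)
  pose rho := 2 * d%:R * Num.min 1 (N%:R * t).
  have m0 : 0 < Num.min 1 (N%:R * t) by rewrite lt_min ltr01 mulr_gt0.
  have rho0 : 0 < rho by rewrite !mulr_gt0//; lra.
  have hr l : (supn l <= N)%N -> nc (expk l h - 1) <= rho.
    move=> hl; rewrite /rho; case: (leP 1 (N%:R * t)) => _.
      by apply: le_trans (expk_sub1_le2 _ _) _; rewrite mulr1 ler_peMr.
    apply: le_trans (expk_sub1_le h hl) _.
    by rewrite !ler_wpM2l// mulr_ge0.
  have h1 := @fejer_delta_Lp R d N N0 k h rho rho0 hr p p1.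
  have B0 : 0 <= (2 * rho) ^+ k * N%:R `^ (d%:R * (1 - p^-1)).
    by rewrite mulr_ge0 ?powR_ge0// exprn_ge0// mulr_ge0// ltW.
  apply: le_trans (LpnormZ _ p0 B0 (cmeasurable_deltak _ _ mF) h1) _.
  rewrite lee_fin normcR ger0_norm ?(ltW ga0)// mulrCA NE; apply: eq_ler.
  rewrite /rho /C1 !mulrA (_ : 2 * 2 = 4 :> R); last by ring.
  by rewrite exprMn; ring.
have hsup (t : R) : 0 < t -> ((t `^ (- r))%:E * omega k f t p <=
   (c * C1 * (Num.min (N%:R * t) (N%:R * t)^-1) `^ e)%:E)%E.
  move=> t0; apply: le_trans (lee_wpmul2l _ (hom t t0)) _.
    by rewrite lee_fin powR_ge0.
  rewrite -EFinM lee_fin.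
  rewrite [leLHS](_ : _ = c * C1 * ((N%:R * t) `^ (- r) * (Num.min 1 (N%:R * t)) ^+ k)).
    rewrite (ler_wpM2l a0)//.
    by apply: min_pow_le => //; rewrite mulr_gt0.
  by rewrite powRM ?(ltW NR) ?(ltW t0)//; ring.
have mlt (t : R) : 0 < t -> Num.min (N%:R * t) (N%:R * t)^-1 <= 1.
  move=> t0; have u0 : 0 < N%:R * t by rewrite mulr_gt0.
  have [u1|u1] := leP (N%:R * t) 1; first by rewrite ge_min u1.
  by rewrite ge_min invf_le1// (ltW u1) orbT.
have mgt (t : R) : 0 < t -> 0 < Num.min (N%:R * t) (N%:R * t)^-1.
  by move=> t0; rewrite lt_min invr_gt0 andbb mulr_gt0.
split; first by move=> x i; rewrite /f; congr (_ * _); exact: trigp_periodic.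
split; first by apply: cmeasurableM mF; exact: cmeasurable_cst.
rewrite /besov_norm (_ : 1%E = (2^-1)%:E + (2^-1)%:E :> \bar R)%E; last first.
  by rewrite -EFinD; congr (_%:E); field.
apply: leeD => //.
case: theta th1 => [th| |//] /= th1; last first.
  apply: ub_ereal_sup => _ [t /= t0 <-]; apply: le_trans (hsup t t0) _.
  rewrite lee_fin; apply: le_trans cC1; rewrite ler_piMr//.
  rewrite -[leRHS](powR1E e); apply: ler_powR2r; rewrite ?(ltW e0) ?(ltW (mgt _ t0))//; exact: mlt.
rewrite lee_fin in th1; have th0 : 0 < th by lra.
apply/poweR_leP => //.
  apply: integral_ge0 => t /= t0.
  by rewrite mule_ge0 ?poweR_ge0// lee_fin invr_ge0 ltW.
apply: (@le_trans _ _ (\int[lebesgue_measure]_(t in [set t : R | (0 < t)%R])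
   (((c * C1) `^ th)%:E * ((Num.min (N%:R * t) (N%:R * t)^-1) `^ e * t^-1)%:E))%E).
  apply: ge0_le_integral_nomeas => t /= t0.
    by rewrite mule_ge0 ?poweR_ge0// lee_fin invr_ge0 ltW.
  rewrite EFinM muleA lee_wpmul2r ?lee_fin ?invr_ge0 ?(ltW t0)//.
  apply: (@le_trans _ _ ((c * C1 * (Num.min (N%:R * t) (N%:R * t)^-1) `^ e)%:E `^ th)%E).
    apply: gt0_ler_poweR; [exact: ltW| | |exact: hsup].
    - by rewrite in_itv /= leey mule_ge0 ?lee_fin ?powR_ge0// omega_ge0// ltW.
    - by rewrite in_itv /= leey lee_fin mulr_ge0 ?powR_ge0.
  rewrite poweR_EFin powRM ?powR_ge0// EFinM lee_wpmul2l ?lee_fin ?powR_ge0//.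
  (* A number in (0, 1] does not grow under a power theta >= 1, so the integral is reduced to that
     of [dyadic_integral]. *)
  rewrite ge1r_powR// powR_gt0 ?mgt//=.
  rewrite -[leRHS](powR1E e); apply: ler_powR2r; rewrite ?(ltW e0) ?(ltW (mgt _ t0))//; exact: mlt.
rewrite ge0_integralZl_EFin ?powR_ge0//; last 3 first.
- rewrite (_ : [set t : R | 0 < t] = `]0, +oo[%classic)//.
  by apply/seteqP; split => t; rewrite /= in_itv /= andbT.
- by move=> t /= t0; rewrite lee_fin mulr_ge0 ?powR_ge0// invr_ge0 ltW.
- apply/measurable_EFinP; apply: (eq_measurable_fun (fun t : R =>
    (Num.min (N%:R * t) ((N%:R * t) `^ (-1))) `^ e * t `^ (-1))).
    move=> t; rewrite inE /= => t0.
    by rewrite !powR_inv1 ?mulr_ge0 ?(ltW t0) ?(ltW NR).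
  have mN : measurable_fun setT (fun t : R => N%:R * t) by exact: measurable_funM.
  apply: measurable_funTS; apply: measurable_funM; last exact: measurable_powR.
  apply: (measurableT_comp (measurable_powR e)).
  apply: measurable_minr => //.
  exact: (measurableT_comp (measurable_powR (-1))).
apply: le_trans (lee_wpmul2l _ (dyadic_integral e0 NR)) _.
  by rewrite lee_fin powR_ge0.
rewrite -EFinM lee_fin -/I -cI -[leRHS]/((c * C1 * I) `^ th).
rewrite [leRHS]powRM//; last by lra.
by rewrite ler_wpM2l ?powR_ge0// le1r_powR.
Qed.

End besov_fejer.

(** * Duality and the lower bound *)

Section lower_bound.
Context {R : realType} {d : nat}.
Local Open Scope complex_scope.
Local Notation pt := 'rV[R]_d.
Local Notation freq := 'rV[int]_d.
Local Notation C := R[i].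
Local Notation nc := (@Normc.normc R).

(** Extends [mean_mul_le] to A = 0, since some sigma_s may vanish: A is enlarged by e / B with e
    arbitrarily small. *)
Lemma pairing_le (q q' A B : R) (u v : pt -> C) : 0 < q -> 0 < q' ->
  q^-1 + q'^-1 = 1 -> 0 <= A -> 0 < B -> cmeasurable u -> cmeasurable v ->
  (Lpnorm q u <= A%:E)%E -> (Lpnorm q' v <= B%:E)%E ->
  `|complex.Re (cint (fun x => u x * conjc (v x)))| <= A * B.
Proof.
move=> q0 q'0 qq A0 B0 mu mv hu hv; apply/ler_addgt0Pr => e e0.
have eB : 0 < e / B by rewrite divr_gt0.
have A'0 : 0 < A + e / B by rewrite ltr_wpDl.
have hu' : (Lpnorm q u <= (A + e / B)%:E)%E.
  by apply: le_trans hu _; rewrite lee_fin lerDl ltW.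
have [iuv muv] := mean_mul_le q0 q'0 qq A'0 B0 mu mv hu' hv.
have nE x : nc (u x * conjc (v x)) = nc (u x) * nc (v x).
  by rewrite Normc.normcM normc_conj.
have ci : cintble (fun x => u x * conjc (v x)).
  apply: cintble_le iuv _; last by move=> x; rewrite nE.
  by apply: cmeasurableM mu _; exact: cmeasurable_conj.
have iR := cintble_Re ci.
have -> : A * B + e = (A + e / B) * B by rewrite mulrDl mulfVK// gt_eqF.
apply: le_trans muv; rewrite cintE /= ler_norml; apply/andP; split.
  rewrite lerNl -mulN1r -meanZ//; apply: le_mean => //; first exact: intbleZ.
  move=> x; rewrite mulN1r -nE; apply: le_trans (normc_Re _).
  by rewrite -normrN ler_norm.
by apply: le_mean => // x; rewrite -nE; apply: le_trans (normc_Re _); exact: ler_norm.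
Qed.

Lemma Lpnorm_trigp_le (q : R) (c : freq -> C) s : 0 < q ->
  (Lpnorm q (trigp c s : pt -> C) <= (\sum_(k <- s) nc (c k))%:E)%E.
Proof.
move=> q0; have S0 : 0 <= \sum_(k <- s) nc (c k) by apply: sumr_ge0 => k _; exact: normc_ge0.
apply/Lpnorm_leP => //; rewrite -(@torus_int_cst R d).
apply: ge0_le_torus_int => x; first by rewrite lee_fin powR_ge0.
by rewrite lee_fin; apply: ler_powR2r; [exact: ltW|exact: normc_ge0|exact: normc_trigp].
Qed.

Lemma fcoef_sigma s (g : pt -> C) k : Defs.periodic g -> cintble g ->
  fcoef (sigma_s s g) k = (lpmult s k)%:C * fcoef g k.
Proof.
move=> pg gi; rewrite (_ : sigma_s s g = trigp (fun k => (lpmult s k)%:C * fcoef g k)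
   (fbox (2 ^ s.+1))); last by apply/funext => x; exact: sigma_sE.
rewrite fcoef_trigp ?uniq_fbox// mem_fbox -lev_leE; case: leqP => // h.
by rewrite lpmult_eq0 ?mul0r// gtn_eqF// ltnW.
Qed.

(** The inequality u^q' <= 1 + u^2 for u = |P| / m^(1/2) compares L_q' with L_2, at the price of the
    factor 2. *)
Lemma low_dim_Lq (q' m : R) (c : freq -> C) s : 1 <= q' -> q' <= 2 -> 0 < m -> uniq s ->
  \sum_(k <- s) nc (c k) ^+ 2 <= m ->
  (Lpnorm q' (trigp c s : pt -> C) <= (2 * m `^ 2^-1)%:E)%E.
Proof.
move=> q1 q2 m0 us hm; have q0 : 0 < q' by lra.
pose T := m `^ 2^-1; have T0 : 0 < T by rewrite powR_gt0.
have TT : T ^+ 2 = m by rewrite -powR_mulrn ?(ltW T0)// powRVK// ltW.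
have i1 := intble_trigp_normc2 c s.
have i2 : intble (fun x => T `^ q' * (1 + m^-1 * nc (trigp c s x) ^+ 2)).
  by apply: intbleZ; apply: intbleD; [exact: intble_cst|exact: intbleZ].
have le1 x : nc (trigp c s x) `^ q' <= T `^ q' * (1 + m^-1 * nc (trigp c s x) ^+ 2).
  set P := nc _; have P0 : 0 <= P by exact: normc_ge0.
  have -> : P `^ q' = T `^ q' * (P / T) `^ q'.
    rewrite -powRM ?divr_ge0 ?(ltW T0)//; congr (_ `^ _).
    by rewrite mulrC mulfVK ?gt_eqF.
  rewrite ler_wpM2l ?powR_ge0//.
  have h0 : 0 <= m^-1 * P ^+ 2 by rewrite mulr_ge0 ?sqr_ge0// invr_ge0 ltW.
  have [h|h] := leP (P / T) 1.
    apply: (@le_trans _ _ 1); last by rewrite lerDl.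
    rewrite -[leRHS](powR1E q'); apply: ler_powR2r => //; first exact: ltW.
    by rewrite divr_ge0// ltW.
  apply: le_trans (ler_powR (ltW h) q2) _.
  rewrite powR_mulrn ?divr_ge0 ?(ltW T0)// expr_div_n TT [leLHS]mulrC lerDr.
  exact: ler01.
have i3 : intble (fun x => nc (trigp c s x) `^ q').
  apply: intble_le i2; first by apply: mble_powR_normc; exact: cmeasurable_trigp.
  by move=> x; rewrite ger0_norm ?powR_ge0.
apply: Lpnorm_le_mean => //; first by rewrite mulr_ge0// powR_ge0.
apply: le_trans (le_mean i3 i2 le1) _.
rewrite meanZ; last by apply: intbleD; [exact: intble_cst|exact: intbleZ].
rewrite meanD; [|exact: intble_cst|exact: intbleZ].
rewrite mean_cst meanZ// parseval// powRM ?powR_ge0// -/T mulrC ler_wpM2r ?powR_ge0//.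
apply: (@le_trans _ _ 2); last by rewrite le1r_powR// ler1n.
by have : m^-1 * \sum_(k <- s) nc (c k) ^+ 2 <= 1; [rewrite mulrC ler_pdivrMr// mul1r|lra].
Qed.

(** Cauchy-Schwarz in the linear form phi^2 >= 2 c phi - c^2, where c = 3^(-d) is at most the mean
    N^d / (2N + 1)^d of the coefficients. *)
Lemma fejer_coef_sum_sqr (N : nat) : (0 < N)%N ->
  N%:R ^+ d / 3 ^+ d <= \sum_(k <- fbox N) @fejer_coef R d N k ^+ 2.
Proof.
move=> N0; pose c : R := 3 ^- d.
have c0 : 0 < c by rewrite invr_gt0 exprn_gt0.
have cc : c * 3 ^+ d = 1 by rewrite mulVf// expf_neq0.
apply: (@le_trans _ _ (\sum_(k <- fbox N) (2 * c * @fejer_coef R d N k - c ^+ 2))).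
  rewrite sumrB -mulr_sumr sum_fejer_coef// big_const_seq count_predT iter_addr_0.
  rewrite size_fbox -[(c ^+ 2) *+ _]mulr_natr.
  have h : ((2 * N).+1 ^ d)%:R <= 3 ^+ d * N%:R ^+ d :> R.
    rewrite -exprMn -natrM natrX; have [->|d0] := posnP d; first by rewrite !expr0.
    by rewrite lerXn2r ?nnegrE// ler_nat; lia.
  have h2 := ler_wpM2l (sqr_ge0 c) h.
  have E : c ^+ 2 * (3 ^+ d * N%:R ^+ d) = c * N%:R ^+ d.
    rewrite [LHS](_ : _ = c * N%:R ^+ d * (c * 3 ^+ d)); last by ring.
    by rewrite cc mulr1.
  by rewrite E in h2; rewrite [leLHS]mulrC -/c; lra.
by apply: ler_sum => k _; have := sqr_ge0 (@fejer_coef R d N k - c); nra.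
Qed.

(** Each sigma_s of the error is paired with F - P and the results are added: the pairing sees only
    frequencies outside [Th], where the error has the coefficients of the kernel, and there the
    multipliers of the sigma_s sum to 1. *)
Lemma lower_pairing (q ga : R) (m N : nat) (kk : 'I_m -> freq) (cc : 'I_m -> C) :
  2 < q -> 0 < ga -> (0 < m)%N -> (0 < N)%N -> injective kk ->
  ((ga * (N%:R ^+ d / 3 ^+ d - m%:R) / (N%:R `^ (d%:R / q) + 2 * m%:R `^ 2^-1))%:E <=
   Bq1norm q (fun x : pt => (ga%:C * @fejer R d N x - tpoly kk cc x)%R))%E.
Proof.
move=> q2 ga0 m0 N0 kinj; have q0 : 0 < q by lra.
pose Th := [seq kk j | j <- enum 'I_m].
have uTh : uniq Th by rewrite map_inj_uniq ?enum_uniq.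
have sTh : size Th = m by rewrite size_map -cardE card_ord.
pose b k := \sum_(j < m | kk j == k) cc j.
have tE : tpoly kk cc = trigp b Th.
  apply/funext => x; rewrite /tpoly /trigp big_map big_enum /=.
  apply: eq_bigr => j _; congr (_ * _); rewrite /b (big_pred1 j)// => i /=.
  by rewrite (inj_eq kinj).
pose ph := fun k : freq => (@fejer_coef R d N k)%:C : C.
set g := fun x : pt => _.
have gE : g = fun x => trigp (fun k => ga%:C * ph k) (fbox N) x - trigp b Th x.
  by apply/funext => x; rewrite /g tE trigpZ.
have pg : Defs.periodic g by move=> x i; rewrite gE !trigp_periodic.
have gi : cintble g.
  by rewrite gE; apply: cintbleD (cintble_trigp _ _) (cintbleN (cintble_trigp _ _)).
have gc k : k \in fbox N -> k \notin Th -> fcoef g k = (ga * @fejer_coef R d N k)%:C.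
  move=> kN kT; rewrite gE fcoefB; try exact: cintble_trigp.
  by rewrite !fcoef_trigp ?uniq_fbox// kN (negbTE kT) subr0 rmorphM.
pose s1 := [seq k <- fbox N | k \notin Th]; pose s2 := [seq k <- fbox N | k \in Th].
have us2 : uniq s2 by rewrite filter_uniq// uniq_fbox.
pose X := \sum_(k <- s1) ga * @fejer_coef R d N k ^+ 2.
pose q' := q / (q - 1).
have q'1 : 1 < q' by rewrite ltr_pdivlMr; lra.
have q'2 : q' <= 2 by rewrite ler_pdivrMr; lra.
have qq : q^-1 + q'^-1 = 1 by rewrite /q'; field; lra.
have q'0 : 0 < q' by lra.
pose Y1 := N%:R `^ (d%:R / q) : R; pose Y2 := 2 * m%:R `^ 2^-1 : R.
have NR : 0 < N%:R :> R by rewrite ltr0n.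
have mR : 0 < m%:R :> R by rewrite ltr0n.
have Y10 : 0 < Y1 by rewrite powR_gt0.
have Y20 : 0 < Y2 by rewrite mulr_gt0// powR_gt0.
have hF : (Lpnorm q' (trigp ph (fbox N)) <= Y1%:E)%E.
  have := @fejer_delta_Lp R d N N0 0 0 2 (ltr0n _ 2) (fun l _ => expk_sub1_le2 l 0) q' q'1.
  rewrite expr0 mul1r /Y1 (_ : d%:R * (1 - q'^-1) = d%:R / q)//.
  by rewrite -qq addrK.
have phle k : nc (ph k) ^+ 2 <= 1.
  by rewrite normcR ger0_norm ?fejer_coef_ge0// expr_le1// ?fejer_coef_le1// fejer_coef_ge0.
have ss2 : (size s2 <= m)%N.
  rewrite -sTh; apply: uniq_leq_size us2 _ => k; by rewrite mem_filter => /andP[].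
have hsum2 : \sum_(k <- s2) nc (ph k) ^+ 2 <= m%:R.
  apply: (@le_trans _ _ (\sum_(k <- s2) 1)); first by apply: ler_sum.
  by rewrite big_const_seq count_predT iter_addr_0 ler_nat.
have hP : (Lpnorm q' (trigp ph s2) <= Y2%:E)%E by apply: low_dim_Lq => //; exact: ltW.
pose L s := fine (Lpnorm q (sigma_s s g)).
have sE s : sigma_s s g = trigp (fun k => (lpmult s k)%:C * fcoef g k) (fbox (2 ^ s.+1)).
  by apply/funext => x; exact: sigma_sE.
have Lfin s : Lpnorm q (sigma_s s g) = (L s)%:E.
  rewrite /L fineK// ge0_fin_numE ?Lpnorm_ge0//.
  by apply: le_lt_trans (ltry _); rewrite sE; exact: Lpnorm_trigp_le.
have L0 s : 0 <= L s by rewrite fine_ge0 ?Lpnorm_ge0.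
have sm s : cmeasurable (sigma_s s g) by rewrite sE; exact: cmeasurable_trigp.
have si s : cintble (sigma_s s g) by rewrite sE; exact: cintble_trigp.
have key s : \sum_(k <- s1) lpmult s k * (ga * @fejer_coef R d N k ^+ 2) <= L s * (Y1 + Y2).
  have hq s' : \sum_(k <- s') fcoef (sigma_s s g) k * conjc (ph k) =
      cint (fun x => sigma_s s g x * conjc (trigp ph s' x)) by rewrite cint_mul_trigp.
  have E : \sum_(k <- s1) fcoef (sigma_s s g) k * conjc (ph k) =
     cint (fun x => sigma_s s g x * conjc (trigp ph (fbox N) x)) -
     cint (fun x => sigma_s s g x * conjc (trigp ph s2 x)).
    rewrite -!hq [X in X - _](bigID (mem Th)) /= /s1 /s2 !big_filter; ring.
  have Hs : (Lpnorm q (sigma_s s g) <= (L s)%:E)%E by rewrite Lfin.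
  have h1 := pairing_le q0 q'0 qq (L0 s) Y10 (sm s) (cmeasurable_trigp ph (fbox N)) Hs hF.
  have h2 := pairing_le q0 q'0 qq (L0 s) Y20 (sm s) (cmeasurable_trigp ph s2) Hs hP.
  have -> : \sum_(k <- s1) lpmult s k * (ga * @fejer_coef R d N k ^+ 2) =
      complex.Re (\sum_(k <- s1) fcoef (sigma_s s g) k * conjc (ph k)).
    rewrite Re_sum big_seq [RHS]big_seq; apply: eq_bigr => k.
    rewrite mem_filter => /andP[kT kN].
    by rewrite fcoef_sigma// gc// /ph /= !(mul0r, mulr0, oppr0, subr0, addr0); ring.
  rewrite E ReD ReN mulrDr; apply: lerD; first exact: le_trans (ler_norm _) h1.
  by apply: le_trans h2; rewrite -normrN ler_norm.
(* The multipliers telescope to the cut-off at 2^N, which is 1 on [fbox N] because N <= 2^N. *)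
have XE : X = \sum_(0 <= s < N.+1) \sum_(k <- s1) lpmult s k * (ga * @fejer_coef R d N k ^+ 2).
  rewrite exchange_big /= /X big_seq [RHS]big_seq; apply: eq_bigr => k.
  rewrite mem_filter mem_fbox => /andP[_ kN].
  rewrite -mulr_suml lpmult_sum etad_eq1 ?mul1r ?expn_gt0//.
  by apply: leq_trans kN _; apply: ltnW; exact: ltn_expl.
have YY : 0 < Y1 + Y2 by exact: addr_gt0.
have X1 : X / (Y1 + Y2) <= \sum_(0 <= s < N.+1) L s.
  by rewrite ler_pdivrMr// XE mulr_suml; apply: ler_sum => s _; exact: key.
have X2 : ga * (N%:R ^+ d / 3 ^+ d - m%:R) <= X.
  rewrite /X -mulr_sumr ler_pM2l//.
  have hsplit : \sum_(k <- fbox N) @fejer_coef R d N k ^+ 2 =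
      \sum_(k <- s2) @fejer_coef R d N k ^+ 2 + \sum_(k <- s1) @fejer_coef R d N k ^+ 2.
    by rewrite (bigID (mem Th)) /s1 /s2 !big_filter.
  have h := fejer_coef_sum_sqr N0; rewrite hsplit in h.
  have h2 : \sum_(k <- s2) @fejer_coef R d N k ^+ 2 <= m%:R.
    apply: le_trans hsum2; apply: ler_sum => k _.
    by rewrite normcR real_normK ?num_real.
  lra.
apply: (@le_trans _ _ (\sum_(0 <= s < N.+1) L s)%:E).
  rewrite lee_fin; apply: le_trans X1; rewrite ler_wpM2r// invr_ge0 ltW//.
rewrite -sumEFin /Bq1norm; apply: le_trans (nneseries_lim_ge N.+1 _).
  by apply: lee_sum => s _; rewrite Lfin.
by move=> s *; exact: Lpnorm_ge0.
Qed.

(** Under 2 * 3^d m <= N^d the m removed frequencies cost at most half of N^d / 3^d. *)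
Lemma lower_bound (r p q : R) (theta : \bar R) k : (1 <= d)%N -> 1 < p -> 2 < q ->
  0 < r -> r < k%:R -> (1 <= theta)%E ->
  exists2 c : R, 0 < c & forall m N : nat, (0 < m)%N -> (0 < N)%N ->
   2 * 3 ^+ d * m%:R <= N%:R ^+ d :> R ->
   ((c * N%:R `^ (d%:R / p - r) / (N%:R `^ (d%:R / q) + 2 * m%:R `^ 2^-1))%:E <=
    em_class q m (@besov_class R d r p theta k))%E.
Proof.
move=> d1 p1 q2 r0 rk th1.
have [c c0 hc] := @besov_fejer R d r p theta k d1 p1 r0 rk th1.
have t3 : 0 < 3 ^+ d :> R by exact: exprn_gt0.
exists (c / (2 * 3 ^+ d)); first by rewrite divr_gt0// mulr_gt0.
move=> m N m0 N0 hN; have NR : 0 < N%:R :> R by rewrite ltr0n.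
pose ga := c * N%:R `^ (- r - d%:R + d%:R / p).
have ga0 : 0 < ga by rewrite mulr_gt0// powR_gt0.
apply: (@le_trans _ _ (em_fun q m (fun x : pt => ga%:C * @fejer R d N x))); last first.
  by apply: ereal_sup_ubound; exists (fun x : pt => ga%:C * @fejer R d N x) => //; exact: hc.
apply: le_ereal_inf_tmp => _ [kk [cc [kinj ->]]].
apply: le_trans (lower_pairing cc q2 ga0 m0 N0 kinj); rewrite lee_fin.
have Y0 : 0 < N%:R `^ (d%:R / q) + 2 * m%:R `^ 2^-1 :> R.
  by rewrite addr_gt0 ?mulr_gt0 ?powR_gt0// ltr0n.
rewrite ler_wpM2r ?invr_ge0 ?(ltW Y0)//.
apply: (@le_trans _ _ (ga * (N%:R ^+ d / (2 * 3 ^+ d)))).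
  have -> : N%:R `^ (d%:R / p - r) = N%:R `^ (- r - d%:R + d%:R / p) * N%:R ^+ d.
    rewrite -[N%:R ^+ d]powR_mulrn ?(ltW NR)// -powRD; last by rewrite (gt_eqF NR) implybT.
    by congr (_ `^ _); ring.
  by apply: eq_ler; rewrite /ga; field; exact: lt0r_neq0.
rewrite ler_pM2l// lerBrDr.
have -> : N%:R ^+ d / 3 ^+ d = N%:R ^+ d / (2 * 3 ^+ d) + N%:R ^+ d / (2 * 3 ^+ d) :> R.
  by field; exact: lt0r_neq0.
by rewrite lerD2l ler_pdivlMr ?mulr_gt0// mulrC.
Qed.

(** Here N ~ m^e. The condition 1/d <= e lets N^d dominate m, and d e / q <= 1/2 keeps N^(d/q)
    within O(m^(1/2)), so that m^(1/2) governs the denominator. *)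
Lemma lower_order (r p q e tau : R) (theta : \bar R) k : (1 <= d)%N -> 1 < p -> 2 < q ->
  0 < r -> r < k%:R -> (1 <= theta)%E -> d%:R^-1 <= e -> d%:R * e / q <= 2^-1 ->
  tau = (d%:R / p - r) * e - 2^-1 ->
  exists2 C1 : R, 0 < C1 & forall m, (0 < m)%N ->
    ((C1 * m%:R `^ tau)%:E <= em_class q m (@besov_class R d r p theta k))%E.
Proof.
move=> d1 p1 q2 r0 rk th1 e1 e2 tauE.
have [c c0 hc] := @lower_bound r p q theta k d1 p1 q2 r0 rk th1.
have dR : 0 < d%:R :> R by rewrite ltr0n.
have d0 : d%:R != 0 :> R by exact: lt0r_neq0.
(* Chosen so that H^d >= 2 * 3^d. *)
pose H : R := 2 * 3.
have H0 : 0 < H by rewrite /H mulr_gt0.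
have H1 : 1 <= H by rewrite /H; lra.
have e0 : 0 < e by apply: lt_le_trans e1; rewrite invr_gt0.
pose al := d%:R / p - r.
pose K := (2 * H) `^ (d%:R / q) + 2 : R.
have K0 : 0 < K by rewrite addr_gt0// powR_gt0// mulr_gt0.
(* The sign of al is not fixed, so N^al is bounded below through either the lower or the upper
   estimate of N. *)
pose B := Num.min (H `^ al) ((2 * H) `^ al).
have B0 : 0 < B by rewrite lt_min !powR_gt0// mulr_gt0.
exists (c * B / K); first by rewrite divr_gt0// mulr_gt0.
move=> m m0; have mR : 1 <= m%:R :> R by rewrite ler1n.
have mR0 : 0 < m%:R :> R by lra.
pose M := m%:R `^ e : R.
have M1 : 1 <= M by rewrite -[leLHS](powR1E e); apply: ler_powR2r; rewrite ?(ltW e0).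
have M0 : 0 < M by lra.
have HM0 : 0 <= H * M by exact: mulr_ge0 (ltW H0) (ltW M0).
have H20 : 0 <= 2 * H by exact: mulr_ge0 (ler0n _ 2) (ltW H0).
pose N := (Num.truncn (H * M)).+1.
have Nl : H * M <= N%:R by apply: ltW; exact: truncnS_gt.
have Nu : N%:R <= 2 * H * M.
  apply: (@le_trans _ _ (H * M + 1)).
    by rewrite /N -(natr1 (Num.truncn _)) lerD2r truncn_le.
  have : 1 <= H * M by rewrite mulr_ege1.
  by rewrite -mulrA; lra.
have NR : 0 < N%:R :> R by rewrite ltr0n.
have hN : 2 * 3 ^+ d * m%:R <= N%:R ^+ d :> R.
  apply: (@le_trans _ _ ((H * M) ^+ d)); last first.
    by rewrite lerXn2r ?nnegrE.
  rewrite exprMn; apply: ler_pM => //.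
  - rewrite /H exprMn ler_wpM2r ?exprn_ge0//.
    by rewrite -{1}[2]expr1 ler_weXn2l// ler1n.
  - rewrite /M -powR_mulrn ?powR_ge0// -powRrM -[leLHS]powRr1 ?(ltW mR0)//.
    by apply: ler_powR => //; rewrite mulrC -ler_pdivrMl// mulr1.
apply: le_trans (hc m N m0 isT hN); rewrite lee_fin.
have hnum : B * M `^ al <= N%:R `^ al.
  have [a0|a0] := leP 0 al.
    apply: (@le_trans _ _ ((H * M) `^ al)).
      by rewrite powRM ?(ltW H0) ?(ltW M0)// ler_wpM2r ?powR_ge0// ge_min lexx.
    exact: ler_powR2r.
  apply: (@le_trans _ _ ((2 * H * M) `^ al)).
    by rewrite powRM ?(ltW M0)// ler_wpM2r ?powR_ge0// ge_min lexx orbT.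
  rewrite -[al]opprK !(powRN _ (- al)) lef_pV2 ?posrE ?powR_gt0// ?mulr_gt0//.
  by apply: ler_powR2r => //; rewrite ?oppr_ge0 ltW.
have hden : N%:R `^ (d%:R / q) + 2 * m%:R `^ 2^-1 <= K * m%:R `^ 2^-1.
  rewrite /K [leRHS]mulrDl lerD2r.
  have dq : 0 <= d%:R / q by rewrite divr_ge0//; lra.
  apply: (@le_trans _ _ ((2 * H * M) `^ (d%:R / q))).
    by apply: ler_powR2r => //; exact: ltW.
  rewrite powRM ?(ltW M0)// ler_wpM2l ?powR_ge0// /M -powRrM.
  by apply: ler_powR => //; apply: le_trans e2; apply: eq_ler; ring.
have Y0 : 0 < N%:R `^ (d%:R / q) + 2 * m%:R `^ 2^-1 :> R.
  by rewrite addr_gt0 ?mulr_gt0 ?powR_gt0.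
rewrite ler_pdivlMr//.
apply: (@le_trans _ _ (c * B / K * m%:R `^ tau * (K * m%:R `^ 2^-1))).
  by rewrite ler_wpM2l// !mulr_ge0 ?powR_ge0 ?invr_ge0 ?(ltW c0) ?(ltW B0) ?(ltW K0).
rewrite [leLHS](_ : _ = c * (B * (m%:R `^ tau * m%:R `^ 2^-1))); last first.
  by field; exact: lt0r_neq0.
rewrite -powRD; last by rewrite (gt_eqF mR0) implybT.
rewrite tauE subrK -/al [al * e]mulrC powRrM ler_pM2l//.
Qed.

End lower_bound.

Theorem theorem1 (R : realType) (d : nat) (p q r : R) (theta : \bar R) (k : nat) :
  (1 <= d)%N -> 1 < p -> p <= 2 -> 2 < q -> (1 <= theta)%E ->
  0 < r -> r < k%:R ->
  ((d%:R * (p^-1 - q^-1) < r < d%:R / p) ->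
     asymp (fun m : nat => (m%:R : R) `^ (- (q / 2) * (r / d%:R - p^-1 + q^-1)))
           (fun m : nat => em_class q m (@besov_class R d r p theta k)))
  /\
  (d%:R / p < r ->
     asymp (fun m : nat => (m%:R : R) `^ (- (r / d%:R) + p^-1 - 2^-1))
           (fun m : nat => em_class q m (@besov_class R d r p theta k))).
Proof.
move=> d1 p1 p2 q2 th1 r0 rk.
have dR : 1 <= d%:R :> R by rewrite ler1n.
have d0 : 0 < d%:R :> R by lra.
split=> [/andP[hr1 hr2]|hr].
  have [C2 C20 hup] := @upper_small R d r p q theta k d1 p1 p2 q2 r0 th1 hr1 hr2.
  (* For r < d/p the exponent increases with e, so the largest admissible e is taken; N^(d/q) and
     m^(1/2) then have the same order. *)
  have [|||C1 C10 hlo] := @lower_order R d r p q (q / (2 * d%:R))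
    (- (q / 2) * (r / d%:R - p^-1 + q^-1)) theta k d1 p1 q2 r0 rk th1.
  - by rewrite ler_pdivlMr ?mulr_gt0// mulrCA mulVf ?mulr1 ?ltW// lt0r_neq0.
  - by apply: eq_ler; field; rewrite !lt0r_neq0//; lra.
  - by field; rewrite !lt0r_neq0//; lra.
  exists C1, C2; split => //; split => // m m0.
  by split; [exact: hlo|exact: hup].
have [C2 C20 hup] := @upper_large R d r p q theta k d1 p1 p2 q2 r0 th1 hr.
(* For r > d/p the exponent decreases with e, so the smallest admissible e is taken. *)
have [|||C1 C10 hlo] := @lower_order R d r p q d%:R^-1
  (- (r / d%:R) + p^-1 - 2^-1) theta k d1 p1 q2 r0 rk th1.
- by [].
- by rewrite mulfV ?lt0r_neq0// mul1r lef_pV2 ?posrE; lra.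
- by field; rewrite !lt0r_neq0//; lra.
exists C1, C2; split => //; split => // m m0.
by split; [exact: hlo|exact: hup].
Qed.
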